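(* Let $\mathbb{K}$ be a field of characteristic $0$ and let $G$ be a finite abelian group acting diagonally on $V=\mathbb{K}^n$. (i) The universal enveloping algebra $\mathcal{U}(L)$ of any Yetter-Drinfeld $(A,\epsilon)$-color Lie ring $L=V\otimes\mathbb{K}G$ over $\mathbb{K}G$ with purely positive part (for any abelian group $A$ and antisymmetric bicharacter $\epsilon$ on $A$) is isomorphic to a quantum Drinfeld orbifold algebra $\mathcal{H}_{\mathbf{q},\kappa}$, for some quantum system of parameters $\mathbf{q}$ and some parameter function $\kappa:V\times V\to V\otimes\mathbb{K}G$ (defined relative to some basis of $V$ on which $G$ acts diagonally). (ii) Any quantum Drinfeld orbifold algebra $\mathcal{H}_{\mathbf{q},\kappa}$ with $\kappa:V\times V\to V\otimes\mathbb{K}G$ satisfying the strong vanishing condition is isomorphic to the universal enveloping algebra of some Yetter-Drinfeld $(A,\epsilon)$-color Lie ring $L=V\otimes\mathbb{K}G$ with purely positive part (for some abelian group $A$ and antisymmetric bicharacter $\epsilon$ on $A$).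
   Context: Conventions: $\otimes=\otimes_{\mathbb{K}}$; ${}^gv$ is the action of $g\in G$ on $v\in V$; $\mathbb{N}$ contains $0$; isomorphisms are of $\mathbb{K}$-algebras. Quantum Drinfeld orbifold algebras. Let $v_1,\dots,v_n$ be a basis of $V$ on which $G$ acts diagonally. A quantum system of parameters is a set $\mathbf{q}=\{q_{ij}\}_{1\le i,j\le n}$ of nonzero scalars in $\mathbb{K}$ with $q_{ii}=1$ and $q_{ji}=q_{ij}^{-1}$. A parameter function is a bilinear map $\kappa:V\times V\to V\otimes\mathbb{K}G$ with $\kappa(v_i,v_j)=-q_{ij}\,\kappa(v_j,v_i)$ for all $i,j$. Let $T(V)$ be the tensor algebra and $T(V)\rtimes G$ the skew group algebra, i.e. $T(V)\otimes\mathbb{K}G$ with product $(r\,g)(s\,h)=r({}^gs)\,gh$; $V\otimes\mathbb{K}G$ is viewed as a subspace of it. Put $$\mathcal{H}_{\mathbf{q},\kappa}=(T(V)\rtimes G)/\big(v_iv_j-q_{ij}v_jv_i-\kappa(v_i,v_j):1\le i,j\le n\big).$$ It satisfies the PBW property if the image of $\{v_1^{m_1}\cdots v_n^{m_n}g: m_i\in\mathbb{N},g\in G\}$ is a $\mathbb{K}$-basis of $\mathcal{H}_{\mathbf{q},\kappa}$; in that case $\mathcal{H}_{\mathbf{q},\kappa}$ is called a quantum Drinfeld orbifold algebra. The strong vanishing condition: for all $g\in G$ and all $1\le i,j,k,r\le n$ (not necessarily distinct), ${}^gv_k=q_{ik}q_{jk}q_{kr}\,v_k$ whenever the coefficient of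 $v_r\otimes g$ in $\kappa(v_i,v_j)$ is nonzero. Color Lie rings. Let $A$ be an abelian group (written multiplicatively). A bicharacter is a map $\epsilon:A\times A\to\mathbb{K}^*$ with $\epsilon(a,bc)=\epsilon(a,b)\epsilon(a,c)$, $\epsilon(ab,c)=\epsilon(a,c)\epsilon(b,c)$; it is antisymmetric if $\epsilon(b,a)=\epsilon(a,b)^{-1}$. Let $R=\bigoplus_{a\in A}R_a$ be an $A$-graded $\mathbb{K}$-algebra; an $A$-graded $R$-bimodule is an $R$-bimodule $L=\bigoplus_aL_a$ with $R_aL_bR_c\subset L_{abc}$. For $0\ne x$ in the degree-$a$ part write $|x|=a$ ($x$ is $A$-homogeneous); $|0|=1_A$. If $R=\mathbb{K}G$, each $g\in G$ is assumed $A$-homogeneous. An $(A,\epsilon)$-color Lie ring over $R$ is an $A$-graded $R$-bimodule $L$ with an $R$-bilinear, $R$-balanced operation $[\,,\,]:L\times L\to L$ (i.e. $\mathbb{K}$-bilinear with $[rx,ys]=r[x,y]s$ and $[xr,y]=[x,ry]$ for $r,s\in R$) such that for all $A$-homogeneous $x,y,z$: $[x,y]\in L_{|x||y|}$; $[x,y]=-\epsilon(|x|,|y|)[y,x]$; and $\epsilon(|z|,|x|)[x,[y,z]]+\epsilon(|x|,|y|)[y,[z,x]]+\epsilon(|y|,|z|)[z,[x,y]]=0$. Its universal enveloping algebra is $\mathcal{U}(L)=T_R(L)/J$, where $T_R(L)=\bigoplus_{m\ge0}L^{\otimes_Rm}$ and $J$ is the ideal generated by all $u\otimes_Rv-\epsilon(|u|,|v|)\,v\otimes_Ru-[u,v]$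 with $u,v\in L$ $A$-homogeneous. The space $L=V\otimes\mathbb{K}G$ is a $\mathbb{K}G$-bimodule via $g(v\otimes h)g'={}^gv\otimes ghg'$. An $(A,\epsilon)$-color Lie ring structure on $L=V\otimes\mathbb{K}G$ over $\mathbb{K}G$ (with this bimodule structure) is Yetter-Drinfeld if (a) the $A$-grading on $L$ is induced from $A$-gradings on $V$ and $G$: $|v\otimes g|=|v||g|$ for $g\in G$ and $A$-homogeneous $v\in V$; and (b) ${}^gv=\epsilon(|g|,|v|)\,v$ for all $g\in G$ and $A$-homogeneous $v\in V$. It has purely positive part if $\epsilon(|v|,|v|)=1$ for every nonzero $A$-homogeneous $v\in V$.
   Formalization: Part (i) assumes in addition that ε(|g|,|h|)=1 for all g,h in G; without it (i) fails whenever V≠0, e.g. G of order 2, V=K with trivial action and degree, zero bracket, ε(|g|,|g|)=-1 forces v²=0 in U(L). *)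

(* Defs.v *)
From HB Require Import structures.
From mathcomp Require Import all_boot all_order all_algebra all_fingroup.
From mathcomp Require Import generic_quotient ring_quotient sesquilinear.
From mathcomp Require Import mxrepresentation.
From mathcomp Require Import finmap boolp monalg.

Set Implicit Arguments.
Unset Strict Implicit.
Unset Printing Implicit Defensive.
Import GRing.Theory.
Local Open Scope ring_scope.
Local Open Scope quotient_scope.

Section LinearFacts.
Variables (K : fieldType) (U V : lmodType K) (f : U -> V).
Hypothesis lf : linear f.

Lemma linfD x y : f (x + y) = f x + f y.
Proof. by have := lf 1 x y; rewrite !scale1r. Qed.
Lemma linf0 : f 0 = 0.
Proof. by apply: (addrI (f 0)); rewrite -linfD !addr0. Qed.
Lemma linfZ a x : f (a *: x) = a *: f x.
Proof. by have := lf a x 0; rewrite linf0 !addr0. Qed.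
Lemma linf_sum I (r : seq I) (F : I -> U) :
  f (\sum_(i <- r) F i) = \sum_(i <- r) f (F i).
Proof.
by elim: r => [|i r IH]; rewrite ?big_nil ?linf0 // !big_cons linfD IH.
Qed.
Lemma linfN x : f (- x) = - f x.
Proof. by rewrite -scaleN1r linfZ scaleN1r. Qed.
Lemma linfB x y : f (x - y) = f x - f y.
Proof. by rewrite linfD linfN. Qed.
End LinearFacts.

Section LinearFacts2.
Variable K : fieldType.

Lemma linear_comp (U V W : lmodType K) (f : V -> W) (g : U -> V) :
  linear f -> linear g -> linear (fun x => f (g x)).
Proof. by move=> lf lg a x y; rewrite lg lf. Qed.
Lemma linear_comb (U V : lmodType K) a (f g : U -> V) :
  linear f -> linear g -> linear (fun x => a *: f x + g x).
Proof.
move=> lf lg b x y; rewrite lf lg !scalerDr !scalerA mulrC !addrA.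
by congr (_ + _); rewrite addrAC.
Qed.
End LinearFacts2.

Section Span.
Variables (K : fieldType) (V : lmodType K).

Inductive span_of (S : V -> Prop) : V -> Prop :=
| span_gen x of S x : span_of S x
| span_0 : span_of S 0
| span_lin a x y of span_of S x & span_of S y : span_of S (a *: x + y).

Definition spanp (S : V -> Prop) : {pred V} := fun x => `[< span_of S x >].

Lemma spanpP S x : x \in spanp S <-> span_of S x.
Proof. by split=> /asboolP. Qed.

Lemma spanp_submod S : submod_closed (spanp S).
Proof.
split; first by apply/spanpP; exact: span_0.
by move=> a x y /spanpP Sx /spanpP Sy; apply/spanpP; exact: span_lin.
Qed.

HB.instance Definition _ S := GRing.isSubmodClosed.Build K V (spanp S)
  (GRing.submod_closed_semi (spanp_submod S)).
End Span.

Section QuotientModule.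
Variables (K : fieldType) (V : lmodType K) (S : V -> Prop).
Local Notation W := (spanp S).

Definition quotmod : Type := Quotient.quot W.
HB.instance Definition _ := GRing.Zmodule.on quotmod.

Definition qpi (x : V) : quotmod := \pi_(Quotient.quot W) x.
Definition qrepr (x : quotmod) : V := repr (x : Quotient.quot W).

Lemma qreprK x : qpi (qrepr x) = x.
Proof. by rewrite /qpi /qrepr reprK. Qed.

Lemma qpiP x y : qpi x = qpi y <-> span_of S (x - y).
Proof.
rewrite -spanpP (Quotient.idealrBE W); split=> [h|/eqP//].
by apply/eqP.
Qed.

Lemma qpiD x y : qpi (x + y) = qpi x + qpi y.
Proof. exact: (@pi_addr _ _ _ _ _ (Quotient.quot W)). Qed.

Definition qscale (a : K) (x : quotmod) : quotmod := qpi (a *: qrepr x).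

Lemma qscale_pi a x : qscale a (qpi x) = qpi (a *: x).
Proof. by apply/qpiP; rewrite -scalerBr; apply/spanpP/rpredZ/spanpP/qpiP/qreprK. Qed.

Lemma qscaleA a b x : qscale a (qscale b x) = qscale (a * b) x.
Proof. by rewrite -[x]qreprK !qscale_pi scalerA. Qed.
Lemma qscale1 : left_id 1 qscale.
Proof. by move=> x; rewrite -[x]qreprK qscale_pi scale1r. Qed.
Lemma qscaleDr : right_distributive qscale +%R.
Proof.
move=> a x y; rewrite -[x]qreprK -[y]qreprK -qpiD !qscale_pi scalerDr.
exact: qpiD.
Qed.
Lemma qscaleDl x : {morph qscale^~ x : a b / a + b}.
Proof.
by move=> a b; rewrite -[x]qreprK !qscale_pi scalerDl; exact: qpiD.
Qed.

HB.instance Definition _ := GRing.Zmodule_isLmodule.Build K quotmod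
  qscaleA qscale1 qscaleDr qscaleDl.

Lemma qpi_linear : linear qpi.
Proof. by move=> a x y; rewrite qpiD -qscale_pi. Qed.

Lemma qpi_eq0 x : span_of S x -> qpi x = 0.
Proof. by move=> Wx; rewrite -(linf0 qpi_linear); apply/qpiP; rewrite subr0. Qed.

End QuotientModule.

Section QuotientAlgebra.
Variables (K : fieldType) (A : algType K) (S : A -> Prop).

Inductive ideal_of : A -> Prop :=
| ideal_gen x of S x : ideal_of x
| ideal_0 : ideal_of 0
| ideal_D x y of ideal_of x & ideal_of y : ideal_of (x + y)
| ideal_Ml a x of ideal_of x : ideal_of (a * x)
| ideal_Mr a x of ideal_of x : ideal_of (x * a).

Lemma span_ideal x : span_of ideal_of x <-> ideal_of x.
Proof.
split=> [|Ix]; last exact: span_gen.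
elim=> // [|a y z _ Iy _ Iz]; first exact: ideal_0.
by apply: ideal_D => //; rewrite -mulr_algl; exact: ideal_Ml.
Qed.

Definition quotalg : Type := quotmod ideal_of.
HB.instance Definition _ := GRing.Lmodule.on quotalg.

Definition api (x : A) : quotalg := qpi ideal_of x.
Definition qmul (x y : quotalg) : quotalg := api (qrepr x * qrepr y).

Lemma api_repr x : api (qrepr x) = x. Proof. exact: qreprK. Qed.
Lemma api_linear : linear api. Proof. exact: qpi_linear. Qed.
Lemma apiP x y : api x = api y <-> ideal_of (x - y).
Proof. by rewrite -span_ideal; exact: qpiP. Qed.

Lemma qmul_pi x y : qmul (api x) (api y) = api (x * y).
Proof.
apply/apiP; set x' := qrepr _; set y' := qrepr _.
have -> : x' * y' - x * y = (x' - x) * y' + x * (y' - y).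
  by rewrite mulrBl mulrBr addrA subrK.
by apply: ideal_D; [apply: ideal_Mr|apply: ideal_Ml]; apply/apiP/api_repr.
Qed.

Lemma qmulA : associative qmul.
Proof.
by move=> x y z; rewrite -[x]api_repr -[y]api_repr -[z]api_repr !qmul_pi mulrA.
Qed.
Lemma qmul1l : left_id (api 1) qmul.
Proof. by move=> x; rewrite -[x]api_repr qmul_pi mul1r. Qed.
Lemma qmul1r : right_id (api 1) qmul.
Proof. by move=> x; rewrite -[x]api_repr qmul_pi mulr1. Qed.
Lemma qmulDl : left_distributive qmul +%R.
Proof.
move=> x y z; rewrite -[x]api_repr -[y]api_repr -[z]api_repr.
by rewrite -(linfD api_linear) !qmul_pi mulrDl (linfD api_linear).
Qed.
Lemma qmulDr : right_distributive qmul +%R.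
Proof.
move=> x y z; rewrite -[x]api_repr -[y]api_repr -[z]api_repr.
by rewrite -(linfD api_linear) !qmul_pi mulrDr (linfD api_linear).
Qed.

(* A [pzRingType] only, since the ideal may contain 1. *)
HB.instance Definition _ := GRing.Zmodule_isPzRing.Build quotalg
  qmulA qmul1l qmul1r qmulDl qmulDr.

Lemma apiM x y : api (x * y) = api x * api y.
Proof. by rewrite -qmul_pi. Qed.
Lemma quotalg_scaleAl a (x y : quotalg) : a *: (x * y) = (a *: x) * y.
Proof.
rewrite -[x]api_repr -[y]api_repr -apiM.
by rewrite -!(linfZ api_linear) -apiM scalerAl.
Qed.
Lemma quotalg_scaleAr a (x y : quotalg) : a *: (x * y) = x * (a *: y).
Proof.
rewrite -[x]api_repr -[y]api_repr -apiM.
by rewrite -!(linfZ api_linear) -apiM scalerAr.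
Qed.
End QuotientAlgebra.

(* [bilinear_for] of the library lives in Type. *)
Definition bilin (K : fieldType) (U V W : lmodType K) (f : U -> V -> W) : Prop :=
  (forall y, linear (f^~ y)) /\ (forall x, linear (f x)).

Section Bimodules.
Variables (K : fieldType) (R : algType K).

(* Bilinearity over K makes the K-actions through R on both sides agree. *)
Structure bimodule := Bimodule {
  bimod_sort :> lmodType K;
  lact : R -> bimod_sort -> bimod_sort;
  ract : bimod_sort -> R -> bimod_sort;
  lact_bilin : bilin lact;
  ract_bilin : bilin ract;
  lact1 : forall x, lact 1 x = x;
  lactM : forall r s x, lact (r * s) x = lact r (lact s x);
  ract1 : forall x, ract x 1 = x;
  ractM : forall r s x, ract x (r * s) = ract (ract x r) s;
  lractA : forall r s x, ract (lact r x) s = lact r (ract x s)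
}.

Lemma regular_lact_bilin : bilin (fun r x : R => r * x).
Proof.
split=> [y|x] a u v; first by rewrite mulrDl scalerAl.
by rewrite mulrDr scalerAr.
Qed.

Definition regular_bimodule : bimodule :=
  @Bimodule R (fun r x => r * x) (fun x r => x * r)
    regular_lact_bilin regular_lact_bilin
    (@mul1r R) (fun r s x => esym (mulrA r s x))
    (@mulr1 R) (fun r s x => mulrA x r s) (fun r s x => esym (mulrA r x s)).

Variables M N : bimodule.

(* {malg K[X]} is the vector space with basis the << x >>, x in X. *)
Inductive tens_rel : {malg K[(M * N)%type]} -> Prop :=
| tens_linl a m m' n :
    tens_rel (<< (a *: m + m', n) >> - a *: << (m, n) >> - << (m', n) >>)
| tens_linr a m n n' :
    tens_rel (<< (m, a *: n + n') >> - a *: << (m, n) >> - << (m, n') >>)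
| tens_bal m r n : tens_rel (<< (ract m r, n) >> - << (m, lact r n) >>).

Definition tens_mod : lmodType K := quotmod tens_rel.
Definition tpure (m : M) (n : N) : tens_mod := qpi tens_rel << (m, n) >>.

Lemma tpure_bilin : bilin tpure.
Proof.
split=> [n|m] a u v; rewrite -[RHS](qpi_linear tens_rel); apply/qpiP/span_gen;
  rewrite opprD addrA; [exact: tens_linl|exact: tens_linr].
Qed.

Lemma tpure_bal m r n : tpure (ract m r) n = tpure m (lact r n).
Proof. by apply/qpiP/span_gen; exact: tens_bal. Qed.

Definition tlift (P : lmodType K) (f : M -> N -> P) (t : tens_mod) : P :=
  let g := qrepr t in \sum_(k <- msupp g) g@_k *: f k.1 k.2.

Definition balanced (P : lmodType K) (f : M -> N -> P) : Prop :=
  forall m r n, f (ract m r) n = f m (lact r n).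

Section Lift.
Variables (P : lmodType K) (f : M -> N -> P).
Hypotheses (f_bilin : bilin f) (f_bal : balanced f).

Let lin (g : {malg K[(M * N)%type]}) : P := \sum_(k <- msupp g) g@_k *: f k.1 k.2.

Let linw (d : {fset (M * N)%type}) g : (msupp g `<=` d)%fset ->
  lin g = \sum_(k <- d) g@_k *: f k.1 k.2.
Proof.
move=> gd; rewrite /lin (big_fset_incl _ gd) //= => k kd.
by rewrite -mcoeff_eq0 => /eqP->; rewrite scale0r.
Qed.

Let lin_linear : linear lin.
Proof.
move=> a g h; pose d := (msupp (a *: g + h) `|` (msupp g `|` msupp h))%fset.
rewrite !(@linw d) ?fsubsetUl //.
- rewrite scaler_sumr -big_split /=; apply: eq_bigr => k _.
  by rewrite mcoeffD mcoeffZ scalerDl scalerA.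
- by apply: fsubset_trans (fsubsetUr _ _); exact: fsubsetUr.
- by apply: fsubset_trans (fsubsetUr _ _); exact: fsubsetUl.
Qed.

Let linU k : lin << k >> = f k.1 k.2.
Proof. by rewrite /lin msuppU oner_eq0 big_seq_fset1 mcoeffUU scale1r. Qed.

Let lin_rel g : span_of tens_rel g -> lin g = 0.
Proof.
elim=> [x|| a x y _ x0 _ y0]; last 2 first.
- exact: linf0 lin_linear.
- by rewrite lin_linear x0 y0 scaler0 addr0.
case=> [a m m' n|a m n n'|m r n];
  rewrite ?(linfB lin_linear) ?(linfZ lin_linear) !linU /=.
- by rewrite (f_bilin.1 n) addrAC addrK subrr.
- by rewrite (f_bilin.2 m) addrAC addrK subrr.
- by rewrite f_bal subrr.
Qed.

Let tlift_pi g : tlift f (qpi tens_rel g) = lin g.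
Proof.
apply/eqP; rewrite -subr_eq0; apply/eqP.
rewrite -[LHS](linfB lin_linear); apply: lin_rel; exact/qpiP/qreprK.
Qed.

Lemma tlift_linear : linear (tlift f).
Proof.
move=> a x y; rewrite -[x]qreprK -[y]qreprK -qpi_linear !tlift_pi.
exact: lin_linear.
Qed.

Lemma tlift_pure m n : tlift f (tpure m n) = f m n.
Proof. by rewrite tlift_pi linU. Qed.
End Lift.

Lemma tens_ext (P : lmodType K) (f g : tens_mod -> P) :
  linear f -> linear g -> (forall m n, f (tpure m n) = g (tpure m n)) -> f =1 g.
Proof.
move=> lf lg fg t; rewrite -[t]qreprK; set x := qrepr t.
rewrite [x]monalgE; have lq := qpi_linear tens_rel.
rewrite (linf_sum lq) (linf_sum lf) (linf_sum lg); apply: eq_bigr => -[m n] _.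
have -> : << x@_(m, n) *g (m, n) >> = x@_(m, n) *: << (m, n) >>.
  by apply/malgP => k; rewrite mcoeffZ !mcoeffU mulr_natr.
by rewrite (linfZ lq) (linfZ lf) (linfZ lg); congr (_ *: _); exact: fg.
Qed.

Definition tens_lact (r : R) : tens_mod -> tens_mod :=
  tlift (fun m n => tpure (lact r m) n).
Definition tens_ract (t : tens_mod) (r : R) : tens_mod :=
  tlift (fun m n => tpure m (ract n r)) t.

Let tlb r : bilin (fun m n => tpure (lact r m) n).
Proof.
split=> [n|m] a u v; last exact: tpure_bilin.2.
by rewrite (lact_bilin M).2 tpure_bilin.1.
Qed.
Let tlbal r : balanced (fun m n => tpure (lact r m) n).
Proof. by move=> m s n; rewrite -lractA tpure_bal. Qed.
Let trb r : bilin (fun m n => tpure m (ract n r)).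
Proof.
split=> [n|m] a u v; first exact: tpure_bilin.1.
by rewrite (ract_bilin N).1 tpure_bilin.2.
Qed.
Let trbal r : balanced (fun m n => tpure m (ract n r)).
Proof. by move=> m s n; rewrite lractA tpure_bal. Qed.

Lemma tens_lact_linear r : linear (tens_lact r).
Proof. exact: tlift_linear. Qed.
Lemma tens_ract_linear r : linear (tens_ract^~ r).
Proof. exact: tlift_linear. Qed.
Lemma tens_lact_pure r m n : tens_lact r (tpure m n) = tpure (lact r m) n.
Proof. exact: tlift_pure. Qed.
Lemma tens_ract_pure r m n : tens_ract (tpure m n) r = tpure m (ract n r).
Proof. exact: tlift_pure. Qed.

Lemma tens_lact_bilin : bilin tens_lact.
Proof.
split=> [t|r]; last exact: tens_lact_linear.
move=> a r s; move: t; apply: (tens_ext (f := tens_lact (a *: r + s))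
  (g := fun t => a *: tens_lact r t + tens_lact s t)) => [||m n].
- exact: tens_lact_linear.
- by apply: linear_comb; exact: tens_lact_linear.
- by rewrite !tens_lact_pure (lact_bilin M).1 tpure_bilin.1.
Qed.

Lemma tens_ract_bilin : bilin tens_ract.
Proof.
split=> [r|t]; first exact: tens_ract_linear.
move=> a r s; move: t; apply: (tens_ext (f := tens_ract^~ (a *: r + s))
  (g := fun t => a *: tens_ract t r + tens_ract t s)) => [||m n].
- exact: tens_ract_linear.
- by apply: linear_comb; exact: tens_ract_linear.
- by rewrite !tens_ract_pure (ract_bilin N).2 tpure_bilin.2.
Qed.

Lemma tens_lact1 t : tens_lact 1 t = t.
Proof.
move: t; apply: (tens_ext (f := tens_lact 1) (g := id)) => [||m n] //.
  exact: tens_lact_linear.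
by rewrite tens_lact_pure lact1.
Qed.
Lemma tens_ract1 t : tens_ract t 1 = t.
Proof.
move: t; apply: (tens_ext (f := tens_ract^~ 1) (g := id)) => [||m n] //.
  exact: tens_ract_linear.
by rewrite tens_ract_pure ract1.
Qed.
Lemma tens_lactM r s t : tens_lact (r * s) t = tens_lact r (tens_lact s t).
Proof.
move: t; apply: (tens_ext (f := tens_lact (r * s))
  (g := fun t => tens_lact r (tens_lact s t))) => [||m n].
- exact: tens_lact_linear.
- by apply: linear_comp; exact: tens_lact_linear.
- by rewrite !tens_lact_pure lactM.
Qed.
Lemma tens_ractM r s t : tens_ract t (r * s) = tens_ract (tens_ract t r) s.
Proof.
move: t; apply: (tens_ext (f := tens_ract^~ (r * s))
  (g := fun t => tens_ract (tens_ract t r) s)) => [||m n].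
- exact: tens_ract_linear.
- by apply: (linear_comp (f := tens_ract^~ s)); exact: tens_ract_linear.
- by rewrite !tens_ract_pure ractM.
Qed.
Lemma tens_lractA r s t :
  tens_ract (tens_lact r t) s = tens_lact r (tens_ract t s).
Proof.
move: t; apply: (tens_ext (f := fun t => tens_ract (tens_lact r t) s)
  (g := fun t => tens_lact r (tens_ract t s))) => [||m n].
- apply: (linear_comp (f := tens_ract^~ s)); first exact: tens_ract_linear.
  exact: tens_lact_linear.
- apply: (linear_comp (g := tens_ract^~ s)); first exact: tens_lact_linear.
  exact: tens_ract_linear.
- by rewrite !(tens_lact_pure, tens_ract_pure).
Qed.

Definition tens : bimodule :=
  Bimodule tens_lact_bilin tens_ract_bilin
    tens_lact1 tens_lactM tens_ract1 tens_ractM tens_lractA.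
End Bimodules.

Section DirectSum.
Variables (K : fieldType) (E : nat -> lmodType K).

Record dsum : Type := Dsum {
  dval :> forall m, E m;
  dvalP : exists N, forall m, (N <= m)%N -> dval m = 0
}.

Lemma dsumP (x y : dsum) : (forall m, x m = y m) -> x = y.
Proof.
case: x y => [x Px] [y Py] /= xy; have {}xy : x = y by exact: functional_extensionality_dep.
by rewrite xy in Px *; congr Dsum; exact: Prop_irrelevance.
Qed.

HB.instance Definition _ := gen_eqMixin dsum.
HB.instance Definition _ := gen_choiceMixin dsum.

Lemma dsum0_subproof : exists N : nat, forall m, (N <= m)%N -> (0 : E m) = 0.
Proof. by exists 0%N. Qed.
Lemma dsumD_subproof (x y : dsum) :
  exists N : nat, forall m, (N <= m)%N -> x m + y m = 0.
Proof.
have [N xN] := dvalP x; have [M yM] := dvalP y; exists (maxn N M) => m.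
by rewrite geq_max => /andP[Nm Mm]; rewrite xN // yM // addr0.
Qed.
Lemma dsumZ_subproof a (x : dsum) :
  exists N : nat, forall m, (N <= m)%N -> a *: x m = 0.
Proof.
by have [N xN] := dvalP x; exists N => m Nm; rewrite xN // scaler0.
Qed.

Definition dsum0 := Dsum dsum0_subproof.
Definition dsumD (x y : dsum) := Dsum (dsumD_subproof x y).
Definition dsumZ a (x : dsum) := Dsum (dsumZ_subproof a x).

Lemma dsumDA : associative dsumD.
Proof. by move=> x y z; apply: dsumP => m /=; rewrite addrA. Qed.
Lemma dsumDC : commutative dsumD.
Proof. by move=> x y; apply: dsumP => m /=; rewrite addrC. Qed.
Lemma dsumD0 : left_id dsum0 dsumD.
Proof. by move=> x; apply: dsumP => m /=; rewrite add0r. Qed.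
Lemma dsumDN : left_inverse dsum0 (dsumZ (-1)) dsumD.
Proof. by move=> x; apply: dsumP => m /=; rewrite scaleN1r addNr. Qed.

HB.instance Definition _ :=
  GRing.isZmodule.Build dsum dsumDA dsumDC dsumD0 dsumDN.

Lemma dsumZA a b x : dsumZ a (dsumZ b x) = dsumZ (a * b) x.
Proof. by apply: dsumP => m /=; rewrite scalerA. Qed.
Lemma dsumZ1 : left_id 1 dsumZ.
Proof. by move=> x; apply: dsumP => m /=; rewrite scale1r. Qed.
Lemma dsumZDr : right_distributive dsumZ +%R.
Proof. by move=> a x y; apply: dsumP => m /=; rewrite scalerDr. Qed.
Lemma dsumZDl x : {morph dsumZ^~ x : a b / a + b}.
Proof. by move=> a b; apply: dsumP => m /=; rewrite scalerDl. Qed.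

HB.instance Definition _ := GRing.Zmodule_isLmodule.Build K dsum
  dsumZA dsumZ1 dsumZDr dsumZDl.

Lemma dval_linear m : linear (fun x : dsum => x m).
Proof. by []. Qed.

Definition din_fun m (x : E m) k : E k :=
  if @eqP _ m k is ReflectT e then ecast i (E i) e x else 0.

Lemma din_subproof m (x : E m) :
  exists N, forall k, (N <= k)%N -> din_fun x k = 0.
Proof.
exists m.+1 => k mk; rewrite /din_fun; case: eqP => // e.
by rewrite -e ltnn in mk.
Qed.

Definition din m (x : E m) : dsum := Dsum (din_subproof x).

Lemma din_same m (x : E m) : din x m = x.
Proof.
rewrite /= /din_fun; case: eqP => // e.
by rewrite (eq_irrelevance e erefl).
Qed.
Lemma din_neq m (x : E m) k : m != k -> din x k = 0.
Proof. by rewrite /= /din_fun; case: eqP. Qed.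

Lemma din_linear m : linear (@din m).
Proof.
move=> a x y; apply: dsumP => k; rewrite dval_linear.
have [mk|mk] := eqVneq m k; last by rewrite !din_neq // scaler0 addr0.
by case: k / mk; rewrite !din_same.
Qed.

Definition dbound (x : dsum) : nat := projT1 (cid (dvalP x)).

Definition dlift (P : lmodType K) (f : forall m, E m -> P) (x : dsum) : P :=
  \sum_(m < dbound x) f m (x m).

Section Lift.
Variables (P : lmodType K) (f : forall m, E m -> P).
Hypothesis lf : forall m, linear (@f m).

Lemma dliftE (x : dsum) N : (forall m, (N <= m)%N -> x m = 0) ->
  dlift f x = \sum_(m < N) f (x m).
Proof.
have aux n n' : (forall m, (n <= m)%N -> x m = 0) ->
    \sum_(m < n + n') f (x m) = \sum_(m < n) f (x m).
  move=> xn; rewrite big_split_ord /= [X in _ + X]big1 ?addr0 // => i _.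
  by rewrite xn ?leq_addr // (linf0 (@lf _)).
move=> xN; rewrite -(aux N (dbound x)) // addnC aux // /dbound.
by case: cid.
Qed.

Lemma dlift_linear : linear (dlift f).
Proof.
move=> a x y; have [N xN] := dvalP x; have [M yM] := dvalP y.
have zle k : (maxn N M <= k)%N -> (N <= k)%N /\ (M <= k)%N.
  by rewrite geq_max => /andP.
have xm m : (maxn N M <= m)%N -> x m = 0 by move=> /zle[? _]; exact: xN.
have ym m : (maxn N M <= m)%N -> y m = 0 by move=> /zle[_ ?]; exact: yM.
rewrite (dliftE xm) (dliftE ym) (@dliftE _ (maxn N M)); last first.
  by move=> m Nm; rewrite dval_linear xm // ym // scaler0 addr0.
rewrite scaler_sumr -big_split /=; apply: eq_bigr => m _; exact: lf.
Qed.

Lemma dlift_in m (x : E m) : dlift f (din x) = f x.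
Proof.
rewrite (@dliftE _ m.+1) => [|k mk]; last by rewrite din_neq // ltn_eqF.
rewrite big_ord_recr /= -[din_fun _ _]/(din x m) din_same big1 ?add0r // => i _.
by rewrite -[din_fun _ _]/(din x i) din_neq ?(linf0 (@lf _)) // gtn_eqF.
Qed.
End Lift.

Lemma dsum_ext (P : lmodType K) (f g : dsum -> P) : linear f -> linear g ->
  (forall m (x : E m), f (din x) = g (din x)) -> f =1 g.
Proof.
move=> lf lg fg x; have [N xN] := dvalP x.
have -> : x = \sum_(m < N) din (x m).
  apply: dsumP => k; rewrite (linf_sum (dval_linear k)).
  case: (ltnP k N) => [kN|Nk].
    rewrite (bigD1 (Ordinal kN)) //= -[din_fun _ _]/(din (x k) k) din_same.
    rewrite big1 ?addr0 // => i ik; rewrite -[LHS]/(din (x i) k) din_neq //.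
  rewrite xN // big1 // => i _; rewrite din_neq //.
  by rewrite ltn_eqF // (leq_trans _ Nk).
rewrite (linf_sum lf) (linf_sum lg); apply: eq_bigr => i _; exact: fg.
Qed.

End DirectSum.

Section TensorAlgebra.
Variables (K : fieldType) (R : algType K) (L : bimodule R).

Fixpoint tpow (m : nat) : bimodule R :=
  if m is m'.+1 then tens L (tpow m') else regular_bimodule R.

Definition talg : Type := dsum tpow.
HB.instance Definition _ := GRing.Lmodule.on talg.

Definition thom m (t : tpow m) : talg := @din K tpow m t.

Lemma thom_linear m : linear (@thom m). Proof. exact: din_linear. Qed.

Lemma talg_ext (P : lmodType K) (f g : talg -> P) :
  linear f -> linear g ->
  (forall r : R, f (@thom 0 r) = g (@thom 0 r)) ->
  (forall m (l : L), (forall t, f (@thom m t) = g (thom t)) ->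
     forall t, f (@thom m.+1 (tpure l t)) = g (@thom m.+1 (tpure l t))) ->
  f =1 g.
Proof.
move=> lf lg fg0 fgS; apply: dsum_ext => // m.
elim: m => [//|m IH]; apply: (tens_ext (f := fun t => f (@thom m.+1 t))
  (g := fun t => g (@thom m.+1 t))) => [||l t].
- apply: (linear_comp (f := f) (g := @thom m.+1)) => //; exact: thom_linear.
- apply: (linear_comp (f := g) (g := @thom m.+1)) => //; exact: thom_linear.
- exact: fgS.
Qed.

(* Data of a left module over T_R(L): compatible operators for R and for L *)
Structure topers := Topers {
  tcar :> lmodType K;
  op0 : R -> tcar -> tcar;
  op1 : L -> tcar -> tcar;
  op0_bilin : bilin op0;
  op1_bilin : bilin op1;
  op0_1 : forall p, op0 1 p = p;
  op0M : forall r s p, op0 (r * s) p = op0 r (op0 s p);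
  op1l : forall r l p, op1 (lact r l) p = op0 r (op1 l p);
  op1r : forall r l p, op1 (ract l r) p = op1 l (op0 r p)
}.

Section Rep.
Variable P : topers.

Fixpoint trep_pow (p : P) (m : nat) : tpow m -> P :=
  match m return tpow m -> P with
  | 0 => fun r => op0 r p
  | m'.+1 => tlift (fun l t => op1 l (@trep_pow p m' t))
  end.

Definition trep (x : talg) (p : P) : P := dlift (trep_pow p) x.

Lemma trep_pow_facts p m :
  linear (@trep_pow p m) /\
  (forall r t, trep_pow p (lact r t) = op0 r (@trep_pow p m t)).
Proof.
elim: m => [|m [IHl IHr]] /=.
  by split=> [|r s]; [exact: (op0_bilin P).1|exact: op0M].
have b : bilin (fun l t => op1 l (@trep_pow p m t)).
  split=> [t|l] a u v; first exact: (op1_bilin P).1.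
  by rewrite IHl (op1_bilin P).2.
have bal : balanced (fun l t => op1 l (@trep_pow p m t)).
  by move=> l r t; rewrite op1r IHr.
split=> [|r]; first exact: tlift_linear.
apply: (tens_ext (f := fun t => tlift _ (tens_lact r t))
  (g := fun t => op0 r (tlift _ t))) => [||l t].
- apply: linear_comp; [exact: tlift_linear|exact: tens_lact_linear].
- apply: linear_comp; [exact: (op0_bilin P).2|exact: tlift_linear].
- by rewrite tens_lact_pure !tlift_pure // op1l.
Qed.

Lemma trep_linearl p : linear (trep^~ p).
Proof. by apply: dlift_linear => m; have [] := trep_pow_facts p m. Qed.

Lemma trep_in p m (t : tpow m) : trep (thom t) p = trep_pow p t.
Proof. by apply: dlift_in => k; have [] := trep_pow_facts p k. Qed.

Lemma trep0 (r : R) p : trep (@thom 0 r) p = op0 r p.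
Proof. exact: trep_in. Qed.

Lemma trepS m l (t : tpow m) p :
  trep (@thom m.+1 (tpure l t)) p = op1 l (trep (thom t) p).
Proof.
rewrite !trep_in /= tlift_pure //.
  split=> [u|u] a v w; first exact: (op1_bilin P).1.
  by rewrite (trep_pow_facts p m).1 (op1_bilin P).2.
by move=> u r v; rewrite op1r (trep_pow_facts p m).2.
Qed.
End Rep.

Section RepLinear.
Variable P : topers.

Lemma trep_linearr x : linear (@trep P x).
Proof.
move=> a p q; move: x; apply: (talg_ext (f := fun x => trep x (a *: p + q))
  (g := fun x => a *: trep x p + trep x q)) => [||r|m l IH t].
- exact: trep_linearl.
- by apply: linear_comb; exact: trep_linearl.
- by rewrite !trep0 (op0_bilin P).2.
- by rewrite !trepS IH (op1_bilin P).2.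
Qed.
End RepLinear.

Definition tleft0 (r : R) : talg -> talg :=
  dlift (fun m (t : tpow m) => thom (lact r t)).
Definition tleft1 (l : L) : talg -> talg :=
  dlift (fun m (t : tpow m) => @thom m.+1 (tpure l t)).

Let thl0 r m : linear (fun t : tpow m => thom (lact r t)).
Proof. exact: linear_comp (@thom_linear m) ((lact_bilin _).2 r). Qed.
Let thl1 l m : linear (fun t : tpow m => @thom m.+1 (tpure l t)).
Proof.
apply: (linear_comp (f := @thom m.+1) (g := tpure l)); first exact: thom_linear.
exact: (tpure_bilin _ _).2.
Qed.

Lemma tleft0_in r m (t : tpow m) : tleft0 r (thom t) = thom (lact r t).
Proof. exact: (dlift_in (thl0 r)). Qed.
Lemma tleft1_in l m (t : tpow m) : tleft1 l (thom t) = @thom m.+1 (tpure l t).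
Proof. exact: (dlift_in (thl1 l)). Qed.
Lemma tleft0_linear r : linear (tleft0 r). Proof. exact: dlift_linear. Qed.
Lemma tleft1_linear l : linear (tleft1 l). Proof. exact: dlift_linear. Qed.

Lemma tleft0_bilin : bilin tleft0.
Proof.
split=> [x|r]; last exact: tleft0_linear.
move=> a r s; move: x; apply: (dsum_ext (f := tleft0 (a *: r + s))
  (g := fun x => a *: tleft0 r x + tleft0 s x)) => [||m t].
- exact: tleft0_linear.
- by apply: linear_comb; exact: tleft0_linear.
- by rewrite !tleft0_in (lact_bilin _).1 thom_linear.
Qed.

Lemma tleft1_bilin : bilin tleft1.
Proof.
split=> [x|r]; last exact: tleft1_linear.
move=> a r s; move: x; apply: (dsum_ext (f := tleft1 (a *: r + s))
  (g := fun x => a *: tleft1 r x + tleft1 s x)) => [||m t].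
- exact: tleft1_linear.
- by apply: linear_comb; exact: tleft1_linear.
- by rewrite !tleft1_in (tpure_bilin _ _).1 thom_linear.
Qed.

Lemma tleft0_1 x : tleft0 1 x = x.
Proof.
move: x; apply: (dsum_ext (f := tleft0 1) (g := id)) => [||m t] //.
  exact: tleft0_linear.
by rewrite tleft0_in lact1.
Qed.
Lemma tleft0M r s x : tleft0 (r * s) x = tleft0 r (tleft0 s x).
Proof.
move: x; apply: (dsum_ext (f := tleft0 (r * s))
  (g := fun x => tleft0 r (tleft0 s x))) => [||m t].
- exact: tleft0_linear.
- by apply: linear_comp; exact: tleft0_linear.
- by rewrite !tleft0_in lactM.
Qed.
Lemma tleft1l r l x : tleft1 (lact r l) x = tleft0 r (tleft1 l x).
Proof.
move: x; apply: (dsum_ext (f := tleft1 (lact r l))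
  (g := fun x => tleft0 r (tleft1 l x))) => [||m t].
- exact: tleft1_linear.
- by apply: linear_comp; [exact: tleft0_linear|exact: tleft1_linear].
- by rewrite !tleft1_in tleft0_in /= tens_lact_pure.
Qed.
Lemma tleft1r r l x : tleft1 (ract l r) x = tleft1 l (tleft0 r x).
Proof.
move: x; apply: (dsum_ext (f := tleft1 (ract l r))
  (g := fun x => tleft1 l (tleft0 r x))) => [||m t].
- exact: tleft1_linear.
- by apply: linear_comp; [exact: tleft1_linear|exact: tleft0_linear].
- by rewrite tleft0_in !tleft1_in tpure_bal.
Qed.

Definition tself : topers :=
  Topers tleft0_bilin tleft1_bilin tleft0_1 tleft0M tleft1l tleft1r.

(* For m-fold tensors t, the product (l1 (x) .. (x) lm (x) r) * y is
   l1 (x) (.. (lm (x) (r y))), i.e. concatenation of tensors. *)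
Definition tmul (x y : talg) : talg := @trep tself x y.

Section RepMul.
Variable P : topers.

Lemma trep_left0 r x p : @trep P (tleft0 r x) p = op0 r (trep x p).
Proof.
move: x; apply: (dsum_ext (f := fun x => @trep P (tleft0 r x) p)
  (g := fun x => op0 r (trep x p))) => [||m t].
- apply: (linear_comp (f := fun x => trep x p)); last exact: tleft0_linear.
  exact: trep_linearl.
- apply: linear_comp; [exact: (op0_bilin P).2|exact: trep_linearl].
- by rewrite tleft0_in !trep_in (trep_pow_facts p m).2.
Qed.

Lemma trep_left1 l x p : @trep P (tleft1 l x) p = op1 l (trep x p).
Proof.
move: x; apply: (dsum_ext (f := fun x => @trep P (tleft1 l x) p)
  (g := fun x => op1 l (trep x p))) => [||m t].
- apply: (linear_comp (f := fun x => trep x p)); last exact: tleft1_linear.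
  exact: trep_linearl.
- apply: linear_comp; [exact: (op1_bilin P).2|exact: trep_linearl].
- by rewrite tleft1_in trepS.
Qed.

Lemma trepM x y p : @trep P (tmul x y) p = trep x (trep y p).
Proof.
move: x; apply: (talg_ext (f := fun x => @trep P (tmul x y) p)
  (g := fun x => trep x (trep y p))) => [||r|m l IH t].
- apply: (linear_comp (f := fun x => trep x p)); first exact: trep_linearl.
  exact: (@trep_linearl tself y).
- exact: trep_linearl.
- by rewrite trep0 -trep_left0 /tmul trep0.
- by rewrite trepS -IH -trep_left1 /tmul trepS.
Qed.
End RepMul.

Definition tinjR (r : R) : talg := @thom 0 r.
Definition tinjL (l : L) : talg := @thom 1 (@tpure K R L (tpow 0) l (1 : R)).

Lemma tmulA : associative tmul.
Proof. by move=> x y z; rewrite /tmul trepM. Qed.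
Lemma tmul1l : left_id (tinjR 1) tmul.
Proof. by move=> x; rewrite /tmul trep0 /= tleft0_1. Qed.
Lemma tmul1r : right_id (tinjR 1) tmul.
Proof.
apply: (talg_ext (f := tmul^~ (tinjR 1)) (g := id)) => [||r|m l IH t] //.
- exact: (@trep_linearl tself).
- by rewrite /tmul trep0 /= tleft0_in /= mulr1.
- by rewrite /tmul trepS /= -/(tmul _ _) IH tleft1_in.
Qed.
Lemma tmulDl : left_distributive tmul +%R.
Proof. by move=> x y z; rewrite /tmul (linfD (@trep_linearl tself z)). Qed.
Lemma tmulDr : right_distributive tmul +%R.
Proof. by move=> x y z; rewrite /tmul (linfD (@trep_linearr tself x)). Qed.
Lemma tone_neq0 : tinjR 1 != 0.
Proof.
apply/eqP => /(congr1 (fun x : talg => x 0%N)).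
by rewrite [LHS]din_same; apply/eqP; exact: oner_neq0.
Qed.

HB.instance Definition _ := GRing.Zmodule_isNzRing.Build talg
  tmulA tmul1l tmul1r tmulDl tmulDr tone_neq0.

Lemma talg_scaleAl a (x y : talg) : a *: (x * y) = (a *: x) * y.
Proof. exact: esym (linfZ (@trep_linearl tself y) a x). Qed.
HB.instance Definition _ := GRing.Lmodule_isLalgebra.Build K talg talg_scaleAl.
Lemma talg_scaleAr a (x y : talg) : a *: (x * y) = x * (a *: y).
Proof. exact: esym (linfZ (@trep_linearr tself x) a y). Qed.
HB.instance Definition _ := GRing.Lalgebra_isAlgebra.Build K talg talg_scaleAr.

Lemma tinjR_linear : linear tinjR. Proof. exact: (@thom_linear 0). Qed.
Lemma tinjL_linear : linear tinjL.
Proof.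
apply: (linear_comp (f := @thom 1) (g := fun l => @tpure K R L (tpow 0) l (1 : R))).
  exact: thom_linear.
exact: (tpure_bilin _ _).1.
Qed.
Lemma tinjR1 : tinjR 1 = 1. Proof. by []. Qed.
Lemma tinjRM r s : tinjR (r * s) = tinjR r * tinjR s.
Proof. by rewrite /GRing.mul /= /tmul trep0 /= tleft0_in. Qed.
Lemma tinjRl r l : tinjL (lact r l) = tinjR r * tinjL l.
Proof.
by rewrite [RHS]/GRing.mul /= /tmul trep0 /= tleft0_in /= tens_lact_pure.
Qed.
Lemma tinjLM l m (t : tpow m) : tinjL l * thom t = @thom m.+1 (tpure l t).
Proof.
by rewrite [LHS]/GRing.mul /= /tmul trepS trep0 /= tleft0_1 tleft1_in.
Qed.
Lemma tinjLr l r : tinjL (ract l r) = tinjL l * tinjR r.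
Proof. by rewrite tinjLM /tinjL tpure_bal /= mulr1. Qed.

Section Morphism.
Variable B : algType K.

Structure tmorph := Tmorph {
  tm0 : R -> B;
  tm1 : L -> B;
  tm0_linear : linear tm0;
  tm1_linear : linear tm1;
  tm0_1 : tm0 1 = 1;
  tm0_M : forall r s, tm0 (r * s) = tm0 r * tm0 s;
  tm1_l : forall r l, tm1 (lact r l) = tm0 r * tm1 l;
  tm1_r : forall r l, tm1 (ract l r) = tm1 l * tm0 r
}.

Variable f : tmorph.

Let lmul_bilin (U : lmodType K) (h : U -> B) : linear h -> bilin (fun r b => h r * b).
Proof.
move=> lh; split=> [b|r] a u v; first by rewrite lh mulrDl scalerAl.
by rewrite mulrDr scalerAr.
Qed.

Definition tmorph_ops : topers := @Topers B
  (fun r b => tm0 f r * b) (fun l b => tm1 f l * b)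
  (lmul_bilin (tm0_linear f)) (lmul_bilin (tm1_linear f))
  (fun b => etrans (congr1 (fun x => x * b) (tm0_1 f)) (mul1r b))
  (fun r s b => etrans (congr1 (fun x => x * b) (tm0_M f r s))
                  (esym (mulrA _ _ b)))
  (fun r l b => etrans (congr1 (fun x => x * b) (tm1_l f r l))
                  (esym (mulrA _ _ b)))
  (fun r l b => etrans (congr1 (fun x => x * b) (tm1_r f r l))
                  (esym (mulrA _ _ b))).

Definition tlift_alg (x : talg) : B := @trep tmorph_ops x 1.

Lemma tlift_alg_linear : linear tlift_alg.
Proof. exact: (@trep_linearl tmorph_ops). Qed.
Lemma tlift_algR r : tlift_alg (tinjR r) = tm0 f r.
Proof. by rewrite /tlift_alg trep0 /= mulr1. Qed.
Lemma tlift_algL l : tlift_alg (tinjL l) = tm1 f l.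
Proof. by rewrite /tlift_alg trepS trep0 /= tm0_1 !mulr1. Qed.
Lemma tlift_alg1 : tlift_alg 1 = 1.
Proof. by rewrite -tinjR1 tlift_algR tm0_1. Qed.
Lemma tlift_algM x y : tlift_alg (x * y) = tlift_alg x * tlift_alg y.
Proof.
have aux b z : @trep tmorph_ops z b = tlift_alg z * b.
  move: z; apply: (talg_ext (f := fun z => @trep tmorph_ops z b)
    (g := fun z => tlift_alg z * b)) => [||r|m l IH t].
  - exact: trep_linearl.
  - by move=> a u v; rewrite tlift_alg_linear mulrDl scalerAl.
  - by rewrite trep0 -/(tinjR r) tlift_algR.
  - by rewrite trepS IH /tlift_alg trepS /= mulrA.
by rewrite -aux; exact: (@trepM tmorph_ops x y 1).
Qed.

Lemma tlift_alg_unique (h : talg -> B) : linear h ->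
  (forall x y, h (x * y) = h x * h y) ->
  (forall r, h (tinjR r) = tm0 f r) -> (forall l, h (tinjL l) = tm1 f l) ->
  h =1 tlift_alg.
Proof.
move=> lh hM h0 h1; apply: talg_ext => //; first exact: tlift_alg_linear.
- by move=> r; rewrite h0 -tlift_algR.
- by move=> m l IH t; rewrite -tinjLM hM tlift_algM h1 tlift_algL IH.
Qed.
End Morphism.

End TensorAlgebra.

Section SkewGroupAlgebra.
Variables (K : fieldType) (gT : finGroupType) (B : algType K).

Structure galg_action := GalgAction {
  gact :> gT -> B -> B;
  gact_linear : forall g, linear (gact g);
  gact_one : forall g, gact g 1 = 1;
  gactM : forall g x y, gact g (x * y) = gact g x * gact g y;
  gact1 : forall x, gact 1%g x = x;
  gact_comp : forall g h x, gact (g * h)%g x = gact g (gact h x)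
}.

Variable act : galg_action.

(* The function x stands for the sum of the x(g) g over g in G. *)
Definition skew of galg_action : Type := {ffun gT -> B}.
HB.instance Definition _ := GRing.Lmodule.on (skew act).

Definition sgen (b : B) (g : gT) : skew act := [ffun k => if k == g then b else 0].

Definition smul (x y : skew act) : skew act :=
  [ffun k => \sum_g x g * act g (y (g^-1 * k)%g)].

Lemma smul_gen b c g h : smul (sgen b g) (sgen c h) = sgen (b * act g c) (g * h)%g.
Proof.
apply/ffunP => k; rewrite !ffunE (bigD1 g) //= !ffunE eqxx big1 ?addr0.
  rewrite -(inj_eq (mulgI g)) mulKVg; case: ifP => // _.
  by rewrite (linf0 (gact_linear act g)) mulr0.
by move=> i /negbTE ig; rewrite ffunE ig mul0r.
Qed.

Lemma smulA : associative smul.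
Proof.
move=> x y z; apply/ffunP => k; rewrite !ffunE.
under [RHS]eq_bigr => g _ do rewrite ffunE mulr_suml.
rewrite [RHS]exchange_big /=; apply: eq_bigr => g _.
rewrite ffunE (linf_sum (gact_linear act g)) mulr_sumr [RHS](reindex_inj (mulgI g)) /=.
apply: eq_bigr => h _; rewrite gactM mulrA mulKg gact_comp invMg.
by rewrite -mulgA.
Qed.
Lemma smul1l : left_id (sgen 1 1%g) smul.
Proof.
move=> x; apply/ffunP => k; rewrite ffunE (bigD1 1%g) //= ffunE eqxx mul1r.
rewrite gact1 invg1 mul1g big1 ?addr0 // => g /negbTE g1.
by rewrite ffunE g1 mul0r.
Qed.
Lemma smul1r : right_id (sgen 1 1%g) smul.
Proof.
move=> x; apply/ffunP => k; rewrite ffunE (bigD1 k) //= ffunE mulVg eqxx.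
rewrite gact_one mulr1 big1 ?addr0 // => g /negbTE gk; rewrite ffunE.
rewrite -(inj_eq (mulgI g)) mulKVg mulg1 eq_sym gk.
by rewrite (linf0 (gact_linear act g)) mulr0.
Qed.
Lemma smulDl : left_distributive smul +%R.
Proof.
move=> x y z; apply/ffunP => k; rewrite !ffunE -big_split.
by apply: eq_bigr => g _ /=; rewrite ffunE mulrDl.
Qed.
Lemma smulDr : right_distributive smul +%R.
Proof.
move=> x y z; apply/ffunP => k; rewrite !ffunE -big_split.
by apply: eq_bigr => g _ /=; rewrite ffunE (linfD (gact_linear act g)) mulrDr.
Qed.
Lemma sone_neq0 : sgen 1 1%g != 0.
Proof.
by apply/eqP => /ffunP/(_ 1%g); rewrite !ffunE eqxx; apply/eqP/oner_neq0.
Qed.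

HB.instance Definition _ := GRing.Zmodule_isNzRing.Build (skew act)
  smulA smul1l smul1r smulDl smulDr sone_neq0.

Lemma skew_scaleAl a (x y : skew act) : a *: (x * y) = (a *: x) * y.
Proof.
apply/ffunP => k; rewrite !ffunE scaler_sumr; apply: eq_bigr => g _.
by rewrite ffunE scalerAl.
Qed.
HB.instance Definition _ := GRing.Lmodule_isLalgebra.Build K (skew act) skew_scaleAl.
Lemma skew_scaleAr a (x y : skew act) : a *: (x * y) = x * (a *: y).
Proof.
apply/ffunP => k; rewrite !ffunE scaler_sumr; apply: eq_bigr => g _.
by rewrite ffunE (linfZ (gact_linear act g)) scalerAr.
Qed.
HB.instance Definition _ := GRing.Lalgebra_isAlgebra.Build K (skew act) skew_scaleAr.

Lemma sgenM b c g h : sgen b g * sgen c h = sgen (b * act g c) (g * h)%g.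
Proof. exact: smul_gen. Qed.

End SkewGroupAlgebra.

Section GroupAlgebra.
Variables (K : fieldType) (gT : finGroupType).

Definition trivial_action : galg_action gT K^o :=
  @GalgAction K gT K^o (fun _ x => x) (fun _ a x y => erefl) (fun _ => erefl)
    (fun _ x y => erefl) (fun x => erefl) (fun _ _ x => erefl).

Definition grpalg : algType K := skew trivial_action.
Definition gelt (g : gT) : grpalg := sgen trivial_action 1 g.

Lemma geltM g h : gelt g * gelt h = gelt (g * h)%g.
Proof. by rewrite /gelt [LHS]sgenM mulr1. Qed.

Variables (n : nat) (rG : mx_representation K [set: gT]%G n).

(* The function x stands for the sum of the x(g) (x) g over g in G; the group
   acts on the left of column vectors. *)
Definition VG : lmodType K := {ffun gT -> 'cV[K]_n}.
Definition vg (v : 'cV[K]_n) (g : gT) : VG := [ffun k => if k == g then v else 0].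

Definition VG_lact (r : grpalg) (x : VG) : VG :=
  [ffun k => \sum_g (r g : K) *: (rG g *m x (g^-1 * k)%g)].
Definition VG_ract (x : VG) (r : grpalg) : VG :=
  [ffun k => \sum_g (r g : K) *: x (k * g^-1)%g].

Lemma VG_lact_bilin : bilin VG_lact.
Proof.
split=> [x|r] a u v; apply/ffunP => k; rewrite !ffunE scaler_sumr -big_split;
  apply: eq_bigr => g _ /=; rewrite !ffunE.
  by rewrite scalerDl scalerA.
by rewrite mulmxDr -scalemxAr scalerDr !scalerA mulrC.
Qed.
Lemma VG_ract_bilin : bilin VG_ract.
Proof.
split=> [x|r] a u v; apply/ffunP => k; rewrite !ffunE scaler_sumr -big_split;
  apply: eq_bigr => g _ /=; rewrite !ffunE.
  by rewrite scalerDr !scalerA mulrC.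
by rewrite scalerDl scalerA.
Qed.
Lemma VG_lact_gen g v h : VG_lact (gelt g) (vg v h) = vg (rG g *m v) (g * h)%g.
Proof.
apply/ffunP => k; rewrite !ffunE (bigD1 g) //= !ffunE eqxx scale1r big1 ?addr0.
  rewrite -(inj_eq (mulgI g)) mulKVg; case: ifP => // _.
  by rewrite mulmx0.
by move=> i /negbTE ig; rewrite ffunE ig scale0r.
Qed.
Lemma VG_ract_gen g v h : VG_ract (vg v h) (gelt g) = vg v (h * g)%g.
Proof.
apply/ffunP => k; rewrite !ffunE (bigD1 g) //= !ffunE eqxx scale1r big1 ?addr0.
  by rewrite -(inj_eq (mulIg g)) mulgKV.
by move=> i /negbTE ig; rewrite ffunE ig scale0r.
Qed.
Lemma VG_lact1 x : VG_lact 1 x = x.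
Proof.
apply/ffunP => k; rewrite ffunE (bigD1 1%g) //= ffunE eqxx scale1r repr_mx1.
rewrite mul1mx invg1 mul1g big1 ?addr0 // => g /negbTE g1.
by rewrite ffunE g1 scale0r.
Qed.
Lemma VG_ract1 x : VG_ract x 1 = x.
Proof.
apply/ffunP => k; rewrite ffunE (bigD1 1%g) //= ffunE eqxx scale1r.
rewrite invg1 mulg1 big1 ?addr0 // => g /negbTE g1.
by rewrite ffunE g1 scale0r.
Qed.
Lemma VG_lactM r s x : VG_lact (r * s) x = VG_lact r (VG_lact s x).
Proof.
apply/ffunP => k; rewrite !ffunE.
under eq_bigr => g _ do rewrite ffunE scaler_suml.
rewrite exchange_big /=; apply: eq_bigr => g _.
rewrite ffunE mulmx_sumr scaler_sumr (reindex_inj (mulgI g)) /=.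
apply: eq_bigr => h _; rewrite mulKg -scalemxAr scalerA mulmxA.
by rewrite -repr_mxM ?inE // invMg mulgA.
Qed.
Lemma VG_ractM r s x : VG_ract x (r * s) = VG_ract (VG_ract x r) s.
Proof.
apply/ffunP => k; rewrite !ffunE.
under eq_bigr => g _ do rewrite ffunE scaler_suml.
under [RHS]eq_bigr => g _ do rewrite ffunE scaler_sumr.
rewrite exchange_big [RHS]exchange_big /=; apply: eq_bigr => g _.
rewrite (reindex_inj (mulgI g)) /=.
apply: eq_bigr => h _; rewrite mulKg scalerA mulrC.
by rewrite invMg mulgA.
Qed.
Lemma VG_lractA r s x : VG_ract (VG_lact r x) s = VG_lact r (VG_ract x s).
Proof.
apply/ffunP => k; rewrite !ffunE.
under eq_bigr => g _ do rewrite ffunE scaler_sumr.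
under [RHS]eq_bigr => g _ do rewrite ffunE mulmx_sumr scaler_sumr.
rewrite exchange_big /=; apply: eq_bigr => g _; apply: eq_bigr => h _.
by rewrite -scalemxAr !scalerA mulrC mulgA.
Qed.

Definition VG_bimodule : bimodule grpalg :=
  Bimodule VG_lact_bilin VG_ract_bilin
    VG_lact1 VG_lactM VG_ract1 VG_ractM VG_lractA.

End GroupAlgebra.

Section Gradings.
Variables (K : fieldType) (A : zmodType).

Definition grading (V : lmodType K) (gr : A -> V -> Prop) : Prop :=
  [/\ forall a, gr a 0 /\ (forall k x y, gr a x -> gr a y -> gr a (k *: x + y)),
      forall x, exists (s : seq A) (c : A -> V),
        (forall a, gr a (c a)) /\ x = \sum_(a <- s) c a
    & forall (s : seq A) (c : A -> V), uniq s -> (forall a, gr a (c a)) ->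
        \sum_(a <- s) c a = 0 -> {in s, forall a, c a = 0}].

(* |x| = a, with the convention that |0| is the neutral element of A, which is
   written additively. *)
Definition has_degree (V : lmodType K) (gr : A -> V -> Prop) (x : V) (a : A) :=
  gr a x /\ (x = 0 -> a = 0).

Definition graded_algebra (R : algType K) (gr : A -> R -> Prop) : Prop :=
  grading gr /\ forall a b x y, gr a x -> gr b y -> gr (a + b) (x * y).

Definition graded_bimodule (R : algType K) (grR : A -> R -> Prop)
    (L : bimodule R) (grL : A -> L -> Prop) : Prop :=
  grading grL /\ forall a b c r x s, grR a r -> grL b x -> grR c s ->
    grL (a + b + c) (ract (lact r x) s).

Definition bicharacter (eps : A -> A -> K) : Prop :=
  [/\ forall a b, eps a b != 0,
      forall a b c, eps a (b + c) = eps a b * eps a c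
    & forall a b c, eps (a + b) c = eps a c * eps b c].

Definition antisymmetric_bicharacter (eps : A -> A -> K) : Prop :=
  bicharacter eps /\ forall a b, eps b a = (eps a b)^-1.

Structure color_Lie_ring (eps : A -> A -> K) (R : algType K)
    (grR : A -> R -> Prop) (L : bimodule R) (grL : A -> L -> Prop)
    (br : L -> L -> L) : Prop := ColorLieRing {
  clr_algebra : graded_algebra grR;
  clr_bimodule : graded_bimodule grR grL;
  clr_bilin : bilin br;
  clr_lr : forall r x y s, br (lact r x) (ract y s) = lact r (ract (br x y) s);
  clr_balanced : forall x r y, br (ract x r) y = br x (lact r y);
  clr_degree : forall x y a b, has_degree grL x a -> has_degree grL y b ->
    grL (a + b) (br x y);
  clr_antisym : forall x y a b, has_degree grL x a -> has_degree grL y b ->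
    br x y = - eps a b *: br y x;
  clr_jacobi : forall x y z a b c,
    has_degree grL x a -> has_degree grL y b -> has_degree grL z c ->
    eps c a *: br x (br y z) + eps a b *: br y (br z x)
      + eps b c *: br z (br x y) = 0
}.

Section Enveloping.
Variables (eps : A -> A -> K) (R : algType K) (L : bimodule R).
Variables (grL : A -> L -> Prop) (br : L -> L -> L).

Inductive uea_rel : talg L -> Prop :=
| Uea_rel u v a b of has_degree grL u a & has_degree grL v b :
    uea_rel (tinjL u * tinjL v - eps a b *: (tinjL v * tinjL u)
             - tinjL (br u v)).

Definition uea : Type := quotalg uea_rel.
HB.instance Definition _ := GRing.Lmodule.on uea.
HB.instance Definition _ := GRing.PzRing.on uea.
End Enveloping.

End Gradings.

Section YetterDrinfeld.
Variables (K : fieldType) (gT : finGroupType) (n : nat).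
Variable rG : mx_representation K [set: gT]%G n.
Variables (A : zmodType) (eps : A -> A -> K).
Variables (grG : A -> grpalg K gT -> Prop) (grV : A -> 'cV[K]_n -> Prop).
Variables (grL : A -> VG_bimodule rG -> Prop).
Variable br : VG_bimodule rG -> VG_bimodule rG -> VG_bimodule rG.

Structure Yetter_Drinfeld_color_Lie_ring : Prop := YetterDrinfeld {
  yd_color_Lie : color_Lie_ring eps grG grL br;
  yd_group : forall g, exists a, grG a (gelt K g);
  yd_grading : grading grV;
  yd_induced : forall v a g b, has_degree grV v a -> grG b (gelt K g) ->
    grL (a + b) (vg v g);
  yd_action : forall g b v a, grG b (gelt K g) -> has_degree grV v a ->
    rG g *m v = eps b a *: v
}.

Definition purely_positive_part : Prop :=
  forall v a, v != 0 -> grV a v -> eps a a = 1.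

(* Without this condition U(L) need not satisfy the PBW property: since gh = hg,
   the defining relations of U(L) for v (x) g and w (x) h, compared with those
   for v and w, give (1 - eps |g| |h|) w v = 0.  For instance, if G has order 2
   with generator g, V = K with trivial action and trivial degree,
   eps |g| |g| = -1 and [ , ] = 0, then v ^+ 2 = 0 in U(L). *)
Definition trivial_on_group : Prop :=
  forall g h a b, grG a (gelt K g) -> grG b (gelt K h) -> eps a b = 1.

End YetterDrinfeld.

Section QuantumDrinfeld.
Variables (K : fieldType) (gT : finGroupType) (n : nat).
Variable rG : mx_representation K [set: gT]%G n.
Local Notation V := 'cV[K]_n.

Lemma scale_bilin (U : lmodType K) :
  bilin (fun (a : K^o) (v : U) => (a : K) *: v).
Proof.
split=> [y|x] a u v; first by rewrite scalerDl scalerA.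
by rewrite scalerDr !scalerA mulrC.
Qed.
Lemma scale_bilinr (U : lmodType K) :
  bilin (fun (v : U) (a : K^o) => (a : K) *: v).
Proof. by have [l r] := scale_bilin U; split. Qed.

Definition vect_bimodule (U : lmodType K) : bimodule K^o.
Proof.
refine (@Bimodule K K^o U (fun a v => (a : K) *: v) (fun v a => (a : K) *: v)
  (scale_bilin U) (scale_bilinr U) (@scale1r K U) _ (@scale1r K U) _ _).
- by move=> a b v; rewrite scalerA.
- by move=> a b v; rewrite scalerA mulrC.
- by move=> a b v; rewrite !scalerA mulrC.
Defined.

Definition TV : algType K := talg (vect_bimodule V).
Definition tv (v : V) : TV := @tinjL K K^o (vect_bimodule V) v.

Definition TV_tmorph (g : gT) : tmorph (vect_bimodule V) TV.
Proof.
refine (@Tmorph K K^o (vect_bimodule V) TV (@tinjR _ _ _)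
  (fun v => tv (rG g *m v)) (@tinjR_linear _ _ _) _ (@tinjR1 _ _ _)
  (@tinjRM _ _ _) _ _).
- by move=> a u v; rewrite mulmxDr -scalemxAr; exact: tinjL_linear.
- by move=> a v; rewrite -tinjRl /= scalemxAr.
- by move=> a v; rewrite -tinjLr /= scalemxAr.
Defined.

(* The algebra automorphism of T(V) extending the action of g on V *)
Definition TV_act (g : gT) : TV -> TV := tlift_alg (TV_tmorph g).

Lemma TV_act_v g v : TV_act g (tv v) = tv (rG g *m v).
Proof. exact: tlift_algL. Qed.
Lemma TV_act_scalar g a :
  TV_act g (@tinjR K K^o (vect_bimodule V) a) = @tinjR K K^o (vect_bimodule V) a.
Proof. exact: (tlift_algR (TV_tmorph g) a). Qed.
Lemma TV_act1 x : TV_act 1%g x = x.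
Proof.
apply/esym; apply: (@tlift_alg_unique _ _ _ _ (TV_tmorph 1%g) id)
  => [a u v|y z|a|v].
- by [].
- by [].
- by [].
- by rewrite /= repr_mx1 mul1mx.
Qed.
Lemma TV_actM g h x : TV_act (g * h)%g x = TV_act g (TV_act h x).
Proof.
apply/esym; apply: (@tlift_alg_unique _ _ _ _ (TV_tmorph (g * h)%g)
  (fun x => TV_act g (TV_act h x))) => [|y z|a|v].
- by apply: linear_comp; exact: tlift_alg_linear.
- exact: etrans (congr1 (TV_act g) (tlift_algM (TV_tmorph h) y z))
    (tlift_algM (TV_tmorph g) _ _).
- change (TV_act g (TV_act h (@tinjR _ _ (vect_bimodule V) a)) = tinjR (vect_bimodule V) a).
  by rewrite !TV_act_scalar.
- change (TV_act g (TV_act h (tv v)) = tv (rG (g * h)%g *m v)).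
  by rewrite !TV_act_v mulmxA -repr_mxM ?inE.
Qed.

Definition TV_action : galg_action gT TV :=
  @GalgAction K gT TV TV_act (fun g => tlift_alg_linear (TV_tmorph g))
    (fun g => tlift_alg1 (TV_tmorph g)) (fun g => tlift_algM (TV_tmorph g))
    TV_act1 TV_actM.

Definition skewTV : algType K := skew TV_action.
Definition skew_v (v : V) : skewTV := sgen TV_action (tv v) 1%g.
Definition skew_g (g : gT) : skewTV := sgen TV_action 1 g.
(* V (x) KG as a subspace of the skew group algebra of T(V) *)
Definition skew_VG (x : VG K gT n) : skewTV := [ffun g => tv (x g)].

Definition diagonal_basis (b : n.-tuple V) : Prop :=
  basis_of fullv b /\
  forall g i, exists c : K, rG g *m tnth b i = c *: tnth b i.

Definition quantum_system (q : 'I_n -> 'I_n -> K) : Prop :=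
  [/\ forall i j, q i j != 0, forall i, q i i = 1
    & forall i j, q j i = (q i j)^-1].

Section Algebra.
Variables (b : n.-tuple V) (q : 'I_n -> 'I_n -> K).
Variable kappa : V -> V -> VG K gT n.
Local Notation v := (tnth b).

Definition parameter_function : Prop :=
  bilin kappa /\
  forall i j, kappa (v i) (v j) = - q i j *: kappa (v j) (v i).

Inductive qdoa_rel : skewTV -> Prop :=
| Qdoa_rel i j : qdoa_rel
    (skew_v (v i) * skew_v (v j) - q i j *: (skew_v (v j) * skew_v (v i))
     - skew_VG (kappa (v i) (v j))).

Definition qdoa : Type := quotalg qdoa_rel.
HB.instance Definition _ := GRing.Lmodule.on qdoa.
HB.instance Definition _ := GRing.PzRing.on qdoa.

Definition qdoa_pi (x : skewTV) : qdoa := api qdoa_rel x.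

Definition PBW_monomial (mg : {ffun 'I_n -> nat} * gT) : qdoa :=
  qdoa_pi ((\prod_(i < n) skew_v (v i) ^+ mg.1 i) * skew_g mg.2).

End Algebra.

Definition is_vector_basis (I : choiceType) (U : lmodType K) (e : I -> U) : Prop :=
  (forall x, exists (s : seq I) (c : I -> K), x = \sum_(i <- s) c i *: e i) /\
  (forall (s : seq I) (c : I -> K), uniq s -> \sum_(i <- s) c i *: e i = 0 ->
     {in s, forall i, c i = 0}).

Definition PBW_property b q kappa : Prop :=
  is_vector_basis (@PBW_monomial b q kappa).

Definition strong_vanishing (b : n.-tuple V) (q : 'I_n -> 'I_n -> K)
    (kappa : V -> V -> VG K gT n) : Prop :=
  forall (g : gT) (i j k r : 'I_n),
    coord b r (kappa (tnth b i) (tnth b j) g) != 0 ->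
    rG g *m tnth b k = (q i k * q j k * q k r) *: tnth b k.

End QuantumDrinfeld.

(* Main.v *)
Require Import Defs.
From HB Require Import structures.
From mathcomp Require Import all_boot all_order all_algebra all_fingroup.
From mathcomp Require Import mxrepresentation generic_quotient ring_quotient.
From mathcomp Require Import finmap boolp monalg.
From mathcomp Require Import ring zify.

Set Implicit Arguments.
Unset Strict Implicit.
Unset Printing Implicit Defensive.
Import GRing.Theory.
Local Open Scope ring_scope.

(** Both U(L) and H_(q,kappa) are quotients of T_KG(V (x) KG) = T(V) x| G.  By
    bilinearity and the Yetter-Drinfeld condition, the relations of U(L) for all
    homogeneous elements follow from those for pairs of basis vectors v_i, v_j,
    which are the relations of H_(q,kappa) when q_ij = eps |v_i| |v_j| and
    kappa (v_i, v_j) = [v_i, v_j].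

    For (i) the PBW property remains.  The relations rewrite words in the v_i
    into sorted words, which defines operators "left multiplication by v_i" on
    the space with basis the sorted words times G.  The color Jacobi identity
    implies by induction on the length of words that these operators satisfy the
    relations; so H_(q,kappa) acts on that space, and applying PBW monomials to
    the empty word shows that they are independent.

    For (ii), let A be the free abelian group on the v_i and the g in G, with
    the bicharacter eps (v_i, v_j) = q_ij, eps (g, v_i) = chi_i(g), eps (g, h) = 1,
    modulo the radical of eps, where chi_i is the character of G on v_i.  The
    strong vanishing condition and the G-invariance of kappa say that kappa is
    homogeneous for A.  The PBW property embeds V (x) KG in H_(q,kappa), where the
    bracket becomes the color commutator; this yields the invariance of kappa
    and the Jacobi identity. *)

(** * Linear maps, spans and quotient algebras *)

(** Three points shape the proof. Left multiplication by v_i is not a structural recursion: in v_i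
    v_l w = q_il v_l (v_i w) + [v_i, v_l] w with l < i, the vector v_i w may involve words as long
    as l w, so v_l acts on words that are no shorter, but l < i. Hence the lexicographic order by
    length and letter, both for termination and for checking the relations. In (i), these operators
    satisfy the relations only if the structure constants obey the strong vanishing condition and
    are G-invariant. Both follow by pairing with eps the equality |v_r| |g| = |v_i| |v_j|, valid
    whenever v_r g occurs in [v_i, v_j]. In (ii), equalities of degrees must conversely be deduced
    from values of eps. Division by the radical makes this possible; it also makes g -> |g|
    multiplicative, although the free group ignores the product of G. Characteristic 0 enters as 2
    <> 0, which with q_ii = 1 gives kappa (v_i, v_i) = 0. *)

Section Linear.
Variables (K : fieldType) (U V : lmodType K).

Lemma span_of_map (f : U -> V) (S : U -> Prop) (T : V -> Prop) x : linear f ->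
  (forall y, S y -> span_of T (f y)) -> span_of S x -> span_of T (f x).
Proof.
move=> lf ST; elim=> [y|| a y z _ IHy _ IHz]; first exact: ST.
  by rewrite (linf0 lf); exact: span_0.
by rewrite lf; exact: span_lin.
Qed.

Lemma span_of_eq (f g : U -> V) (S : U -> Prop) x : linear f -> linear g ->
  (forall y, S y -> f y = g y) -> span_of S x -> f x = g x.
Proof.
move=> lf lg fg; elim=> [y|| a y z _ IHy _ IHz]; first exact: fg.
  by rewrite (linf0 lf) (linf0 lg).
by rewrite lf lg IHy IHz.
Qed.


Lemma span_of_sum I (r : seq I) (F : I -> U) (S : U -> Prop) :
  (forall i, span_of S (F i)) -> span_of S (\sum_(i <- r) F i).
Proof. by move=> SF; apply/spanpP/rpred_sum => i _; exact/spanpP. Qed.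

Lemma span_ofD (S : U -> Prop) x y :
  span_of S x -> span_of S y -> span_of S (x + y).
Proof. by move=> Sx Sy; rewrite -[x]scale1r; exact: span_lin. Qed.

Lemma span_ofZ (S : U -> Prop) a x : span_of S x -> span_of S (a *: x).
Proof. by move=> Sx; rewrite -[_ *: _]addr0; apply: span_lin => //; exact: span_0. Qed.

Lemma linear_of_sum I (r : seq I) (F : I -> U -> V) :
  (forall i, linear (F i)) -> linear (fun x => \sum_(i <- r) F i x).
Proof.
move=> lF a x y; rewrite scaler_sumr -big_split.
by apply: eq_bigr => i _; exact: lF.
Qed.

Lemma linear_of_scale (f : U -> V) c : linear f -> linear (fun x => c *: f x).
Proof. by move=> lf a x y; rewrite lf scalerDr !scalerA mulrC. Qed.

End Linear.

Section MalgLinear.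
Variables (K : fieldType) (X : choiceType).
Local Notation M := {malg K[X]}.

Definition malg_lin (P : lmodType K) (f : X -> P) (p : M) : P :=
  \sum_(k <- msupp p) p@_k *: f k.

(** Vectors with different supports can then be compared over one common finite set. *)
Lemma malg_linE (P : lmodType K) (f : X -> P) (d : {fset X}) p :
  (msupp p `<=` d)%fset -> malg_lin f p = \sum_(k <- d) p@_k *: f k.
Proof.
move=> gd; rewrite /malg_lin (big_fset_incl _ gd) //= => k kd.
by rewrite -mcoeff_eq0 => /eqP->; rewrite scale0r.
Qed.

Lemma malg_lin_linear (P : lmodType K) (f : X -> P) : linear (malg_lin f).
Proof.
move=> a g h; pose d := (msupp (a *: g + h) `|` (msupp g `|` msupp h))%fset.
rewrite !(@malg_linE _ _ d) ?fsubsetUl //.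
- rewrite scaler_sumr -big_split /=; apply: eq_bigr => k _.
  by rewrite mcoeffD mcoeffZ scalerDl scalerA.
- by apply: fsubset_trans (fsubsetUr _ _); exact: fsubsetUr.
- by apply: fsubset_trans (fsubsetUr _ _); exact: fsubsetUl.
Qed.

Lemma malg_linU (P : lmodType K) (f : X -> P) k : malg_lin f << k >> = f k.
Proof. by rewrite /malg_lin msuppU oner_eq0 big_seq_fset1 mcoeffUU scale1r. Qed.

Lemma malg_ext (P : lmodType K) (f g : M -> P) : linear f -> linear g ->
  (forall k, f << k >> = g << k >>) -> f =1 g.
Proof.
move=> lf lg fg x; rewrite [x]monalgE (linf_sum lf) (linf_sum lg).
apply: eq_bigr => k _.
have -> : << x@_k *g k >> = x@_k *: << k >> :> M.
  by apply/malgP => l; rewrite mcoeffZ !mcoeffU mulr_natr.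
by rewrite (linfZ lf) (linfZ lg) fg.
Qed.

End MalgLinear.

Section QuotientIsomorphism.
Variables (K : fieldType) (A B : algType K) (S : A -> Prop) (T : B -> Prop).

Lemma ideal_of_map (phi : A -> B) x : linear phi ->
  (forall y z, phi (y * z) = phi y * phi z) ->
  (forall y, S y -> ideal_of T (phi y)) -> ideal_of S x -> ideal_of T (phi x).
Proof.
move=> lphi phiM ST; elim=> [y|| y z _ IHy _ IHz|a y _ IHy|a y _ IHy].
- exact: ST.
- by rewrite (linf0 lphi); exact: ideal_0.
- by rewrite (linfD lphi); exact: ideal_D.
- by rewrite phiM; exact: ideal_Ml.
- by rewrite phiM; exact: ideal_Mr.
Qed.

End QuotientIsomorphism.

Lemma quotalg_iso (K : fieldType) (A B : algType K) (S : A -> Prop)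
    (T : B -> Prop) (phi : A -> B) (psi : B -> A) :
  linear phi -> linear psi -> phi 1 = 1 ->
  (forall x y, phi (x * y) = phi x * phi y) ->
  (forall x y, psi (x * y) = psi x * psi y) ->
  cancel phi psi -> cancel psi phi ->
  (forall x, S x -> ideal_of T (phi x)) ->
  (forall y, T y -> ideal_of S (psi y)) ->
  exists f : {rmorphism quotalg S -> quotalg T}, linear f /\ bijective f.
Proof.
move=> lphi lpsi phi1 phiM psiM phiK psiK ST TS.
(* Both maps use the chosen representatives [qrepr]; [ideal_of_map] shows in [fE] and [gE] that the
   classes do not depend on this choice. *)
pose f (x : quotalg S) : quotalg T := api T (phi (qrepr x)).
pose g (y : quotalg T) : quotalg S := api S (psi (qrepr y)).
have fE x : f (api S x) = api T (phi x).
  apply/apiP; rewrite -(linfB lphi); apply: (ideal_of_map (S := S)) => //.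
  exact/apiP/api_repr.
have gE x : g (api T x) = api S (psi x).
  apply/apiP; rewrite -(linfB lpsi); apply: (ideal_of_map (S := T)) => //.
  exact/apiP/api_repr.
have lf : linear f.
  move=> a x y; rewrite -[x]api_repr -[y]api_repr -api_linear !fE lphi.
  exact: api_linear.
have fM : monoid_morphism f.
  split=> [|x y]; first by rewrite [1]/(api S 1) fE phi1.
  by rewrite -[x]api_repr -[y]api_repr -apiM !fE phiM apiM.
have fB : zmod_morphism f by move=> x y; exact: linfB.
pose F : {rmorphism quotalg S -> quotalg T} :=
  HB.pack_for {rmorphism quotalg S -> quotalg T} f
    (GRing.isZmodMorphism.Build _ _ f fB) (GRing.isMonoidMorphism.Build _ _ f fM).
exists F; split=> //; exists g => x.
  by rewrite -[x]api_repr [F _]fE gE phiK.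
by rewrite -[x]api_repr gE [F _]fE psiK.
Qed.

(** * Normal ordering *)

Section NormalOrdering.
Variables (K : fieldType) (gT : finGroupType) (n : nat).
Variables (q : 'I_n -> 'I_n -> K) (chi : 'I_n -> gT -> K).
Variable c : 'I_n -> 'I_n -> 'I_n -> gT -> K.
Local Notation X := (seq 'I_n * gT)%type.
Variables (M : lmodType K) (e : X -> M) (lin : (X -> M) -> M -> M).
Hypothesis lin_linear : forall f, linear (lin f).
Hypothesis linE : forall f x, lin f (e x) = f x.
Hypothesis basis_ext : forall f f' : M -> M, linear f -> linear f' ->
  (forall x, f (e x) = f' (e x)) -> f =1 f'.

Definition ord_sorted (w : seq 'I_n) : bool := sorted leq (map val w).
Arguments ord_sorted : simpl never.

Lemma ord_sorted_cons2 i j w :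
  ord_sorted [:: i, j & w] = (i <= j)%N && ord_sorted (j :: w).
Proof. by []. Qed.
Lemma ord_sorted_behead i w : ord_sorted (i :: w) -> ord_sorted w.
Proof. exact: path_sorted. Qed.

Definition word_char (w : seq 'I_n) (g : gT) : K := \prod_(i <- w) chi i g.

(** Left multiplication by g on the monomial w h: moving g past the letters of w costs the scalar
    [word_char w g]. *)
Definition gop (g : gT) : M -> M :=
  lin (fun x : X => word_char x.1 g *: e (x.1, (g * x.2)%g)).

(* Left multiplication by v_i on the PBW basis, where the word w with x = (w, g)
   stands for the monomial w g.  The recursion is on [k], which bounds the
   termination measure [rec_measure]; unsorted words are sent to 0. *)
Fixpoint vop_rec (k : nat) (i : 'I_n) (x : X) : M :=
  if k is k'.+1 then
    if ~~ ord_sorted x.1 then 0 else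
    if x.1 is l :: w then
      if (i <= l)%N then e (i :: x.1, x.2) else
      q i l *: lin (vop_rec k' l) (vop_rec k' i (w, x.2))
      + \sum_r \sum_g
          (c i l r g * word_char w g) *: vop_rec k' r (w, (g * x.2)%g)
    else e ([:: i], x.2)
  else 0.

Lemma vop_rec0 i x : vop_rec 0 i x = 0. Proof. by []. Qed.

Lemma vop_recS k i x : vop_rec k.+1 i x =
  if ~~ ord_sorted x.1 then 0 else
  if x.1 is l :: w then
    if (i <= l)%N then e (i :: x.1, x.2) else
    q i l *: lin (vop_rec k l) (vop_rec k i (w, x.2))
    + \sum_r \sum_g
        (c i l r g * word_char w g) *: vop_rec k r (w, (g * x.2)%g)
  else e ([:: i], x.2).
Proof. by []. Qed.

Opaque vop_rec.

(** Encodes the lexicographic order on (length, letter), as letters are below n. On l w with l < i,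
    the recursion applies v_i and v_r to w, which is shorter, and v_l to words of length at most
    that of l w, where the letter has decreased. *)
Definition rec_measure (i : 'I_n) (x : X) : nat := size x.1 * n + i.

(** The successor matters: at fuel 0 the recursion returns the default value 0, so the fuel must
    exceed the measure. By [vop_recE] all such fuels agree. *)
Definition vop_word (i : 'I_n) (x : X) : M := vop_rec (rec_measure i x).+1 i x.
Definition vop (i : 'I_n) : M -> M := lin (vop_word i).

(* The operator of [v_i, v_j], with [c i j r g] the coefficient of v_r g in it. *)
Definition brop (i j : 'I_n) (p : M) : M :=
  \sum_r \sum_g c i j r g *: vop r (gop g p).

(** The filtration by word length, along which the relations between the operators are proved. *)
Definition short (m : nat) : M -> Prop :=
  span_of (fun p => exists x : X, (size x.1 <= m)%N /\ p = e x).

Lemma gop_linear g : linear (gop g). Proof. exact: lin_linear. Qed.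
Lemma vop_linear i : linear (vop i). Proof. exact: lin_linear. Qed.
Lemma brop_linear i j : linear (brop i j).
Proof.
apply: linear_of_sum => r; apply: linear_of_sum => g; apply: linear_of_scale.
by apply: linear_comp; [exact: vop_linear|exact: gop_linear].
Qed.

Lemma gopU g w h : gop g (e (w, h)) = word_char w g *: e (w, (g * h)%g).
Proof. exact: linE. Qed.
Lemma vopU i x : vop i (e x) = vop_word i x.
Proof. exact: linE. Qed.

Lemma short_gen m x : (size x.1 <= m)%N -> short m (e x).
Proof. by move=> xm; apply: span_gen; exists x. Qed.

Lemma short_le m m' p : (m <= m')%N -> short m p -> short m' p.
Proof.
move=> mm; apply: (@span_of_map _ _ _ id) => // _ [x [xm ->]].
exact/short_gen/(leq_trans xm).
Qed.

(** Stated for every fuel, because the stability proof below needs it first: there v_l is applied to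
    a vector of which only the length is known. *)
Lemma vop_rec_short k i x : short (size x.1).+1 (vop_rec k i x).
Proof.
elim: k i x => [|k IH] i [w h]; first by rewrite vop_rec0; exact: span_0.
rewrite vop_recS /=.
case: ifP => _; first exact: span_0.
case: w => [|l w] /=; first exact: short_gen.
case: ifP => _; first exact: short_gen.
apply: span_ofD.
  apply: span_ofZ; apply: (span_of_map (lin_linear _)); last first.
    exact: IH.
  move=> _ [x [xm ->]]; rewrite linE; apply: short_le (IH l x).
  by [].
apply: span_of_sum => r; apply: span_of_sum => g; apply: span_ofZ.
by apply: short_le (IH r _).
Qed.

Lemma vop_rec_stable k i x :
  (rec_measure i x < k)%N -> vop_rec k.+1 i x = vop_rec k i x.
Proof.
elim: k i x => [//|k IH] i [w h] mk; rewrite [LHS]vop_recS [RHS]vop_recS /=.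
case: (ord_sorted w) => [|//] /=.
case: w mk => [//|l w].
rewrite /rec_measure /= mulSn => mk.
case: (leqP i l) => [//|li].
congr (_ *: _ + _).
- rewrite [vop_rec k.+1 i _]IH; last first.
    rewrite /rec_measure /=; move: mk (ltn_ord i); lia.
  (* The two linear maps need only agree on words of length at most that of l w; there the measure
     has dropped because l < i. *)
  apply: (span_of_eq _ _ _ (vop_rec_short k i (w, h))).
  + exact: lin_linear.
  + exact: lin_linear.
  move=> _ [x [/= xm ->]]; rewrite !linE; apply: IH; rewrite /rec_measure.
  have: (size x.1 * n <= (size w).+1 * n)%N by rewrite leq_mul2r xm orbT.
  rewrite mulSn; move: mk li (ltn_ord i); lia.
- apply: eq_bigr => r _; apply: eq_bigr => g _; congr (_ *: _).
  apply: IH; rewrite /rec_measure /=; move: mk (ltn_ord r); lia.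
Qed.

Lemma vop_recE k i x : (rec_measure i x < k)%N -> vop_rec k i x = vop_word i x.
Proof.
move=> /subnKC <-; elim: (k - _)%N => [|d IH]; first by rewrite addn0.
by rewrite addnS vop_rec_stable // leq_addr.
Qed.

Lemma vop_word_short i x : short (size x.1).+1 (vop_word i x).
Proof. exact: vop_rec_short. Qed.

Lemma vop_short m i p : short m p -> short m.+1 (vop i p).
Proof.
apply: span_of_map; first exact: vop_linear.
move=> _ [x [xm ->]]; rewrite vopU.
exact: short_le (vop_word_short i x).
Qed.

Lemma vop_unsorted i x : ~~ ord_sorted x.1 -> vop i (e x) = 0.
Proof. by move=> xs; rewrite vopU /vop_word vop_recS xs. Qed.

Lemma vop_cons i w h : ord_sorted (i :: w) -> vop i (e (w, h)) = e (i :: w, h).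
Proof.
rewrite vopU /vop_word vop_recS /=; case: w => [|l w] // s.
by move: s; rewrite ord_sorted_cons2 => /andP[-> ->].
Qed.

(** The rewriting rule with the fuel eliminated. With [vop_cons] and [vop_unsorted] it determines
    [vop], so [vop_rec] need not be unfolded to check the relations. *)
Lemma vop_swap (i l : 'I_n) w h : ord_sorted (l :: w) -> (l < i)%N ->
  vop i (e (l :: w, h)) =
    q i l *: vop l (vop i (e (w, h))) + brop i l (e (w, h)).
Proof.
move=> s li; rewrite vopU /vop_word; set k := rec_measure _ _.
have kE : k = (size w * n + n + i)%N by rewrite /k /rec_measure /= mulSn; lia.
rewrite vop_recS /= s leqNgt li /=; congr (_ *: _ + _).
- rewrite vop_recE ?vopU; last first.
    rewrite /rec_measure /= kE; move: (ltn_ord i); lia.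
  apply: (span_of_eq _ (vop_linear l) _ (vop_word_short i (w, h))).
    exact: lin_linear.
  move=> _ [x [/= xm ->]]; rewrite linE vopU; apply: vop_recE.
  rewrite /rec_measure kE.
  have: (size x.1 * n <= (size w).+1 * n)%N by rewrite leq_mul2r xm orbT.
  rewrite mulSn; move: li (ltn_ord i); lia.
- apply: eq_bigr => r _; apply: eq_bigr => g _.
  rewrite gopU (linfZ (vop_linear r)) scalerA vopU vop_recE //.
  rewrite /rec_measure /= kE; move: (ltn_ord r); lia.
Qed.

Hypothesis abelG : forall g h : gT, (g * h = h * g)%g.
Hypothesis q_neq0 : forall i j, q i j != 0.
Hypothesis qV : forall i j, q j i = (q i j)^-1.
Hypothesis qii : forall i, q i i = 1.
Hypothesis chiM : forall i g h, chi i (g * h)%g = chi i g * chi i h.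
Hypothesis c_antisym : forall i j r g, c i j r g = - q i j * c j i r g.
Hypothesis c_diag : forall i r g, c i i r g = 0.
Hypothesis c_vanish : forall i j k r g, c i j r g != 0 ->
  chi k g = q i k * q j k * q k r.
Hypothesis c_inv : forall i j r g h, c i j r g != 0 ->
  chi i h * chi j h = chi r h.
Hypothesis c_jacobi : forall i j l s k,
  \sum_r \sum_g (c j l r g * c i r s (k * g^-1)%g
    - q i j * (c i l r g * c j r s (k * g^-1)%g)
    + q j l * q i l * (c i j r g * c l r s (k * g^-1)%g)) = 0.

Lemma word_charM w g h : word_char w (g * h)%g = word_char w g * word_char w h.
Proof. by rewrite -big_split; apply: eq_bigr => i _; exact: chiM. Qed.

Lemma gopM g h p : gop g (gop h p) = gop (g * h)%g p.
Proof.
move: p; apply: basis_ext => [||[w k]].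
- by apply: linear_comp; exact: gop_linear.
- exact: gop_linear.
rewrite !gopU (linfZ (gop_linear g)) gopU scalerA word_charM mulrC.
by rewrite mulgA.
Qed.

(** The operator version of g v_i = chi_i(g) v_i g. It is proved at fixed fuel, so that the
    induction follows the recursion itself. *)
Lemma gop_vop_rec k i x g : gop g (vop_rec k i x) =
  (chi i g * word_char x.1 g) *: vop_rec k i (x.1, (g * x.2)%g).
Proof.
elim: k i x => [|k IH] i [w h].
  by rewrite !vop_rec0 (linf0 (gop_linear g)) scaler0.
rewrite !vop_recS /=.
case: (ord_sorted w) => /=; last by rewrite (linf0 (gop_linear g)) scaler0.
have charc j u : chi j g * word_char u g = word_char (j :: u) g.
  by rewrite /word_char big_cons.
case: w => [|l w] /=; first by rewrite gopU charc.
case: (leqP i l) => li; first by rewrite gopU charc.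
have IHl p : gop g (lin (vop_rec k l) p) =
    chi l g *: lin (vop_rec k l) (gop g p).
  move: p; apply: basis_ext => [||[u h']].
  - by apply: linear_comp; [exact: gop_linear|exact: lin_linear].
  - apply: linear_of_scale; apply: linear_comp; first exact: lin_linear.
    exact: gop_linear.
  - by rewrite gopU (linfZ (lin_linear _)) !linE IH scalerA.
rewrite (linfD (gop_linear g)) (linfZ (gop_linear g)) IHl IH /=.
rewrite (linfZ (lin_linear _)) scalerDr !scalerA; congr (_ *: _ + _).
  by rewrite -charc; ring.
rewrite (linf_sum (gop_linear g)) scaler_sumr; apply: eq_bigr => r _.
rewrite (linf_sum (gop_linear g)) scaler_sumr; apply: eq_bigr => g' _.
rewrite (linfZ (gop_linear g)) IH /= !scalerA !mulgA [(g * g')%g]abelG.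
(* The bracket term has the weight chi_r and the exchange term the weight chi_i chi_l; by [c_inv]
   they coincide whenever the structure constant is nonzero. *)
congr (_ *: _); have [->|c0] := eqVneq (c i l r g') 0; first by rewrite !mul0r mulr0.
by rewrite -charc -(c_inv g c0); ring.
Qed.

Lemma gop_vop g i p : gop g (vop i p) = chi i g *: vop i (gop g p).
Proof.
move: p; apply: basis_ext => [||[w h]].
- by apply: linear_comp; [exact: gop_linear|exact: vop_linear].
- by apply: linear_of_scale; apply: linear_comp; [exact: vop_linear|exact: gop_linear].
rewrite vopU gop_vop_rec gopU (linfZ (vop_linear i)) vopU scalerA.
by rewrite /vop_word.
Qed.

(** The relation is localized at one vector, so that it can be proved by induction on the length of
    that vector. *)
Definition commutes_at i j p : Prop :=
  vop i (vop j p) = q i j *: vop j (vop i p) + brop i j p.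

Lemma commutes_at_span i j (S : M -> Prop) p :
  (forall p', S p' -> commutes_at i j p') -> span_of S p -> commutes_at i j p.
Proof.
apply: span_of_eq; first by apply: linear_comp; exact: vop_linear.
by apply: linear_comb; [apply: linear_comp; exact: vop_linear|exact: brop_linear].
Qed.

Lemma brop_antisym i j p : brop i j p = - q i j *: brop j i p.
Proof.
rewrite scaler_sumr; apply: eq_bigr => r _.
rewrite scaler_sumr; apply: eq_bigr => g _.
by rewrite scalerA -c_antisym.
Qed.

Lemma qK i j : q i j * q j i = 1.
Proof. by rewrite [q j i]qV mulfV. Qed.

Lemma commutes_at_sym i j p : commutes_at i j p -> commutes_at j i p.
Proof.
rewrite /commutes_at => ->; rewrite scalerDr scalerA qK scale1r.
by rewrite [brop j i p]brop_antisym scaleNr addrK.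
Qed.

Lemma commutes_at_diag i p : commutes_at i i p.
Proof.
rewrite /commutes_at qii scale1r [brop _ _ _]big1 ?addr0 // => r _.
by rewrite big1 // => g _; rewrite c_diag scale0r.
Qed.

(* The operator of [v_i, [v_j, v_l]]. *)
Definition brop2 i j l p : M := \sum_r \sum_g c j l r g *: brop i r (gop g p).

(** The bracket [v_j, v_l] commutes with v_i up to the same scalar as the product v_j v_l. Indeed a
    term v_r g contributes q_ir when v_i passes v_r and chi_i(g) when g passes v_i, and [c_vanish]
    is the identity q_ij q_il chi_i(g) = q_ir. *)
Lemma vop_brop i j l p : (forall r g, commutes_at i r (gop g p)) ->
  vop i (brop j l p) = (q i j * q i l) *: brop j l (vop i p) + brop2 i j l p.
Proof.
move=> rel; rewrite scaler_sumr -big_split (linf_sum (vop_linear i)).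
apply: eq_bigr => r _; rewrite scaler_sumr -big_split (linf_sum (vop_linear i)).
apply: eq_bigr => g _; rewrite (linfZ (vop_linear i)) rel scalerDr /=.
congr (_ + _); rewrite gop_vop (linfZ (vop_linear r)) !scalerA.
have [->|c0] := eqVneq (c j l r g) 0; first by rewrite !(mul0r, mulr0).
congr (_ *: _); rewrite (c_vanish i c0).
transitivity (q i j * q j i * (q i l * q l i) * (c j l r g * q i r)); last by ring.
by rewrite !qK !mul1r.
Qed.

Lemma brop2E i j l p : brop2 i j l p = \sum_s \sum_k
  (\sum_r \sum_g c j l r g * c i r s (k * g^-1)%g) *: vop s (gop k p).
Proof.
rewrite /brop2 /brop.
under eq_bigr => r _ do under eq_bigr => g _ do rewrite scaler_sumr.
under eq_bigr => r _ do rewrite exchange_big.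
rewrite exchange_big /=; apply: eq_bigr => s _.
under eq_bigr => r _.
  under eq_bigr => g _.
    (* Substituting k g^-1 for the inner group element makes the product with g equal to k, so the
       coefficient of v_s k becomes a convolution. *)
    rewrite (reindex_inj (mulIg g^-1)%g) scaler_sumr.
    under eq_bigr => k _ do rewrite gopM mulgKV scalerA.
    over.
  rewrite exchange_big; over.
rewrite exchange_big /=; apply: eq_bigr => k _.
rewrite scaler_suml; apply: eq_bigr => r _; rewrite scaler_suml.
by [].
Qed.

Lemma brop2_jacobi i j l p :
  brop2 i j l p - q i j *: brop2 j i l p + (q j l * q i l) *: brop2 l i j p = 0.
Proof.
rewrite !brop2E !scaler_sumr -sumrB -big_split big1 // => s _ /=.
rewrite !scaler_sumr -sumrB -big_split big1 // => k _ /=.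
rewrite !scalerA -scalerBl -scalerDl -[RHS](scale0r (vop s (gop k p))).
congr (_ *: _); rewrite -[RHS](c_jacobi i j l s k) !mulr_sumr -sumrB -big_split.
apply: eq_bigr => r _ /=; rewrite !mulr_sumr -sumrB -big_split.
by [].
Qed.

(* The overlap v_i v_j v_l of the rewriting system: both ways of reducing it agree
   by the Jacobi identity. *)
Lemma commutes_at_cons (i j l : 'I_n) p : commutes_at j l p -> commutes_at i l p ->
  commutes_at i j p -> commutes_at i l (vop j p) -> commutes_at j l (vop i p) ->
  (forall a r g, commutes_at a r (gop g p)) -> commutes_at i j (vop l p).
Proof.
move=> jlp ilp ijp iljp jlip gp; rewrite /commutes_at jlp ilp.
rewrite !(linfD (vop_linear _)) !(linfZ (vop_linear _)) iljp jlip ijp.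
rewrite !(linfD (vop_linear _)) !(linfZ (vop_linear _)) !vop_brop //.
have /eqP := brop2_jacobi i j l p.
rewrite addrAC subr_eq0 eq_sym => /eqP E.
rewrite !scalerDr E !scalerA.
have -> : q j l * (q i l * (q l i * q l j)) = 1.
  by rewrite -[RHS](mulr1 1) -{1}(qK j l) -(qK i l); ring.
have -> : q i j * (q j i * q j l) = q j l by rewrite mulrA qK mul1r.
rewrite scale1r [q j l * q i l * q i j](_ : _ = q i j * q i l * q j l); last by ring.
by rewrite [LHS](AC (1*2*1*2) ((1*5)*(4*(6*3))*2))%AC.
Qed.

(* The inner induction on [j] reaches the pairs (i, l) and (j, l) with l < j, at
   vectors that are not shorter. *)
Lemma commutes_at_lt m :
  (forall i j (x : X), (size x.1 < m)%N -> commutes_at i j (e x)) ->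
  forall (j i : 'I_n) x, (j < i)%N -> (size x.1 <= m)%N -> commutes_at i j (e x).
Proof.
move=> IHm j; have [k] := ubnP (val j); elim: k j => [//|k IHk] j jk i [w h] ji.
 have [xs|xu _] := boolP (ord_sorted w); last first.
  rewrite /commutes_at /brop !vop_unsorted // !(linf0 (vop_linear _)) scaler0.
  rewrite add0r big1 // => r _; rewrite big1 // => g _.
  by rewrite gopU (linfZ (vop_linear r)) vop_unsorted // !scaler0.
case: w xs => [|l w] xs /= wm.
  by rewrite /commutes_at vop_cons // vop_swap.
(* If j <= l, then j l w is sorted and the relation is the rewriting rule itself. Otherwise l < j <
   i, and the vector is v_l applied to a shorter one: an overlap. *)
have [jl|lj] := leqP j l.
  rewrite /commutes_at [vop j _]vop_cons; first by rewrite vop_swap // ord_sorted_cons2 jl.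
  by rewrite ord_sorted_cons2 jl.
have sp : short (size w) (e (w, h)) by exact: short_gen.
have IHm' a b p : short (size w) p -> commutes_at a b p.
  apply: commutes_at_span => _ [y [ym ->]]; apply: IHm.
  exact: leq_ltn_trans ym wm.
have IHj' (a : 'I_n) p : (l < a)%N -> short m p -> commutes_at a l p.
  move=> la; apply: commutes_at_span => _ [y [ym ->]]; apply: IHk => //.
  exact: leq_trans lj _.
have sm a : short m (vop a (e (w, h))).
  exact: short_le wm (vop_short a sp).
rewrite -vop_cons //; apply: commutes_at_cons; try exact: IHm'.
- by apply: IHj'; rewrite // (ltn_trans lj).
- exact: IHj'.
- move=> a r g; apply: IHm'; rewrite gopU; apply: span_ofZ; exact: short_gen.
Qed.

Lemma vop_vop i j p : vop i (vop j p) = q i j *: vop j (vop i p) + brop i j p.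
Proof.
have H m : forall i j x, (size x.1 < m)%N -> commutes_at i j (e x).
  elim: m => [//|m IHm] {}i {}j x xm.
  have [ji|ij|/val_inj->] := ltngtP j i; last exact: commutes_at_diag.
    exact: (commutes_at_lt IHm).
  by apply: commutes_at_sym; exact: (commutes_at_lt IHm).
move: p; apply: basis_ext => [||x]; last exact: H.
  by apply: linear_comp; exact: vop_linear.
by apply: linear_comb; [apply: linear_comp; exact: vop_linear|exact: brop_linear].
Qed.

End NormalOrdering.

(** * Modules over T(V) x| G *)

Lemma talg_extM (K : fieldType) (R : algType K) (L : bimodule R)
    (P : lmodType K) (f g : talg L -> P) :
  linear f -> linear g -> (forall r, f (tinjR L r) = g (tinjR L r)) ->
  (forall l t, f t = g t -> f (tinjL l * t) = g (tinjL l * t)) -> f =1 g.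
Proof.
move=> lf lg fg0 fgS; apply: talg_ext => // m l IH t.
by rewrite -tinjLM; exact/fgS/IH.
Qed.

Lemma tv_linear (K : fieldType) n : linear (@tv K n).
Proof. exact: (@tinjL_linear K K^o (vect_bimodule 'cV[K]_n)). Qed.

Section AlgebraModule.
Variables (K : fieldType) (A : algType K) (M : lmodType K) (act : A -> M -> M).
Hypotheses (act_linearl : forall p, linear (act^~ p)).
Hypotheses (act_linearr : forall x, linear (act x)).
Hypothesis actM : forall x y p, act (x * y) p = act x (act y p).

Lemma act_commutator_eq0 a x y z fx fy p :
  (forall p, act x p = fx p) -> (forall p, act y p = fy p) ->
  fx (fy p) = a *: fy (fx p) + act z p ->
  act (x * y - a *: (y * x) - z) p = 0.
Proof.
move=> xE yE fE; rewrite !(linfB (act_linearl p)) (linfZ (act_linearl p)) !actM.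
by rewrite !xE !yE fE addrAC addrK subrr.
Qed.

Lemma act_ideal (S : A -> Prop) x p : (forall y, S y -> forall p, act y p = 0) ->
  ideal_of S x -> act x p = 0.
Proof.
move=> S0 Ix; elim: Ix p => [y|p|y z _ IHy _ IHz p|a y _ IHy p|a y _ IHy p].
- exact: S0.
- exact: linf0 (act_linearl p).
- by rewrite (linfD (act_linearl p)) IHy IHz addr0.
- by rewrite actM IHy (linf0 (act_linearr _)).
- by rewrite actM IHy.
Qed.
End AlgebraModule.

Section SkewTensorModule.
Variables (K : fieldType) (gT : finGroupType) (n : nat).
Variable rG : mx_representation K [set: gT]%G n.
Local Notation V := 'cV[K]_n.
Local Notation TVb := (vect_bimodule V).
Variables (b : n.-tuple V) (chi : 'I_n -> gT -> K).
Local Notation v := (tnth b).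
Hypothesis basis_b : basis_of fullv b.
Hypothesis chiE : forall g i, rG g *m v i = chi i g *: v i.

Lemma basis_coord (x : V) : x = \sum_i coord b i x *: v i.
Proof.
rewrite [LHS](coord_basis basis_b) ?memvf //; apply: eq_bigr => i _.
by rewrite (tnth_nth 0).
Qed.

Lemma coord_v i j : coord b i (v j) = (i == j)%:R.
Proof. by rewrite (tnth_nth 0) coord_free ?(basis_free basis_b) // eq_sym. Qed.

Lemma v_neq0 i : v i != 0.
Proof.
apply/eqP => vi0; have := coord_v i i; rewrite vi0 linear0 eqxx.
by move/esym/eqP; rewrite oner_eq0.
Qed.

Lemma basis_scale_inj i (a a' : K) : a *: v i = a' *: v i -> a = a'.
Proof.
by move/eqP; rewrite -subr_eq0 -scalerBl scaler_eq0 (negbTE (v_neq0 i)) orbF subr_eq0 => /eqP.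
Qed.

Lemma diag_charM i g h : chi i (g * h)%g = chi i g * chi i h.
Proof.
apply: (@basis_scale_inj i); rewrite -chiE repr_mxM ?inE // -mulmxA chiE.
by rewrite -scalemxAr chiE scalerA mulrC.
Qed.

Lemma diag_char1 i : chi i 1%g = 1.
Proof. by apply: (@basis_scale_inj i); rewrite -chiE repr_mx1 mul1mx scale1r. Qed.

Lemma coord_action i g x : coord b i (rG g *m x) = chi i g * coord b i x.
Proof.
rewrite {1}[x]basis_coord mulmx_sumr linear_sum (bigD1 i) //= big1 => [|j ji].
  by rewrite -scalemxAr chiE !linearZ /= coord_v eqxx mulr1 addr0 mulrC.
by rewrite -scalemxAr chiE !linearZ /= coord_v eq_sym (negbTE ji) !mulr0.
Qed.

Variables (M : lmodType K) (L : 'I_n -> M -> M) (rho : gT -> M -> M).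
Hypotheses (L_linear : forall i, linear (L i)).
Hypotheses (rho_linear : forall g, linear (rho g)).
Hypothesis rho1 : forall p, rho 1%g p = p.
Hypothesis rhoM : forall g h p, rho g (rho h p) = rho (g * h)%g p.
Hypothesis rhoL : forall g i p, rho g (L i p) = chi i g *: L i (rho g p).

Definition vect_op (x : V) (p : M) : M := \sum_i coord b i x *: L i p.

Lemma vect_op_bilin : bilin vect_op.
Proof.
split=> [p|x]; last by apply: linear_of_sum => i; exact: linear_of_scale.
apply: linear_of_sum => i a x y.
by rewrite linearP scalerDl /= scalerA.
Qed.

Lemma vect_opv i p : vect_op (v i) p = L i p.
Proof.
rewrite /vect_op (bigD1 i) //= coord_v eqxx scale1r big1 ?addr0 // => j ji.
by rewrite coord_v (negbTE ji) scale0r.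
Qed.

Lemma vect_opZ a x p : vect_op (a *: x) p = a *: vect_op x p.
Proof. exact: linfZ (vect_op_bilin.1 p) a x. Qed.
Lemma vect_opZr a x p : vect_op (a *: x) p = vect_op x (a *: p).
Proof. by rewrite vect_opZ (linfZ (vect_op_bilin.2 x)). Qed.

Definition vect_topers : topers TVb :=
  @Topers K K^o TVb M (fun a p => (a : K) *: p) vect_op (scale_bilin M)
    vect_op_bilin (@scale1r K M) (fun a c p => esym (scalerA a c p))
    vect_opZ vect_opZr.

Definition tens_op : TV K n -> M -> M := @trep K K^o TVb vect_topers.

Lemma tens_opM x y p : tens_op (x * y) p = tens_op x (tens_op y p).
Proof. exact: (@trepM K K^o TVb vect_topers). Qed.

Lemma tens_op_linearl p : linear (tens_op^~ p).
Proof. exact: (@trep_linearl K K^o TVb vect_topers). Qed.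
Lemma tens_op_linearr x : linear (tens_op x).
Proof. exact: (@trep_linearr K K^o TVb vect_topers). Qed.

Lemma tens_op_scalar a p : tens_op (@tinjR K K^o TVb a) p = a *: p.
Proof. exact: (@trep0 K K^o TVb vect_topers). Qed.

Lemma tens_op_tv x p : tens_op (tv x) p = vect_op x p.
Proof. by rewrite /tens_op /tv /tinjL trepS trep0 /= scale1r. Qed.

Lemma rho_vect_op g x p : vect_op (rG g *m x) (rho g p) = rho g (vect_op x p).
Proof.
rewrite /vect_op (linf_sum (rho_linear g)); apply: eq_bigr => i _.
by rewrite (linfZ (rho_linear g)) rhoL scalerA coord_action mulrC.
Qed.

Opaque TV_act tv tens_op.

(** This compatibility lets an action of T(V) and one of G combine into an action of the skew group
    algebra. On generators it is [rhoL], and both sides are multiplicative in x. *)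
Lemma rho_tens_op g x p : tens_op (TV_act rG g x) (rho g p) = rho g (tens_op x p).
Proof.
have actM y z : TV_act rG g (y * z) = TV_act rG g y * TV_act rG g z.
  exact: (Defs.gactM (TV_action rG) g).
have H : (fun x => tens_op (TV_act rG g x) (rho g p)) =1
    (fun x => rho g (tens_op x p)).
  apply: talg_extM => [||a|l t IH].
  - apply: (linear_comp (f := tens_op^~ (rho g p))).
      exact: tens_op_linearl.
    exact: (gact_linear (TV_action rG) g).
  - by apply: linear_comp; [exact: rho_linear|exact: tens_op_linearl].
  - by rewrite [TV_act _ _ _]TV_act_scalar !tens_op_scalar (linfZ (rho_linear g)).
  - have -> : TV_act rG g (tinjL l * t) = tv (rG g *m l) * TV_act rG g t.
      by rewrite actM TV_act_v.
    transitivity (tens_op (tv (rG g *m l)) (tens_op (TV_act rG g t) (rho g p))).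
      exact: tens_opM.
    transitivity (rho g (tens_op (tv l) (tens_op t p))).
      apply: etrans (congr1 (tens_op _) IH) _.
      apply: etrans (tens_op_tv _ _) _.
      apply: etrans (rho_vect_op g l _) _.
      by apply: (congr1 (rho g)); apply: esym; apply: tens_op_tv.
    by apply: (congr1 (rho g)); apply: esym; apply: tens_opM.
exact: H.
Qed.

Definition skew_op (x : skewTV rG) (p : M) : M := \sum_g tens_op (x g) (rho g p).

Lemma skew_op_linearl p : linear (skew_op^~ p).
Proof.
apply: linear_of_sum => g a x y; rewrite !ffunE; exact: tens_op_linearl.
Qed.
Lemma skew_op_linearr x : linear (skew_op x).
Proof.
apply: linear_of_sum => g; apply: linear_comp; [exact: tens_op_linearr|exact: rho_linear].
Qed.

Lemma skew_opM x y p : skew_op (x * y) p = skew_op x (skew_op y p).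
Proof.
rewrite /skew_op.
under eq_bigr => k _ do rewrite ffunE (linf_sum (tens_op_linearl _)).
rewrite exchange_big; apply: eq_bigr => g _ /=.
rewrite (reindex_inj (mulgI g)) (linf_sum (rho_linear g)).
rewrite (linf_sum (tens_op_linearr _)); apply: eq_bigr => h _ /=.
by rewrite mulKg tens_opM -rhoM -rho_tens_op.
Qed.

Lemma skew_op_gen x g p : skew_op (sgen (TV_action rG) x g) p = tens_op x (rho g p).
Proof.
rewrite /skew_op (bigD1 g) //= ffunE eqxx big1 ?addr0 // => h /negbTE hg.
by rewrite ffunE hg (linf0 (tens_op_linearl _)).
Qed.

Lemma skew_op_v i p : skew_op (skew_v rG (v i)) p = L i p.
Proof. by rewrite skew_op_gen tens_op_tv vect_opv rho1. Qed.
Lemma skew_op_g g p : skew_op (skew_g rG g) p = rho g p.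
Proof. by rewrite skew_op_gen -[1]tinjR1 tens_op_scalar scale1r. Qed.

Lemma skew_op_VG x p :
  skew_op (skew_VG rG x) p = \sum_r \sum_g coord b r (x g) *: L r (rho g p).
Proof.
rewrite exchange_big; apply: eq_bigr => g _ /=.
by rewrite ffunE tens_op_tv.
Qed.

Variables (q : 'I_n -> 'I_n -> K) (kappa : V -> V -> VG K gT n).
Hypothesis LL : forall i j p, L i (L j p) = q i j *: L j (L i p)
  + \sum_r \sum_g coord b r (kappa (v i) (v j) g) *: L r (rho g p).

Lemma skew_op_ideal x p : ideal_of (@qdoa_rel K gT n rG b q kappa) x -> skew_op x p = 0.
Proof.
move=> Ix; apply: act_ideal Ix => [{}p|{}x||_ [i j] {}p].
- exact: skew_op_linearl.
- exact: skew_op_linearr.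
- exact: skew_opM.
apply: (act_commutator_eq0 skew_op_linearl skew_opM (fx := L i) (fy := L j)).
- by move=> p'; apply: skew_op_v.
- by move=> p'; apply: skew_op_v.
- by apply: etrans (LL i j p) _; apply: (congr1 (+%R _)); apply: esym; apply: skew_op_VG.
Qed.

End SkewTensorModule.

(** * Straightening: the span of the sorted monomials *)

Section NormalOrderedSpan.
Variables (K : fieldType) (gT : finGroupType) (n : nat).
Variables (q : 'I_n -> 'I_n -> K) (chi : 'I_n -> gT -> K).
Variable c : 'I_n -> 'I_n -> 'I_n -> gT -> K.
Variables (M : lmodType K) (L : 'I_n -> M -> M) (rho : gT -> M -> M) (z : M).
Hypotheses (L_linear : forall i, linear (L i)).
Hypotheses (rho_linear : forall g, linear (rho g)).
Hypothesis rhoM : forall g h p, rho g (rho h p) = rho (g * h)%g p.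
Hypothesis rhoL : forall g i p, rho g (L i p) = chi i g *: L i (rho g p).
Hypothesis LL : forall i j p, L i (L j p) = q i j *: L j (L i p)
  + \sum_r \sum_g c i j r g *: L r (rho g p).

Definition sorted_monomial (m : nat) (p : M) : Prop :=
  exists w g, [/\ ord_sorted w, (size w <= m)%N & p = foldr L (rho g z) w].

Lemma sorted_monomial_le m m' p : (m <= m')%N ->
  span_of (sorted_monomial m) p -> span_of (sorted_monomial m') p.
Proof.
move=> mm; apply: (@span_of_map _ _ _ id) => // _ [w [g [ws wm ->]]].
by apply: span_gen; exists w, g; split=> //; exact: leq_trans mm.
Qed.

Lemma rho_word g w p : rho g (foldr L p w) = word_char chi w g *: foldr L (rho g p) w.
Proof.
elim: w => [|i w IH] /=; first by rewrite /word_char big_nil scale1r.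
by rewrite rhoL IH (linfZ (L_linear i)) scalerA /word_char big_cons.
Qed.

Lemma rho_sorted m g p : span_of (sorted_monomial m) p ->
  span_of (sorted_monomial m) (rho g p).
Proof.
apply: span_of_map => // _ [w [h [ws wm ->]]]; rewrite rho_word rhoM.
by apply: span_ofZ; apply: span_gen; exists w, (g * h)%g.
Qed.

(** Outer induction on the length, inner on the letter i. When l < i, the exchange term applies v_l,
    a smaller letter, to v_i w, which is already straightened by the outer hypothesis; the bracket
    terms have lost a letter. *)
Lemma L_sorted m i p : span_of (sorted_monomial m) p ->
  span_of (sorted_monomial m.+1) (L i p).
Proof.
elim: m i p => [|m IHm] i p.
  apply: span_of_map => // y [w [g [_]]]; rewrite leqn0 => /nilP-> ->.
  by apply: span_gen; exists [:: i], g.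
have [k] := ubnP (val i); elim: k i p => [//|k IHk] i p ik.
apply: span_of_map => // _ [w [g [ws wm ->]]].
case: w ws wm => [|l w] /= ws wm.
  by apply: span_gen; exists [:: i], g.
have [il|li] := leqP i l.
  by apply: span_gen; exists [:: i, l & w], g; split=> //; rewrite ord_sorted_cons2 il.
have sw : span_of (sorted_monomial m) (foldr L (rho g z) w).
  by apply: span_gen; exists w, g; split=> //; exact: ord_sorted_behead ws.
rewrite LL; apply: span_ofD.
  by apply/span_ofZ/IHk; [exact: leq_trans li _|exact: IHm].
apply: span_of_sum => r; apply: span_of_sum => h; apply: span_ofZ.
by apply: sorted_monomial_le (IHm r _ (rho_sorted h sw)).
Qed.

Lemma L_sorted_span i p : span_of (fun p => exists m, sorted_monomial m p) p ->
  span_of (fun p => exists m, sorted_monomial m p) (L i p).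
Proof.
apply: span_of_map => // y [m my].
apply: (@span_of_map _ _ _ id _ _ _ _ _ (L_sorted i (span_gen my))) => // x xm.
by apply: span_gen; exists m.+1.
Qed.

Lemma rho_sorted_span g p : span_of (fun p => exists m, sorted_monomial m p) p ->
  span_of (fun p => exists m, sorted_monomial m p) (rho g p).
Proof.
apply: span_of_map => // y [m my].
apply: (@span_of_map _ _ _ id _ _ _ _ _ (rho_sorted g (span_gen my))) => // x xm.
by apply: span_gen; exists m.
Qed.

End NormalOrderedSpan.

(** * Sorted words and exponent vectors *)

Section SortedWords.
Variable n : nat.

Definition exp_word (s : seq 'I_n) (m : 'I_n -> nat) : seq 'I_n :=
  flatten [seq nseq (m i) i | i <- s].

Lemma eq_exp_word s (m m' : 'I_n -> nat) : m =1 m' -> exp_word s m = exp_word s m'.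
Proof. by move=> mm; congr flatten; apply: eq_map => i; rewrite mm. Qed.

Lemma count_exp_word m i : count_mem i (exp_word (index_enum 'I_n) m) = m i.
Proof.
rewrite count_flatten -map_comp sumnE big_map (bigD1 i) //= big1 => [|j ji].
  by rewrite count_nseq /= eqxx mul1n addn0.
by rewrite count_nseq /= (negbTE ji).
Qed.

(** In the [pairwise] form of sortedness, concatenation splits the claim into constant blocks and
    pairs of letters from different blocks; the latter are ordered as in the enumeration of
    ['I_n]. *)
Lemma ord_sorted_exp_word m : ord_sorted (exp_word (index_enum 'I_n) m).
Proof.
have: sorted ltn (map val (index_enum 'I_n)).
  by rewrite /index_enum -enumT val_enum_ord; exact: iota_ltn_sorted.
rewrite /ord_sorted !sorted_pairwise; [|exact: leq_trans|exact: ltn_trans].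
elim: (index_enum _) => [//|i s IH] /= /andP[is_ /IH {}IH].
rewrite /exp_word /= map_cat pairwise_cat IH andbT.
apply/andP; split; last first.
  elim: (m i) => [//|k IHk] /=; rewrite IHk andbT all_map; apply/allP => j.
  by rewrite mem_nseq => /andP[_ /eqP->] /=.
apply/allrelP => _ _ /mapP[a + ->] /mapP[d + ->].
rewrite mem_nseq => /andP[_ /eqP->] /flattenP[_ /mapP[j js ->]].
rewrite mem_nseq => /andP[_ /eqP->].
by apply: ltnW; move/allP: is_; apply; exact: map_f.
Qed.

(** Both words are sorted and contain each letter equally often. *)
Lemma exp_wordK w : ord_sorted w ->
  exp_word (index_enum 'I_n) (fun i => count_mem i w) = w.
Proof.
move=> ws; apply: (inj_map val_inj); apply: (sorted_eq leq_trans anti_leq) => //.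
  exact: ord_sorted_exp_word.
apply: perm_map; rewrite /perm_eq.
by apply/allP => i _; rewrite /= count_exp_word.
Qed.

Lemma exp_word_inj (m m' : 'I_n -> nat) :
  exp_word (index_enum 'I_n) m = exp_word (index_enum 'I_n) m' -> m =1 m'.
Proof. by move=> mm i; rewrite -count_exp_word mm count_exp_word. Qed.

End SortedWords.

Section AlgebraModuleWords.
Variables (K : fieldType) (A : algType K) (M : lmodType K) (act : A -> M -> M).
Hypothesis actM : forall x y p, act (x * y) p = act x (act y p).
Hypothesis act1 : forall p, act 1 p = p.
Variables (n : nat) (x : 'I_n -> A).

Lemma act_exp_word s m y p : act ((\prod_(i <- s) x i ^+ m i) * y) p =
  foldr (fun i => act (x i)) (act y p) (exp_word s m).
Proof.
elim: s => [|i s IH]; first by rewrite big_nil mul1r.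
rewrite big_cons -mulrA actM IH /exp_word /= foldr_cat -/(exp_word s m).
elim: (m i) => [|k IHk] /=; first by rewrite expr0 act1.
by rewrite exprS actM IHk.
Qed.

End AlgebraModuleWords.

(** * Left multiplication on quotient algebras *)

(** The same basis vector may occur several times in a derivation of [span_of]; the free module
    collects its coefficients, which leaves one coefficient per index. *)
Lemma span_malg_lin (K : fieldType) (I : choiceType) (U : lmodType K) (e : I -> U) x :
  span_of (fun y => exists i, y = e i) x ->
  exists p : {malg K[I]}, x = malg_lin e p.
Proof.
elim=> [_ [i ->]|| a _ _ _ [p ->] _ [p' ->]].
- by exists << i >>; rewrite malg_linU.
- by exists 0; rewrite (linf0 (@malg_lin_linear _ _ _ e)).
- by exists (a *: p + p'); rewrite malg_lin_linear.
Qed.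

Section QuotientAction.
Variables (K : fieldType) (A : algType K) (S : A -> Prop).

Definition lmul_act (x : A) (p : quotalg S) : quotalg S := api S x * p.

Lemma lmul_act_linearl p : linear (lmul_act^~ p).
Proof.
by move=> a x y; rewrite /lmul_act api_linear mulrDl quotalg_scaleAl.
Qed.
Lemma lmul_act_linearr x : linear (lmul_act x).
Proof. by move=> a p r; rewrite /lmul_act mulrDr quotalg_scaleAr. Qed.
Lemma lmul_actM x y p : lmul_act (x * y) p = lmul_act x (lmul_act y p).
Proof. by rewrite /lmul_act apiM mulrA. Qed.
Lemma lmul_act1 p : lmul_act 1 p = p.
Proof. by rewrite /lmul_act [api S 1]/(1 : quotalg S) mul1r. Qed.
Lemma lmul_act_api x y : lmul_act x (api S y) = api S (x * y).
Proof. by rewrite apiM. Qed.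

Lemma lmul_act_commutator x y a z p : ideal_of S (x * y - a *: (y * x) - z) ->
  lmul_act x (lmul_act y p) = a *: lmul_act y (lmul_act x p) + lmul_act z p.
Proof.
rewrite -addrA -opprD => /apiP E.
rewrite -!lmul_actM -(linfZ (lmul_act_linearl p)) -(linfD (lmul_act_linearl p)).
by rewrite /lmul_act E.
Qed.

End QuotientAction.

Section SkewTensorAlgebra.
Variables (K : fieldType) (gT : finGroupType) (n : nat).
Variable rG : mx_representation K [set: gT]%G n.
Local Notation V := 'cV[K]_n.

Lemma TV_act_one g : TV_act rG g 1 = 1.
Proof. exact: (gact_one (TV_action rG) g). Qed.

Definition tvg (x : TV K n) (g : gT) : skewTV rG := sgen (TV_action rG) x g.

Lemma tvgM x y g h : tvg x g * tvg y h = tvg (x * TV_act rG g y) (g * h)%g.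
Proof. exact: sgenM. Qed.

Lemma tvg_linear g : linear (fun x => tvg x g).
Proof.
move=> a x y; apply/ffunP => h; rewrite /tvg !ffunE; case: ifP => // _.
by rewrite scaler0 addr0.
Qed.

Lemma skew_v_linear : linear (skew_v rG).
Proof.
apply: (linear_comp (f := fun x => tvg x 1%g) (g := @tv K n)).
  exact: tvg_linear.
exact: tv_linear.
Qed.

Lemma skew_gM g h : skew_g rG g * skew_g rG h = skew_g rG (g * h)%g.
Proof.
apply: etrans (tvgM _ _ _ _) _.
by rewrite TV_act_one mulr1.
Qed.
Lemma skew_g1 : skew_g rG 1%g = 1. Proof. by []. Qed.

Lemma skew_gv g x : skew_g rG g * skew_v rG x = skew_v rG (rG g *m x) * skew_g rG g.
Proof.
apply: etrans (tvgM _ _ _ _) _; apply: esym; apply: etrans (tvgM _ _ _ _) _.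
rewrite TV_act_one mulr1 mul1r mul1g mulg1.
by apply: (congr1 (fun y => tvg y g)); apply: esym; exact: TV_act_v.
Qed.

Lemma tvgE x g : tvg x g = tvg x 1%g * skew_g rG g.
Proof.
apply: esym; apply: etrans (tvgM _ _ _ _) _.
by rewrite TV_act_one mulr1 mul1g.
Qed.

Lemma skew_decomp (x : skewTV rG) :
  x = \sum_g tvg (x g) 1%g * skew_g rG g.
Proof.
apply/ffunP => h; rewrite sum_ffunE (bigD1 h) //= -tvgE ffunE eqxx.
rewrite big1 ?addr0 // => g /negbTE gh.
by rewrite -tvgE ffunE eq_sym gh.
Qed.

Lemma skew_VG_linear : linear (@skew_VG K gT n rG).
Proof.
move=> a x y; apply/ffunP => g.
have E u : skew_VG rG u g = tv (u g) by exact: ffunE.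
have -> : (a *: skew_VG rG x + skew_VG rG y) g = a *: tv (x g) + tv (y g).
  rewrite -(E x) -(E y).
  transitivity ((a *: skew_VG rG x) g + skew_VG rG y g); first exact: ffunE.
  by apply: (congr1 (fun z => z + _)); exact: ffunE.
apply: etrans (E _) _; rewrite -tv_linear; apply: (congr1 (@tv K n)).
by rewrite !ffunE.
Qed.

Lemma skew_VG_vg x g : skew_VG rG (vg x g) = skew_v rG x * skew_g rG g.
Proof.
transitivity (tvg (tv x) g); last exact: tvgE.
apply/ffunP => h.
have -> : skew_VG rG (vg x g) h = tv (vg x g h) by exact: ffunE.
rewrite /tvg /sgen ffunE.
rewrite /vg ffunE.
case: (h == g) => [//|]; exact: linf0 (@tv_linear K n).
Qed.

Lemma tvg1M x y : tvg (x * y) 1%g =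
  tvg x 1%g * tvg y 1%g.
Proof.
apply: esym; apply: etrans (tvgM _ _ _ _) _.
by rewrite TV_act1 mulg1.
Qed.

Lemma tvg1_scalar a : tvg (@tinjR K K^o (vect_bimodule V) a) 1%g = a *: 1.
Proof.
apply: etrans (linfZ (tvg_linear 1%g) a 1).
apply: (congr1 (fun y => tvg y 1%g)).
apply: etrans (linfZ (@tinjR_linear K K^o (vect_bimodule V)) a 1).
by congr (tinjR _ _); rewrite -[LHS]mulr1.
Qed.

Section Action.
Variables (M : lmodType K) (act : skewTV rG -> M -> M).
Hypotheses (act_linearl : forall p, linear (act^~ p)).
Hypothesis actM : forall x y p, act (x * y) p = act x (act y p).
Hypothesis act1 : forall p, act 1 p = p.
Variable S : M -> Prop.
Hypothesis act_v : forall x p, span_of S p -> span_of S (act (skew_v rG x) p).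
Hypothesis act_g : forall g p, span_of S p -> span_of S (act (skew_g rG g) p).

Lemma skew_act_span x p : span_of S p -> span_of S (act x p).
Proof.
move=> Sp; rewrite [x]skew_decomp (linf_sum (act_linearl p)).
apply: span_of_sum => g; rewrite actM; move: (x g) (act_g g Sp) => {x} x.
move: (act _ p) => {Sp}p Sp.
(* Induction on tensors, phrased as the vanishing of a linear map modulo the span *)
have lf : linear (fun y => qpi S (act (tvg y 1%g) p)).
  apply: linear_comp; first exact: qpi_linear.
  by apply: (linear_comp (f := act^~ p)); [exact: act_linearl|exact: tvg_linear].
have l0 : linear (fun _ : TV K n => 0 : quotmod S).
  by move=> a y z; rewrite scaler0 addr0.
have H := @talg_extM _ _ _ _ _ _ lf l0.
rewrite -[act _ _]subr0; apply/qpiP; rewrite (linf0 (qpi_linear S)).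
apply: H => [a|l t] /=.
  by rewrite tvg1_scalar (linfZ (act_linearl p)) act1; apply: qpi_eq0; exact: span_ofZ.
rewrite -(linf0 (qpi_linear S)) => /qpiP; rewrite subr0 => St.
apply/qpiP; rewrite subr0 tvg1M actM.
exact: (act_v l).
Qed.
End Action.

End SkewTensorAlgebra.

Lemma span_family (K : fieldType) (I : choiceType) (U : lmodType K) (e : I -> U) x :
  span_of (fun y => exists i, y = e i) x ->
  exists (s : seq I) (c : I -> K), x = \sum_(i <- s) c i *: e i.
Proof. by case/span_malg_lin => p ->; exists (msupp p), (mcoeff^~ p). Qed.

Lemma foldr_word (T I : Type) (L L' : I -> T -> T) (z : T) s :
  (forall i p, L i p = L' i p) -> foldr L z s = foldr L' z s.
Proof. by move=> LL; elim: s => //= i s ->. Qed.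

(** * PBW monomials: spanning, and independence from a faithful enough module *)

Section PBWTheorem.
Variables (K : fieldType) (gT : finGroupType) (n : nat).
Variable rG : mx_representation K [set: gT]%G n.
Local Notation V := 'cV[K]_n.
Variables (b : n.-tuple V) (chi : 'I_n -> gT -> K).
Variables (q : 'I_n -> 'I_n -> K) (kappa : V -> V -> VG K gT n).
Local Notation v := (tnth b).
Local Notation S := (@qdoa_rel K gT n rG b q kappa).
Local Notation c i j r g := (coord b r (kappa (v i) (v j) g)).
Hypothesis basis_b : basis_of fullv b.
Hypothesis chiE : forall g i, rG g *m v i = chi i g *: v i.

Lemma VG_decomp (x : VG K gT n) :
  x = \sum_r \sum_g coord b r (x g) *: vg (v r) g.
Proof.
apply/ffunP => h; rewrite exchange_big sum_ffunE (bigD1 h) //= sum_ffunE.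
rewrite [X in _ + X]big1 ?addr0 => [|g gh].
  by rewrite {1}(basis_coord basis_b (x h)); apply: eq_bigr => r _; rewrite !ffunE eqxx.
by rewrite sum_ffunE big1 // => r _; rewrite !ffunE eq_sym (negbTE gh) scaler0.
Qed.

Lemma skew_VG_decomp x : skew_VG rG x =
  \sum_r \sum_g coord b r (x g) *: (skew_v rG (v r) * skew_g rG g).
Proof.
rewrite {1}[x]VG_decomp (linf_sum (@skew_VG_linear _ _ _ rG)).
apply: eq_bigr => r _; rewrite (linf_sum (@skew_VG_linear _ _ _ rG)).
apply: eq_bigr => g _; rewrite (linfZ (@skew_VG_linear _ _ _ rG)).
by rewrite skew_VG_vg.
Qed.

Definition qv (i : 'I_n) : qdoa rG b q kappa -> qdoa rG b q kappa :=
  lmul_act (skew_v rG (v i)).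
Definition qg (g : gT) : qdoa rG b q kappa -> qdoa rG b q kappa :=
  lmul_act (skew_g rG g).

Lemma qgM g h p : qg g (qg h p) = qg (g * h)%g p.
Proof. by rewrite /qg -lmul_actM skew_gM. Qed.

Lemma qg_qv g i p : qg g (qv i p) = chi i g *: qv i (qg g p).
Proof.
rewrite /qg /qv -!lmul_actM skew_gv chiE (linfZ (@skew_v_linear _ _ _ rG)).
by rewrite -(linfZ (lmul_act_linearl _)) scalerAl.
Qed.

Lemma qv_qv i j p : qv i (qv j p) = q i j *: qv j (qv i p)
  + \sum_r \sum_g c i j r g *: qv r (qg g p).
Proof.
have -> : \sum_r \sum_g c i j r g *: qv r (qg g p) =
    lmul_act (skew_VG rG (kappa (v i) (v j))) p :> qdoa rG b q kappa.
  rewrite skew_VG_decomp (linf_sum (lmul_act_linearl p)); apply: eq_bigr => r _.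
  rewrite (linf_sum (lmul_act_linearl p)); apply: eq_bigr => g _.
  by rewrite (linfZ (lmul_act_linearl p)) lmul_actM.
by apply: lmul_act_commutator; apply: ideal_gen; constructor.
Qed.

Lemma PBW_monomialE mg : PBW_monomial rG b q kappa mg =
  foldr qv (qg mg.2 (api S 1)) (exp_word (index_enum 'I_n) mg.1).
Proof.
have := act_exp_word (@lmul_actM _ _ S) (@lmul_act1 _ _ S)
  (fun i => skew_v rG (v i)) (index_enum 'I_n) mg.1 (skew_g rG mg.2) (api S 1).
by rewrite lmul_act_api mulr1.
Qed.

(** The span of the sorted monomials contains 1 and is stable under left multiplication by V and G,
    which generate the algebra; so it is everything. *)
Lemma PBW_spanning (x : qdoa rG b q kappa) :
  span_of (fun y => exists mg, y = PBW_monomial rG b q kappa mg) x.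
Proof.
pose T := sorted_monomial qv qg (api S 1).
have T1 : span_of (fun p => exists m, T m p) (api S 1).
  apply: span_gen; exists 0, [::], 1%g; split=> //=.
  by rewrite /qg skew_g1 lmul_act1.
have Tx : span_of (fun p => exists m, T m p) x.
  rewrite -[x]api_repr -[qrepr x]mulr1 -lmul_act_api.
  apply: skew_act_span T1 => [p|y z p|p|y p Tp|g p Tp].
  - exact: lmul_act_linearl.
  - exact: lmul_actM.
  - exact: lmul_act1.
  - rewrite (basis_coord basis_b y) (linf_sum (@skew_v_linear _ _ _ rG)).
    rewrite (linf_sum (lmul_act_linearl p)); apply: span_of_sum => i.
    rewrite (linfZ (@skew_v_linear _ _ _ rG)) (linfZ (lmul_act_linearl p)).
    apply: span_ofZ; apply: (L_sorted_span (L := qv) (rho := qg)) => //.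
    + by move=> j; exact: lmul_act_linearr.
    + by move=> g; exact: lmul_act_linearr.
    + exact: qgM.
    + exact: qg_qv.
    + exact: qv_qv.
  - apply: (rho_sorted_span (L := qv) (rho := qg)) => //.
    + by move=> j; exact: lmul_act_linearr.
    + by move=> h; exact: lmul_act_linearr.
    + exact: qgM.
    + exact: qg_qv.
apply: (@span_of_map _ _ _ id) Tx => // y [m [w [g [ws _ ->]]]].
apply: span_gen; exists ([ffun i => count_mem i w], g).
rewrite PBW_monomialE /= -[in LHS](exp_wordK ws); congr foldr.
by apply: eq_exp_word => i; rewrite ffunE.
Qed.

Section Independence.
Variables (M : lmodType K) (L : 'I_n -> M -> M) (rho : gT -> M -> M).
Variable e : seq 'I_n * gT -> M.
Hypotheses (L_linear : forall i, linear (L i)).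
Hypotheses (rho_linear : forall g, linear (rho g)).
Hypothesis rho1 : forall p, rho 1%g p = p.
Hypothesis rhoM : forall g h p, rho g (rho h p) = rho (g * h)%g p.
Hypothesis rhoL : forall g i p, rho g (L i p) = chi i g *: L i (rho g p).
Hypothesis LL : forall i j p, L i (L j p) = q i j *: L j (L i p)
  + \sum_r \sum_g c i j r g *: L r (rho g p).
Hypothesis L_cons : forall i w h, ord_sorted (i :: w) -> L i (e (w, h)) = e (i :: w, h).
Hypothesis rho_nil : forall g h, rho g (e ([::], h)) = e ([::], (g * h)%g).
Variable co : seq 'I_n * gT -> M -> K^o.
Hypothesis co_linear : forall x, linear (co x).
Hypothesis coE : forall x y, co x (e y) = (x == y)%:R.

Lemma L_word w g : ord_sorted w -> foldr L (e ([::], g)) w = e (w, g).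
Proof.
elim: w => [//|i w IH] /= ws; rewrite IH ?L_cons //.
exact: ord_sorted_behead ws.
Qed.

Lemma PBW_monomial_free (s : seq ({ffun 'I_n -> nat} * gT))
    (a : {ffun 'I_n -> nat} * gT -> K) :
  uniq s -> \sum_(i <- s) a i *: PBW_monomial rG b q kappa i = 0 ->
  {in s, forall i, a i = 0}.
Proof.
pose mono (mg : {ffun 'I_n -> nat} * gT) : skewTV rG :=
  (\prod_(i < n) skew_v rG (v i) ^+ mg.1 i) * skew_g rG mg.2.
pose act := skew_op (rG := rG) b rho L_linear.
have act_lin p : linear (act^~ p) by exact: skew_op_linearl.
have actM x y p : act (x * y) p = act x (act y p).
  exact: (skew_opM basis_b chiE).
have act1 p : act 1 p = p.
  by apply: etrans (rho1 p); exact: skew_op_g.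
pose wd (mg : {ffun 'I_n -> nat} * gT) := (exp_word (index_enum 'I_n) mg.1, mg.2).
have wd_inj : injective wd.
  move=> [m g] [m' g'] [mm ->]; congr (_, _); apply/ffunP.
  exact: exp_word_inj.
have actE mg : act (mono mg) (e ([::], 1%g)) = e (wd mg).
  apply: etrans (act_exp_word actM act1 _ _ _ _ _) _.
  rewrite -(L_word mg.2 (ord_sorted_exp_word mg.1)).
  have -> : act (skew_g rG mg.2) (e ([::], 1%g)) = e ([::], mg.2).
    apply: etrans (skew_op_g _ _ _ _ _ _) _.
    by rewrite rho_nil mulg1.
  apply: foldr_word => i p.
  by apply: skew_op_v.
move=> us a0.
(* A linear dependence lifts to an element of the ideal of relations, and this ideal annihilates the
   module [M]. *)
have Iz : ideal_of S (\sum_(i <- s) a i *: mono i).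
  rewrite -[\sum_(i <- s) _]subr0; apply/apiP; rewrite (linf0 (api_linear S)) -a0.
  rewrite (linf_sum (api_linear S)); apply: eq_bigr => i _.
  by rewrite (linfZ (api_linear S)).
have := skew_op_ideal basis_b chiE L_linear rho_linear rho1 rhoM rhoL LL (e ([::], 1%g)) Iz.
rewrite -/act (linf_sum (act_lin _)) => E.
move=> j js; have := congr1 (co (wd j)) E.
rewrite (linf0 (co_linear _)) (linf_sum (co_linear _)) (bigD1_seq j) //= big1 => [|i ij].
  rewrite (linfZ (act_lin _)) (linfZ (co_linear _)) actE coE eqxx addr0.
  by rewrite -[_ *: _]/(_ * _) mulr1.
rewrite (linfZ (act_lin _)) (linfZ (co_linear _)) actE coE.
by rewrite (inj_eq wd_inj) eq_sym (negbTE ij) scaler0.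
Qed.

End Independence.
End PBWTheorem.

(** * The PBW property from the Jacobi identity *)

Section DiamondLemma.
Variables (K : fieldType) (gT : finGroupType) (n : nat).
Variable rG : mx_representation K [set: gT]%G n.
Local Notation V := 'cV[K]_n.
Variables (b : n.-tuple V) (chi : 'I_n -> gT -> K).
Variables (q : 'I_n -> 'I_n -> K) (kappa : V -> V -> VG K gT n).
Local Notation v := (tnth b).
Local Notation c i j r g := (coord b r (kappa (v i) (v j) g)).
Hypothesis basis_b : basis_of fullv b.
Hypothesis chiE : forall g i, rG g *m v i = chi i g *: v i.
Hypothesis two_neq0 : (2%:R : K) != 0.
Hypothesis abelG : forall g h : gT, (g * h = h * g)%g.
Hypothesis q_sys : quantum_system q.
Hypothesis kappa_antisym : forall i j,
  kappa (v i) (v j) = - q i j *: kappa (v j) (v i).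
Hypothesis c_vanish : forall i j k r g, c i j r g != 0 ->
  chi k g = q i k * q j k * q k r.
Hypothesis c_inv : forall i j r g h, c i j r g != 0 ->
  chi i h * chi j h = chi r h.
Hypothesis c_jacobi : forall i j l s k,
  \sum_r \sum_g (c j l r g * c i r s (k * g^-1)%g
    - q i j * (c i l r g * c j r s (k * g^-1)%g)
    + q j l * q i l * (c i j r g * c l r s (k * g^-1)%g)) = 0.

(** Since q_ii = 1, antisymmetry reads 2 kappa (v_i, v_i) = 0. This makes the relation of v_i with
    itself trivial, as the normal ordering needs. *)
Lemma kappa_diag i : kappa (v i) (v i) = 0.
Proof.
have [_ qii _] := q_sys; have /eqP := kappa_antisym i i.
rewrite qii scaleN1r -subr_eq0 opprK -mulr2n -scaler_nat scaler_eq0.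
by rewrite (negbTE two_neq0) => /eqP.
Qed.

Lemma PBW_of_jacobi : PBW_property rG b q kappa.
Proof.
have [q_neq0 qii qV] := q_sys.
split=> [x|]; first by apply: span_family; exact: PBW_spanning basis_b chiE x.
pose M : lmodType K := {malg K[(seq 'I_n * gT)%type]}.
pose e (x : seq 'I_n * gT) : M := << x >>.
pose lin (f : seq 'I_n * gT -> M) : M -> M := malg_lin f.
have lin_linear f : linear (lin f) by exact: malg_lin_linear.
have linE f x : lin f (e x) = f x by exact: malg_linU.
have extM (f f' : M -> M) : linear f -> linear f' ->
    (forall x, f (e x) = f' (e x)) -> f =1 f'.
  exact: malg_ext.
have [co [co_linear coE]] : exists co : seq 'I_n * gT -> M -> K^o,
    (forall x, linear (co x)) /\ (forall x y, co x (e y) = (x == y)%:R).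
  exists (fun x p => mcoeff x p); split=> [x a p p'|x y].
    by rewrite mcoeffD mcoeffZ.
  by rewrite mcoeffU eq_sym.
(* The concrete free module is forgotten: what follows uses only the linear extension [lin], the
   extensionality [extM] and the coordinate functions [co]. *)
move: M e lin lin_linear linE extM co co_linear coE => M e lin lin_linear linE extM co co_linear coE.
pose L := vop q chi (fun i j r g => c i j r g) e lin.
pose rho := gop chi e lin.
have chiM i g h : chi i (g * h)%g = chi i g * chi i h.
  exact: (diag_charM basis_b chiE).
have canti i j r g : c i j r g = - q i j * c j i r g.
  by rewrite kappa_antisym ffunE linearZ.
have cdiag i r g : c i i r g = 0 by rewrite kappa_diag ffunE linear0.
apply: (@PBW_monomial_free _ _ _ _ _ _ _ _ basis_b chiE M L rho e) => //.
- by move=> i; exact: vop_linear.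
- by move=> g; exact: gop_linear.
- apply: extM => // [|[w g]]; first exact: gop_linear.
  rewrite /rho gopU // mul1g [word_char _ _ _]big1 ?scale1r // => i _.
  exact: (diag_char1 basis_b chiE).
- by move=> g h p; exact: gopM.
- by move=> g i p; apply: gop_vop.
- by move=> i j p; apply: vop_vop.
- by move=> i w h; apply: vop_cons.
- by move=> g h; rewrite /rho gopU // [word_char _ _ _]big_nil scale1r.
Qed.

End DiamondLemma.

(** * The isomorphism of T_KG(V (x) KG) with T(V) x| G *)

Section EnvelopingToSkew.
Variables (K : fieldType) (gT : finGroupType) (n : nat).
Variable rG : mx_representation K [set: gT]%G n.
Local Notation V := 'cV[K]_n.
Local Notation L := (VG_bimodule rG).
Local Notation T := (talg L).
Local Notation R := (grpalg K gT).

Lemma grpalg_decomp (r : R) : r = \sum_g (r g : K) *: gelt K g.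
Proof.
apply/ffunP => h; rewrite sum_ffunE (bigD1 h) //= big1 => [|g /negbTE gh].
  by rewrite ffunE /gelt /sgen ffunE eqxx addr0 /GRing.scale /= mulr1.
by rewrite ffunE /gelt /sgen ffunE eq_sym gh scaler0.
Qed.

Lemma VG_vg_decomp (x : VG K gT n) : x = \sum_g vg (x g) g.
Proof.
apply/ffunP => h; rewrite sum_ffunE (bigD1 h) //= ffunE eqxx.
by rewrite big1 ?addr0 // => g /negbTE gh; rewrite ffunE eq_sym gh.
Qed.

Lemma vg_linear g : linear (fun x => vg x g : VG K gT n).
Proof.
move=> a x y; apply/ffunP => h; rewrite !ffunE; case: ifP => // _.
by rewrite scaler0 addr0.
Qed.

Lemma grpalg_eq (U : lmodType K) (f f' : R -> U) : linear f -> linear f' ->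
  (forall g, f (gelt K g) = f' (gelt K g)) -> f =1 f'.
Proof.
move=> lf lf' ff r; rewrite [r]grpalg_decomp (linf_sum lf) (linf_sum lf').
by apply: eq_bigr => g _; rewrite (linfZ lf) (linfZ lf') ff.
Qed.

Lemma VG_eq (U : lmodType K) (f f' : VG K gT n -> U) : linear f -> linear f' ->
  (forall x g, f (vg x g) = f' (vg x g)) -> f =1 f'.
Proof.
move=> lf lf' ff x; rewrite [x]VG_vg_decomp (linf_sum lf) (linf_sum lf').
by apply: eq_bigr.
Qed.

Lemma skewTV_eq (U : lmodType K) (f f' : skewTV rG -> U) : linear f -> linear f' ->
  (forall x g, f (tvg rG x g) = f' (tvg rG x g)) -> f =1 f'.
Proof.
move=> lf lf' ff x; rewrite [x]skew_decomp (linf_sum lf) (linf_sum lf').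
by apply: eq_bigr => g _; rewrite -tvgE.
Qed.

Lemma mull_linear (B : algType K) (x : B) : linear (fun y => x * y).
Proof. by move=> a y z; rewrite mulrDr scalerAr. Qed.
Lemma mulr_linear (B : algType K) (y : B) : linear (fun x => x * y).
Proof. by move=> a x z; rewrite mulrDl scalerAl. Qed.

Definition skew_grpalg (r : R) : skewTV rG := \sum_g (r g : K) *: skew_g rG g.

Lemma skew_grpalg_linear : linear skew_grpalg.
Proof.
apply: linear_of_sum => g a r s; rewrite !ffunE scalerDl -scalerA.
by [].
Qed.

Lemma skew_grpalg_gelt g : skew_grpalg (gelt K g) = skew_g rG g.
Proof.
rewrite /skew_grpalg (bigD1 g) //= big1 ?addr0 => [|h hg].
  by rewrite /gelt /sgen ffunE eqxx scale1r.
by rewrite /gelt /sgen ffunE (negbTE hg) scale0r.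
Qed.

Lemma skew_grpalg1 : skew_grpalg 1 = 1.
Proof. exact: (skew_grpalg_gelt 1%g). Qed.

Lemma skew_grpalgM r s : skew_grpalg (r * s) = skew_grpalg r * skew_grpalg s.
Proof.
move: r; apply: grpalg_eq => [||g].
- apply: linear_comp; [exact: skew_grpalg_linear|exact: mulr_linear].
- apply: (linear_comp (f := fun x => x * skew_grpalg s)); first exact: mulr_linear.
  exact: skew_grpalg_linear.
move: s; apply: grpalg_eq => [||h].
- apply: linear_comp; [exact: skew_grpalg_linear|exact: mull_linear].
- apply: linear_comp; [exact: mull_linear|exact: skew_grpalg_linear].
by rewrite geltM !skew_grpalg_gelt skew_gM.
Qed.

Lemma skew_VG_lact r x : skew_VG rG (lact r (x : L)) = skew_grpalg r * skew_VG rG x.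
Proof.
move: r; apply: grpalg_eq => [||g].
- apply: (linear_comp (f := @skew_VG _ _ _ rG) (g := fun r => lact r (x : L))).
    exact: skew_VG_linear.
  exact: (lact_bilin L).1.
- apply: (linear_comp (f := fun y => y * skew_VG rG x)); first exact: mulr_linear.
  exact: skew_grpalg_linear.
move: x; apply: VG_eq => [||x h].
- apply: (linear_comp (f := @skew_VG _ _ _ rG) (g := @lact _ _ L (gelt K g))).
    exact: skew_VG_linear.
  exact: (lact_bilin L).2.
- apply: linear_comp; [exact: mull_linear|exact: skew_VG_linear].
apply: etrans (congr1 _ (VG_lact_gen rG g x h)) _.
rewrite !skew_VG_vg skew_grpalg_gelt mulrA skew_gv -mulrA skew_gM.
by [].
Qed.

Lemma skew_VG_ract x r : skew_VG rG (Defs.ract (x : L) r) = skew_VG rG x * skew_grpalg r.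
Proof.
move: r; apply: grpalg_eq => [||g].
- apply: (linear_comp (f := @skew_VG _ _ _ rG) (g := fun r => Defs.ract (x : L) r)).
    exact: skew_VG_linear.
  exact: (ract_bilin L).2.
- apply: linear_comp; [exact: mull_linear|exact: skew_grpalg_linear].
move: x; apply: VG_eq => [||x h].
- apply: (linear_comp (f := @skew_VG _ _ _ rG) (g := fun x => @Defs.ract _ _ L x (gelt K g))).
    exact: skew_VG_linear.
  exact: (ract_bilin L).1.
- apply: (linear_comp (f := fun y => y * skew_grpalg (gelt K g))).
    exact: mulr_linear.
  exact: skew_VG_linear.
apply: etrans (congr1 _ (VG_ract_gen g x h)) _.
rewrite !skew_VG_vg skew_grpalg_gelt -mulrA skew_gM.
by [].
Qed.

Definition to_skew_morph : tmorph L (skewTV rG) :=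
  @Tmorph K R L (skewTV rG) skew_grpalg (@skew_VG _ _ _ rG)
    skew_grpalg_linear (@skew_VG_linear _ _ _ rG) skew_grpalg1 skew_grpalgM
    skew_VG_lact (fun r x => skew_VG_ract x r).

Definition to_skew : T -> skewTV rG := tlift_alg to_skew_morph.

Lemma to_skew_linear : linear to_skew.
Proof. exact: tlift_alg_linear. Qed.
Lemma to_skew1 : to_skew 1 = 1.
Proof. exact: tlift_alg1. Qed.
Lemma to_skewM x y : to_skew (x * y) = to_skew x * to_skew y.
Proof. exact: tlift_algM. Qed.
Lemma to_skewR r : to_skew (tinjR L r) = skew_grpalg r.
Proof. exact: (tlift_algR to_skew_morph). Qed.
Lemma to_skewL x : to_skew (tinjL (x : L)) = skew_VG rG x.
Proof. exact: (tlift_algL to_skew_morph). Qed.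

Local Notation TVb := (vect_bimodule V).
Definition tensL (u : V) : T := tinjL (vg u 1%g : L).

Lemma tensL_linear : linear tensL.
Proof.
apply: (linear_comp (f := @tinjL _ _ L) (g := fun u => vg u 1%g : L)).
  exact: tinjL_linear.
exact: vg_linear.
Qed.

Lemma scalar_linear : linear (fun a : K^o => (a : K) *: (1 : T)).
Proof. by move=> a x y; rewrite scalerDl scalerA. Qed.

Lemma scalarM (a c : K^o) : (a * c : K) *: (1 : T) = ((a : K) *: 1) * ((c : K) *: 1).
Proof. by rewrite -scalerAl mul1r scalerA. Qed.
Lemma tensL_l (a : K^o) (u : V) : tensL ((a : K) *: u) = ((a : K) *: 1) * tensL u.
Proof. by rewrite (linfZ tensL_linear) -scalerAl mul1r. Qed.
Lemma tensL_r (a : K^o) (u : V) : tensL ((a : K) *: u) = tensL u * ((a : K) *: 1).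
Proof. by rewrite (linfZ tensL_linear) -scalerAr mulr1. Qed.

Definition of_TV_morph : tmorph TVb T :=
  @Tmorph K K^o TVb T (fun a => (a : K) *: 1) tensL scalar_linear tensL_linear
    (scale1r 1) scalarM tensL_l tensL_r.

Definition of_TV : TV K n -> T := tlift_alg of_TV_morph.

Lemma of_TV_linear : linear of_TV.
Proof. exact: tlift_alg_linear. Qed.
Lemma of_TV1 : of_TV 1 = 1.
Proof. exact: tlift_alg1. Qed.
Lemma of_TVM x y : of_TV (x * y) = of_TV x * of_TV y.
Proof. exact: tlift_algM. Qed.
Lemma of_TVR a : of_TV (tinjR TVb a) = (a : K) *: 1.
Proof. exact: (tlift_algR of_TV_morph). Qed.
Lemma of_TVL u : of_TV (tv u) = tensL u.
Proof. exact: (tlift_algL of_TV_morph). Qed.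

End EnvelopingToSkew.

Section SkewToEnveloping.
Variables (K : fieldType) (gT : finGroupType) (n : nat).
Variable rG : mx_representation K [set: gT]%G n.
Local Notation V := 'cV[K]_n.
Local Notation L := (VG_bimodule rG).
Local Notation T := (talg L).
Local Notation TVb := (vect_bimodule V).
Local Notation of_TV := (@of_TV K gT n rG).
Local Notation tensL := (@tensL K gT n rG).
Local Notation Rg g := (tinjR L (gelt K g)).

Lemma tens_gM g h : Rg g * Rg h = Rg (g * h)%g.
Proof. by rewrite -geltM tinjRM. Qed.

Lemma tensL_g u g : tensL u * Rg g = tinjL (vg u g : L).
Proof.
apply: etrans (esym (tinjLr _ _)) _; apply: (congr1 (@tinjL _ _ L)).
by apply: etrans (VG_ract_gen g u 1%g) _; rewrite mul1g.
Qed.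

Lemma g_tensL u g : Rg g * tensL u = tinjL (vg (rG g *m u) g : L).
Proof.
apply: etrans (esym (tinjRl _ _)) _; apply: (congr1 (@tinjL _ _ L)).
by apply: etrans (VG_lact_gen rG g u 1%g) _; rewrite mulg1.
Qed.

Lemma mul_exchange (B : pzRingType) (s s' r a a' : B) :
  s * r = r * s' -> a * r = r * a' -> (a * s) * r = r * (a' * s').
Proof. by move=> sr ar; rewrite -mulrA sr !mulrA ar. Qed.

(** The defining relation of the skew group algebra, inside the tensor algebra over KG. On V it
    holds because (u (x) 1) g = u (x) g and g (u (x) 1) = gu (x) g; it extends to T(V) by
    multiplicativity. *)
Lemma of_TV_act g x : of_TV (TV_act rG g x) * Rg g = Rg g * of_TV x.
Proof.
move: x; apply: talg_extM => [||a|u t IH].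
- apply: (linear_comp (f := fun y => y * Rg g)
    (g := fun x => of_TV (TV_act rG g x))); first exact: mulr_linear.
  apply: (linear_comp (f := of_TV) (g := TV_act rG g)); first exact: of_TV_linear.
  exact: (gact_linear (TV_action rG) g).
- by apply: linear_comp; [exact: mull_linear|exact: of_TV_linear].
- rewrite [TV_act _ _ _]TV_act_scalar of_TVR -scalerAl mul1r.
  by rewrite -scalerAr mulr1.
have -> : of_TV (TV_act rG g (tinjL u * t)) = tensL (rG g *m u) * of_TV (TV_act rG g t).
  apply: etrans (congr1 of_TV (Defs.gactM (TV_action rG) g _ _)) _.
  apply: etrans (of_TVM _ _ _) _; apply: (congr1 (fun y => y * _)).
  by apply: etrans (congr1 of_TV (TV_act_v rG g u)) _; exact: of_TVL.
have -> : of_TV (tinjL u * t) = tensL u * of_TV t.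
  by apply: etrans (of_TVM _ _ _) _; apply: (congr1 (fun y => y * _)); exact: of_TVL.
move: (etrans (tensL_g (rG g *m u) g) (esym (g_tensL u g))) => E.
by apply: mul_exchange IH E.
Qed.

Definition of_skew (x : skewTV rG) : T := \sum_g of_TV (x g) * Rg g.

Lemma of_skew_linear : linear of_skew.
Proof.
apply: linear_of_sum => g a x y; rewrite !ffunE of_TV_linear mulrDl -scalerAl.
by [].
Qed.

Lemma of_skew_gen x g : of_skew (tvg rG x g) = of_TV x * Rg g.
Proof.
rewrite /of_skew (bigD1 g) //= big1 ?addr0 => [|h hg].
  by rewrite /tvg /sgen ffunE eqxx.
by rewrite /tvg /sgen ffunE (negbTE hg) (linf0 (@of_TV_linear _ _ _ rG)) mul0r.
Qed.

Lemma of_skewM x y : of_skew (x * y) = of_skew x * of_skew y.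
Proof.
move: x; apply: skewTV_eq => [||x g].
- apply: (linear_comp (f := of_skew) (g := fun x => x * y)).
    exact: of_skew_linear.
  exact: mulr_linear.
- apply: (linear_comp (f := fun x => x * of_skew y)); first exact: mulr_linear.
  exact: of_skew_linear.
move: y; apply: skewTV_eq => [||y h].
- apply: (linear_comp (f := of_skew)); [exact: of_skew_linear|exact: mull_linear].
- by apply: linear_comp; [exact: mull_linear|exact: of_skew_linear].
apply: etrans (congr1 of_skew (tvgM rG x y g h)) _.
rewrite !of_skew_gen; apply: etrans (congr1 (fun z => z * _) (of_TVM _ _ _)) _.
move: (of_TV_act g y).
move: (of_TV x) (of_TV y) (of_TV _) => x' y' s E.
by rewrite -tens_gM -mulrA [s * _]mulrA E !mulrA.
Qed.

Lemma of_skew_g g : of_skew (skew_g rG g) = Rg g.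
Proof.
apply: etrans (of_skew_gen 1 g) _.
by apply: etrans (congr1 (fun z => z * _) (of_TV1 _)) _; rewrite mul1r.
Qed.

Lemma of_skew_VG x : of_skew (skew_VG rG x) = tinjL (x : L).
Proof.
move: x; apply: VG_eq => [||x g].
- by apply: linear_comp; [exact: of_skew_linear|exact: skew_VG_linear].
- exact: (@tinjL_linear _ _ L).
have -> : skew_VG rG (vg x g) = tvg rG (tv x) g.
  by apply: etrans (skew_VG_vg rG x g) _; by apply: esym; apply: tvgE.
by rewrite of_skew_gen of_TVL tensL_g.
Qed.

Lemma to_skewK : cancel (@to_skew K gT n rG) of_skew.
Proof.
apply: (talg_extM (f := fun x => of_skew (to_skew x)) (g := fun x => x)).
- by apply: linear_comp; [exact: of_skew_linear|exact: to_skew_linear].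
- by [].
- move=> r; rewrite to_skewR; move: r; apply: grpalg_eq => [||g].
  + by apply: linear_comp; [exact: of_skew_linear|exact: skew_grpalg_linear].
  + exact: tinjR_linear.
  + by rewrite skew_grpalg_gelt of_skew_g.
- move=> l t IH; rewrite to_skewM of_skewM IH to_skewL.
  by apply: (congr1 (fun y => y * t)); exact: of_skew_VG.
Qed.

Lemma to_skew_of_TV x : to_skew (of_TV x) = tvg rG x 1%g.
Proof.
move: x; apply: talg_extM => [||a|u t IH].
- by apply: linear_comp; [exact: to_skew_linear|exact: of_TV_linear].
- exact: tvg_linear.
- by rewrite of_TVR (linfZ (@to_skew_linear _ _ _ rG)) to_skew1 tvg1_scalar.
apply: etrans _ (esym (tvg1M rG _ _)); rewrite -IH.
have -> : of_TV (tinjL u * t) = tensL u * of_TV t.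
  by apply: etrans (of_TVM _ _ _) _; apply: (congr1 (fun y => y * _)); exact: of_TVL.
rewrite to_skewM; apply: (congr1 (fun y => y * _)).
apply: etrans (to_skewL _) _; apply: etrans (skew_VG_vg rG u 1%g) _.
by rewrite skew_g1 mulr1.
Qed.

Lemma of_skewK : cancel of_skew (@to_skew K gT n rG).
Proof.
apply: (skewTV_eq (f := fun x => to_skew (of_skew x)) (f' := fun x => x)) => [||x g].
- by apply: linear_comp; [exact: to_skew_linear|exact: of_skew_linear].
- by [].
rewrite of_skew_gen to_skewM to_skew_of_TV to_skewR skew_grpalg_gelt.
by apply: esym; apply: tvgE.
Qed.

End SkewToEnveloping.

(** * Color brackets and quantum Drinfeld orbifold algebras *)

Lemma linear_sub_scale (K : fieldType) (U W : lmodType K) e (f g h : U -> W) :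
  linear f -> linear g -> linear h -> linear (fun x => f x - e *: g x - h x).
Proof.
move=> lf lg lh a x y; rewrite lf lg lh !scalerDr !opprD !scalerN !scalerA.
by rewrite [e * a]mulrC (AC (2*2*2) ((1*3*5)*(2*4*6)))%AC.
Qed.

Lemma hom_commutator (K : fieldType) (B C : algType K) (f : B -> C) e x y z X Y Z :
  linear f -> (forall x y, f (x * y) = f x * f y) ->
  f x = X -> f y = Y -> f z = Z ->
  f (x * y - e *: (y * x) - z) = X * Y - e *: (Y * X) - Z.
Proof. by move=> lf fM <- <- <-; rewrite !(linfB lf) (linfZ lf) !fM. Qed.

Lemma mul_scale_exchange (K : fieldType) (B : algType K) (x g y h : B) a :
  g * y = a *: (y * g) -> (x * g) * (y * h) = a *: (x * y * (g * h)).
Proof.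
by move=> gy; rewrite -!mulrA [g * (y * h)]mulrA gy -!scalerAl -scalerAr -mulrA.
Qed.

(** For X = v_i g, Y = v_j h and w = g h: collecting the group elements on the right costs a =
    chi_j(g) in X Y and c = chi_i(h) in Y X. The scalar e absorbs both, so the relation of X and Y
    is a multiple of that of v_i and v_j, times w. *)
Lemma scale_commutator (K : fieldType) (B : algType K) (X Y Z x y z w : B) q a c e :
  X * Y = a *: (x * y * w) -> Y * X = c *: (y * x * w) -> Z = a *: (z * w) ->
  e = q * a * c^-1 -> c != 0 ->
  X * Y - e *: (Y * X) - Z = a *: ((x * y - q *: (y * x) - z) * w).
Proof.
move=> -> -> -> -> c0; rewrite scalerA divfK // !mulrBl !scalerBr -scalerAl.
by rewrite [q * a]mulrC scalerA.
Qed.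

Section ColorBracket.
Variables (K : fieldType) (gT : finGroupType) (n : nat).
Variable rG : mx_representation K [set: gT]%G n.
Local Notation V := 'cV[K]_n.
Local Notation L := (VG_bimodule rG).
Variables (b : n.-tuple V) (chi : 'I_n -> gT -> K).
Variables (q : 'I_n -> 'I_n -> K) (kappa : V -> V -> VG K gT n).
Local Notation v := (tnth b).
Local Notation S := (@qdoa_rel K gT n rG b q kappa).
Local Notation c i j r g := (coord b r (kappa (v i) (v j) g)).
Hypothesis basis_b : basis_of fullv b.
Hypothesis chiE : forall g i, rG g *m v i = chi i g *: v i.
Hypothesis abelG : forall g h : gT, (g * h = h * g)%g.

Variables (A : zmodType) (eps : A -> A -> K) (grL : A -> L -> Prop).
Variables (br : L -> L -> L) (D : 'I_n -> gT -> A).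
Hypothesis br_bilin : bilin br.
Hypothesis br_gen : forall i j g h, br (vg (v i) g) (vg (v j) h) =
  chi j g *: VG_ract (kappa (v i) (v j)) (gelt K (g * h)%g).
Hypothesis eps_D : forall i j g h,
  eps (D i g) (D j h) = q i j * chi j g * (chi i h)^-1.
Hypothesis grL_coord : forall a x, grL a x ->
  forall i g, coord b i (x g) != 0 -> D i g = a.
Hypothesis grL_gen : forall i g, grL (D i g) (vg (v i) g).

Lemma diag_char_neq0 i g : chi i g != 0.
Proof.
apply/eqP => chi0; have := diag_char1 basis_b chiE i.
rewrite -(mulgV g) (diag_charM basis_b chiE) chi0 mul0r => /esym/eqP.
by rewrite oner_eq0.
Qed.

Lemma kappa_br i j : kappa (v i) (v j) = br (vg (v i) 1%g) (vg (v j) 1%g).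
Proof.
by rewrite br_gen (diag_char1 basis_b chiE) scale1r mulg1 [RHS]VG_ract1.
Qed.

Lemma ideal_ofZ a x : ideal_of S x -> ideal_of S (a *: x).
Proof. by move=> Sx; rewrite -mulr_algl; exact: ideal_Ml. Qed.

Lemma ideal_of_sum I (r : seq I) (F : I -> skewTV rG) :
  (forall i, ideal_of S (F i)) -> ideal_of S (\sum_(i <- r) F i).
Proof.
move=> SF; elim: r => [|i r IH]; first by rewrite big_nil; exact: ideal_0.
by rewrite big_cons; exact: ideal_D.
Qed.

Definition commutator (e : K) (x y : L) : skewTV rG :=
  skew_VG rG x * skew_VG rG y - e *: (skew_VG rG y * skew_VG rG x)
  - skew_VG rG (br x y).

Lemma commutator_linearl e y : linear (commutator e ^~ y).
Proof.
apply: linear_sub_scale.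
- apply: (linear_comp (f := fun z => z * skew_VG rG y)); first exact: mulr_linear.
  exact: skew_VG_linear.
- by apply: linear_comp; [exact: mull_linear|exact: skew_VG_linear].
- apply: (linear_comp (f := @skew_VG _ _ _ rG) (g := br^~ y)).
    exact: skew_VG_linear.
  exact: br_bilin.1.
Qed.

Lemma commutator_linearr e x : linear (commutator e x).
Proof.
apply: linear_sub_scale.
- by apply: linear_comp; [exact: mull_linear|exact: skew_VG_linear].
- apply: (linear_comp (f := fun z => z * skew_VG rG x)); first exact: mulr_linear.
  exact: skew_VG_linear.
- apply: (linear_comp (f := @skew_VG _ _ _ rG) (g := br x)).
    exact: skew_VG_linear.
  exact: br_bilin.2.
Qed.

Lemma skew_vg_mul i j g h : skew_VG rG (vg (v i) g) * skew_VG rG (vg (v j) h) =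
  chi j g *: (skew_v rG (v i) * skew_v rG (v j) * skew_g rG (g * h)%g).
Proof.
rewrite !skew_VG_vg -skew_gM; apply: mul_scale_exchange.
rewrite skew_gv chiE (linfZ (@skew_v_linear _ _ _ rG)).
exact: esym (scalerAl _ _ _).
Qed.

Lemma commutator_gen i j g h :
  ideal_of S (commutator (eps (D i g) (D j h)) (vg (v i) g) (vg (v j) h)).
Proof.
have brE : skew_VG rG (br (vg (v i) g) (vg (v j) h)) =
    chi j g *: (skew_VG rG (kappa (v i) (v j)) * skew_g rG (g * h)%g).
  rewrite br_gen; apply: etrans (linfZ (@skew_VG_linear _ _ _ rG) _ _) _.
  apply: (congr1 ( *:%R _)); rewrite -skew_grpalg_gelt.
  exact: (skew_VG_ract (rG := rG)).
have yx := skew_vg_mul j i h g; rewrite [(h * g)%g]abelG in yx.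
have E := scale_commutator (skew_vg_mul i j g h) yx brE (eps_D i j g h).
rewrite /commutator E ?diag_char_neq0 //.
by apply/ideal_ofZ/ideal_Mr/ideal_gen; constructor.
Qed.

(** Only basis vectors of degree a occur in x and only those of degree a' in y. Hence one value of
    [eps] serves all pairs, and bilinearity reduces to [commutator_gen]. *)
Lemma color_relation x y a a' : grL a x -> grL a' y ->
  ideal_of S (commutator (eps a a') x y).
Proof.
move=> /grL_coord xa /grL_coord ya.
rewrite [x](VG_decomp basis_b) (linf_sum (commutator_linearl _ _)).
apply: ideal_of_sum => i; rewrite (linf_sum (commutator_linearl _ _)).
apply: ideal_of_sum => g; rewrite (linfZ (commutator_linearl _ _)).
have [->|xg] := eqVneq (coord b i (x g)) 0; first by rewrite scale0r; exact: ideal_0.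
rewrite -(xa _ _ xg); apply: ideal_ofZ.
rewrite [y](VG_decomp basis_b) (linf_sum (commutator_linearr _ _)).
apply: ideal_of_sum => j; rewrite (linf_sum (commutator_linearr _ _)).
apply: ideal_of_sum => h; rewrite (linfZ (commutator_linearr _ _)).
have [->|yh] := eqVneq (coord b j (y h)) 0; first by rewrite scale0r; exact: ideal_0.
rewrite -(ya _ _ yh); apply: ideal_ofZ.
exact: commutator_gen.
Qed.

Lemma vg_neq0 i g : vg (v i) g != 0 :> VG K gT n.
Proof.
apply/eqP => /ffunP/(_ g); rewrite !ffunE eqxx => /eqP.
by rewrite (negbTE (v_neq0 basis_b i)).
Qed.

Lemma to_skew_rel x : uea_rel eps grL br x -> ideal_of S (to_skew x).
Proof.
case=> {x} x y a a' [xa _] [ya _].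
have E := hom_commutator (eps a a') (@to_skew_linear K gT n rG)
  (@to_skewM _ _ _ rG) (to_skewL x) (to_skewL y) (to_skewL (br x y)).
by rewrite E; exact: color_relation.
Qed.

Lemma of_skew_rel x : S x -> ideal_of (uea_rel eps grL br) (of_skew x).
Proof.
case=> {x} i j.
have ofv k : of_skew (skew_v rG (v k)) = tinjL (vg (v k) 1%g : L).
  rewrite -of_skew_VG; apply: (congr1 (@of_skew _ _ _ rG)).
  by rewrite skew_VG_vg skew_g1 mulr1.
have deg k : has_degree grL (vg (v k) 1%g) (D k 1%g).
  split; first exact: grL_gen.
  by move/eqP; rewrite (negbTE (vg_neq0 _ _)).
have E := hom_commutator (q i j) (@of_skew_linear K gT n rG)
  (@of_skewM _ _ _ rG) (ofv i) (ofv j) (of_skew_VG rG (kappa (v i) (v j))).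
rewrite E {E} kappa_br; have -> : q i j = eps (D i 1%g) (D j 1%g).
  by rewrite eps_D !(diag_char1 basis_b chiE) mulr1 invr1 mulr1.
by apply: ideal_gen; constructor.
Qed.

Lemma uea_qdoa_iso :
  (exists f : {rmorphism uea eps grL br -> qdoa rG b q kappa}, linear f /\ bijective f)
  /\ (exists f : {rmorphism qdoa rG b q kappa -> uea eps grL br},
        linear f /\ bijective f).
Proof.
split.
  apply: (quotalg_iso (phi := @to_skew K gT n rG) (psi := @of_skew K gT n rG)).
  - exact: to_skew_linear.
  - exact: of_skew_linear.
  - exact: to_skew1.
  - exact: to_skewM.
  - exact: of_skewM.
  - exact: to_skewK.
  - exact: of_skewK.
  - exact: to_skew_rel.
  - exact: of_skew_rel.
apply: (quotalg_iso (phi := @of_skew K gT n rG) (psi := @to_skew K gT n rG)).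
- exact: of_skew_linear.
- exact: to_skew_linear.
- by rewrite -(to_skew1 rG) to_skewK.
- exact: of_skewM.
- exact: to_skewM.
- exact: of_skewK.
- exact: to_skewK.
- exact: of_skew_rel.
- exact: to_skew_rel.
Qed.

(** Translates the Jacobi identity of L into the convolution identities between structure constants
    that normal ordering uses. *)
Lemma coord_br i x s k : coord b s (br (vg (v i) 1%g) x k) =
  \sum_r \sum_g coord b r (x g) * c i r s (k * g^-1)%g.
Proof.
pose f x : K^o := coord b s (br (vg (v i) 1%g) x k).
have lf : linear f.
  by move=> a y z; rewrite /f (br_bilin.2 _) !ffunE linearP.
rewrite -[LHS]/(f x) [in LHS](VG_decomp basis_b x) (linf_sum lf).
apply: eq_bigr => r _; rewrite (linf_sum lf); apply: eq_bigr => g _.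
rewrite (linfZ lf) /f br_gen (diag_char1 basis_b chiE) scale1r mul1g.
rewrite -[_ *: _]/(_ * _); congr (_ * coord b s _).
rewrite ffunE (bigD1 g) //= big1 ?addr0 => [|h hg].
  by rewrite /gelt /sgen ffunE eqxx scale1r.
by rewrite /gelt /sgen ffunE (negbTE hg) scale0r.
Qed.

End ColorBracket.

(** * Gradings and homogeneous bases *)

Section GradingsFromBases.
Variables (K : fieldType) (A : zmodType) (U : lmodType K) (I : finType).
Variables (e : I -> U) (D : I -> A) (co : I -> U -> K^o).
Hypothesis co_linear : forall i, linear (co i).
Hypothesis coE : forall i j, co i (e j) = (i == j)%:R.
Hypothesis co_sum : forall x, x = \sum_i (co i x : K) *: e i.

Lemma co_eq0 x : (forall i, co i x = 0) -> x = 0.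
Proof. by move=> x0; rewrite [x]co_sum big1 // => i _; rewrite x0 scale0r. Qed.

Definition component (a : A) (x : U) : U :=
  \sum_i if D i == a then (co i x : K) *: e i else 0.

Lemma co_component i a x : co i (component a x) = if D i == a then co i x else 0.
Proof.
rewrite /component (linf_sum (co_linear i)) (bigD1 i) //= big1 => [|j ji].
  case: ifP => _; rewrite addr0 ?(linf0 (co_linear i)) //.
  by rewrite (linfZ (co_linear i)) coE eqxx; exact: mulr1.
case: ifP => _; last exact: linf0.
by rewrite (linfZ (co_linear i)) coE eq_sym (negbTE ji) scaler0.
Qed.

Lemma sum_components (s : seq A) x : uniq s -> (forall i, D i \in s) ->
  \sum_(a <- s) component a x = x.
Proof.
move=> us Ds; rewrite exchange_big [RHS]co_sum; apply: eq_bigr => i _ /=.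
rewrite (bigD1_seq (D i)) //= eqxx big1 ?addr0 // => a.
by rewrite eq_sym => /negbTE->.
Qed.

(** In this form 0 is homogeneous of every degree, and closure under linear combinations is
    immediate. *)
Definition basis_gr (a : A) (x : U) : Prop := forall i, co i x != 0 -> D i = a.

Lemma basis_grading : grading basis_gr.
Proof.
split=> [a|x|s c us cgr c0 a sa].
- split=> [i|k x y xa ya i]; first by rewrite (linf0 (co_linear i)) eqxx.
  rewrite co_linear; have [xi|/xa//] := eqVneq (co i x) 0.
  by rewrite xi scaler0 add0r; exact: ya.
- exists (undup (map D (enum I))), (component ^~ x); split=> [a i|].
    by rewrite co_component; case: (D i =P a) => // _; rewrite eqxx.
  rewrite sum_components ?undup_uniq // => i.
  by rewrite mem_undup map_f // mem_enum.
apply: co_eq0 => i; have := congr1 (co i) c0.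
rewrite (linf0 (co_linear i)) (linf_sum (co_linear i)) (bigD1_seq a) //=.
have [//|/cgr Di] := eqVneq (co i (c a)) 0.
rewrite big1 ?addr0 // => a' a'a; apply/eqP; apply: contraNT a'a => /cgr <-.
by rewrite Di.
Qed.

Lemma basis_gr_e i : basis_gr (D i) (e i).
Proof. by move=> j; rewrite coE; have [->|_] := eqVneq j i; rewrite ?eqxx. Qed.

Variable gr : A -> U -> Prop.
Hypothesis gr_grading : grading gr.
Hypothesis gr_e : forall i, gr (D i) (e i).

Lemma gr_lin a k x y : gr a x -> gr a y -> gr a (k *: x + y).
Proof. by have [/(_ a)[_ H] _ _] := gr_grading; exact: H. Qed.
Lemma gr_0 a : gr a 0.
Proof. by have [/(_ a)[H _] _ _] := gr_grading. Qed.
Lemma grZ a k x : gr a x -> gr a (k *: x).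
Proof. by move=> xa; rewrite -[_ *: _]addr0; apply: gr_lin => //; exact: gr_0. Qed.
Lemma gr_sum a (J : Type) (r : seq J) (F : J -> U) :
  (forall j, gr a (F j)) -> gr a (\sum_(j <- r) F j).
Proof.
move=> Fa; elim: r => [|j r IH]; first by rewrite big_nil; exact: gr_0.
by rewrite big_cons -[F j]scale1r; exact: gr_lin.
Qed.

(** A homogeneous basis determines the grading. The element x, placed in degree a, minus its
    components with respect to the basis is a family of homogeneous elements with sum 0; by
    independence the component of x in any other degree vanishes. *)
Lemma gr_coord a x : gr a x -> basis_gr a x.
Proof.
move=> xa i; have [//|Dia] := eqVneq (D i) a; case/eqP.
have [_ _ indep] := gr_grading.
pose c a' : U := (if a' == a then x else 0) - component a' x.
(* The degree a is listed separately because no basis vector need have it. *)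
pose s := undup (a :: map D (enum I)).
have Ds j : D j \in s by rewrite mem_undup inE map_f ?orbT // mem_enum.
have us : uniq s by exact: undup_uniq.
have sa : a \in s by rewrite mem_undup inE eqxx.
have c_gr a' : gr a' (c a').
  rewrite /c addrC -scaleN1r; apply: gr_lin; last first.
    by case: eqP => [->//|_]; exact: gr_0.
  by apply: gr_sum => j; case: eqP => [<-|_]; [exact: grZ|exact: gr_0].
have c0 : \sum_(a' <- s) c a' = 0.
  rewrite sumrB sum_components // (bigD1_seq a) //= eqxx big1 ?addr0 ?subrr //.
  by move=> a' /negbTE->.
have /(congr1 (co i)) := indep s c us c_gr c0 (D i) (Ds i).
rewrite /c (negbTE Dia) sub0r (linfN (co_linear i)) co_component eqxx.
by rewrite (linf0 (co_linear i)) => /eqP; rewrite oppr_eq0 => /eqP.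
Qed.

End GradingsFromBases.

(** * Bases of homogeneous vectors *)

Section HomogeneousBasis.
Variables (K : fieldType) (vT : vectType K).

Lemma free_subseq_span (X : seq vT) : exists Y : seq vT,
  [/\ {subset Y <= X}, free Y & <<Y>>%VS = <<X>>%VS].
Proof.
elim: X => [|x X [Y [sub fY sY]]]; first by exists [::]; split=> //; exact: nil_free.
have [xY|xY] := boolP (x \in <<Y>>%VS).
  exists Y; split=> // [y yY|]; first by rewrite inE sub ?orbT.
  rewrite span_cons -sY; apply/esym/addv_idPr.
  by rewrite -memvE.
exists (x :: Y); split=> [y||].
- by rewrite !inE => /orP[->//|/sub->]; rewrite orbT.
- by rewrite free_cons xY.
- by rewrite !span_cons sY.
Qed.

(** The homogeneous components of the vectors of any basis span the space, and a spanning family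
    contains a basis. *)
Lemma homogeneous_basis (A : zmodType) (gr : A -> vT -> Prop) n :
  \dim {:vT} = n -> grading gr ->
  exists b : n.-tuple vT, basis_of fullv b /\ forall i, exists a, gr a (tnth b i).
Proof.
move=> dimV [_ dec _].
have [X [hX sX]] : exists X : seq vT, (forall x, x \in X -> exists a, gr a x) /\
    <<X>>%VS = fullv.
  have H (Z : seq vT) : exists X : seq vT,
      (forall x, x \in X -> exists a, gr a x) /\ {subset Z <= <<X>>%VS}.
    elim: Z => [|z Z [X [hX sX]]]; first by exists [::].
    have [s [c [c_gr zE]]] := dec z.
    exists ([seq c a | a <- s] ++ X); split=> [x|x].
      by rewrite mem_cat => /orP[/mapP[a _ ->]|/hX//]; exists a.
    rewrite inE span_cat => /orP[/eqP->|/sX xX].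
      apply: (subvP (addvSl _ _)); rewrite zE big_seq.
      by apply: memv_suml => a sa; apply: memv_span; exact: map_f.
    exact: (subvP (addvSr _ _)).
  have [X [hX sX]] := H (vbasis fullv); exists X; split=> //.
  apply/eqP; rewrite eqEsubv subvf -(span_basis (vbasisP fullv)).
  exact/span_subvP.
have [Y [sub fY sY]] := free_subseq_span X.
have bY : basis_of fullv (in_tuple Y) by rewrite /basis_of /= sY sX eqxx.
have sizeY : size Y == n by rewrite -dimV (size_basis bY).
exists (Tuple sizeY); split=> // i.
by apply/hX/sub; rewrite (tnth_nth 0) /= mem_nth // (eqP sizeY).
Qed.

End HomogeneousBasis.

(** * A group with prescribed nondegenerate bicharacter *)

Section BicharacterGroup.
Variables (K : fieldType) (I : finType) (E : I -> I -> K).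
Hypothesis E_neq0 : forall i j, E i j != 0.
Hypothesis E_antisym : forall i j, E j i = (E i j)^-1.
Local Notation F := {ffun I -> int}.
Local Open Scope quotient_scope.

(** The pairing of x with the generator j, where x is an exponent vector in the free abelian group
    on I. *)
Definition char_at (x : F) (j : I) : K := \prod_i E i j ^ x i.
Definition free_bichar (x y : F) : K := \prod_j char_at x j ^ y j.

Lemma char_at_neq0 x j : char_at x j != 0.
Proof. by apply/prodf_neq0 => i _; rewrite expfz_neq0. Qed.

Lemma char_atD x y j : char_at (x + y) j = char_at x j * char_at y j.
Proof. by rewrite -big_split; apply: eq_bigr => i _; rewrite ffunE expfzDr. Qed.
Lemma char_at0 j : char_at 0 j = 1.
Proof. by rewrite /char_at big1 // => i _; rewrite ffunE expr0z. Qed.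
Lemma char_atN x j : char_at (- x) j = (char_at x j)^-1.
Proof.
apply: (mulIf (char_at_neq0 x j)); rewrite mulVf ?char_at_neq0 //.
by rewrite -char_atD addNr char_at0.
Qed.

Lemma free_bichar_neq0 x y : free_bichar x y != 0.
Proof. by apply/prodf_neq0 => i _; rewrite expfz_neq0 // char_at_neq0. Qed.

Lemma free_bicharDr x y z : free_bichar x (y + z) = free_bichar x y * free_bichar x z.
Proof.
by rewrite -big_split; apply: eq_bigr => i _; rewrite ffunE expfzDr // char_at_neq0.
Qed.
Lemma free_bicharDl x y z : free_bichar (x + y) z = free_bichar x z * free_bichar y z.
Proof. by rewrite -big_split; apply: eq_bigr => i _; rewrite char_atD expfzMl. Qed.

Lemma free_bichar_antisym x y : free_bichar y x = (free_bichar x y)^-1.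
Proof.
rewrite /free_bichar /char_at.
have expz_prod (f : I -> K) (z : int) : (\prod_i f i) ^ z = \prod_i f i ^ z.
  by apply: (big_morph (fun a => a ^ z)) => [a c|]; rewrite ?exp1rz // expfzMl.
rewrite -prodfV; under eq_bigr => j _ do rewrite expz_prod.
under [RHS]eq_bigr => j _ do rewrite expz_prod -prodfV.
rewrite exchange_big; apply: eq_bigr => i _; apply: eq_bigr => j _ /=.
by rewrite [E j i]E_antisym exprz_inv invr_expz !exprz_exp; congr (_ ^ _); lia.
Qed.

(** The left kernel of the pairing; testing against generators suffices, since [free_bichar] is a
    product of powers of these values. *)
Definition radical : {pred F} := fun x => [forall j, char_at x j == 1].

Lemma radicalP x : reflect (forall j, char_at x j = 1) (x \in radical).
Proof. by apply: (iffP forallP) => H j; apply/eqP/H. Qed.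

Lemma radical_zmod : zmod_closed radical.
Proof.
split=> [|x y /radicalP x1 /radicalP y1]; apply/radicalP => j; first exact: char_at0.
by rewrite char_atD char_atN x1 y1 invr1 mulr1.
Qed.

HB.instance Definition _ := GRing.isZmodClosed.Build F radical radical_zmod.

Definition bichar_quotient : zmodType := Quotient.quot radical.

Let qclass (x : F) : bichar_quotient := \pi_(Quotient.quot radical) x.
Let qlift (a : bichar_quotient) : F := repr (a : Quotient.quot radical).

Let qliftK a : qclass (qlift a) = a.
Proof. by rewrite /qclass /qlift reprK. Qed.

Let qclassD x y : qclass (x + y) = qclass x + qclass y.
Proof. exact: (@pi_addr _ _ _ _ _ (Quotient.quot radical)). Qed.

Let qclass_eq x y : (forall j, char_at x j = char_at y j) -> qclass x = qclass y.
Proof.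
move=> xy; apply/eqP; rewrite -[_ == _](Quotient.idealrBE radical).
by apply/radicalP => j; rewrite char_atD char_atN xy mulfV ?char_at_neq0.
Qed.

Let qclass_char x y : qclass x = qclass y -> forall j, char_at x j = char_at y j.
Proof.
move/eqP; rewrite -[_ == _](Quotient.idealrBE radical) => /radicalP xy j.
have := xy j; rewrite char_atD char_atN => /(canRL (mulfVK _)) -> //.
  by rewrite mul1r.
by rewrite char_at_neq0.
Qed.

(** The last clause is the purpose of the quotient: two degrees are equal as soon as [eps] does not
    distinguish them on the generators. *)
Lemma nondegenerate_bicharacter : exists (A : zmodType) (eps : A -> A -> K) (d : I -> A),
  [/\ antisymmetric_bicharacter eps, forall i j, eps (d i) (d j) = E i j
    & forall a a', (forall j, eps a (d j) = eps a' (d j)) -> a = a'].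
Proof.
pose eps (a a' : bichar_quotient) := free_bichar (qlift a) (qlift a').
pose delta i : F := [ffun j => (j == i)%:Z].
(* The pairing descends in its first argument by the definition of the radical, and in its second by
   antisymmetry. *)
have congl x x' y : qclass x = qclass x' -> free_bichar x y = free_bichar x' y.
  by move=> /qclass_char xx; apply: eq_bigr => j _; rewrite xx.
have congr x y y' : qclass y = qclass y' -> free_bichar x y = free_bichar x y'.
  by move=> yy; rewrite free_bichar_antisym [RHS]free_bichar_antisym (congl _ _ _ yy).
have epsE x y : eps (qclass x) (qclass y) = free_bichar x y.
  by rewrite /eps (congl _ x) ?qliftK // (congr _ _ y) ?qliftK.
have charE x j : free_bichar x (delta j) = char_at x j.
  rewrite /free_bichar (bigD1 j) //= ffunE eqxx expr1z big1 ?mulr1 // => i ij.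
  by rewrite ffunE (negbTE ij) expr0z.
exists bichar_quotient, eps, (fun i => qclass (delta i)); split.
- split=> [|a a']; last exact: free_bichar_antisym.
  split=> [a a'|a a' a''|a a' a'']; first exact: free_bichar_neq0.
    by rewrite -[a' in LHS]qliftK -[a'' in LHS]qliftK -qclassD -[a in LHS]qliftK epsE free_bicharDr.
  by rewrite -[a in LHS]qliftK -[a' in LHS]qliftK -qclassD -[a'' in LHS]qliftK epsE free_bicharDl.
- move=> i j; rewrite epsE charE /char_at (bigD1 i) //= ffunE eqxx expr1z.
  by rewrite big1 ?mulr1 // => k ki; rewrite ffunE (negbTE ki) expr0z.
move=> a a' aa; rewrite -[a]qliftK -[a']qliftK; apply: qclass_eq => j.
have := aa j; rewrite -[a]qliftK -[a']qliftK !epsE !charE.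
by rewrite !qliftK.
Qed.

End BicharacterGroup.

(** * From color Lie rings to orbifold algebras *)

Section EnvelopingAlgebraIsOrbifold.
Variables (K : fieldType) (gT : finGroupType) (n : nat).
Variable rG : mx_representation K [set: gT]%G n.
Local Notation V := 'cV[K]_n.
Local Notation L := (VG_bimodule rG).
Variables (A : zmodType) (eps : A -> A -> K).
Variables (grG : A -> grpalg K gT -> Prop) (grV : A -> V -> Prop).
Variables (grL : A -> L -> Prop) (br : L -> L -> L).
Hypothesis abelG : forall g h : gT, (g * h = h * g)%g.
Hypothesis two_neq0 : (2%:R : K) != 0.
Hypothesis eps_bichar : antisymmetric_bicharacter eps.
Hypothesis yd : Yetter_Drinfeld_color_Lie_ring eps grG grV grL br.
Hypothesis pos : purely_positive_part eps grV.
Hypothesis trivG : trivial_on_group eps grG.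

Lemma YD_orbifold : exists (b : n.-tuple V) (q : 'I_n -> 'I_n -> K)
    (kappa : V -> V -> VG K gT n),
  [/\ diagonal_basis rG b, quantum_system q, parameter_function b q kappa,
      PBW_property rG b q kappa
    & exists f : {rmorphism uea eps grL br -> qdoa rG b q kappa},
        linear f /\ bijective f].
Proof.
have [[eps_neq0 epsDr epsDl] epsV] := eps_bichar.
have [clr ydG ydV yd_ind yd_act] := yd.
have [_ [gradL _] br_bilin br_lr br_bal br_deg br_antisym br_jac] := clr.
have dimV : \dim {: 'cV[K]_n} = n by rewrite dimvf /dim /= muln1.
have [b [basis_b b_hom]] := homogeneous_basis (vT := 'cV[K]_n) dimV ydV.
have [dV dVE] : exists dV : 'I_n -> A, forall i, grV (dV i) (tnth b i).
  by exists (fun i => projT1 (cid (b_hom i))) => i; case: cid.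
have [dG dGE] : exists dG : gT -> A, forall g, grG (dG g) (gelt K g).
  by exists (fun g => projT1 (cid (ydG g))) => g; case: cid.
pose v i := tnth b i.
have dVdeg i : has_degree grV (v i) (dV i).
  split=> [|/eqP]; first exact: dVE.
  by rewrite (negbTE (v_neq0 basis_b i)).
pose chi i g := eps (dG g) (dV i).
have chiE g i : rG g *m v i = chi i g *: v i by exact: yd_act.
have chi1 i : chi i 1%g = 1 by exact: (diag_char1 basis_b chiE).
pose q i j := eps (dV i) (dV j).
have q_sys : quantum_system q.
  split=> [i j|i|i j]; [exact: eps_neq0| |exact: epsV].
  by apply: (pos (v_neq0 basis_b i)); exact: dVE.
have [q_neq0 qii qV] := q_sys.
pose D i g := dV i + dG g.
have grL_gen i g : grL (D i g) (vg (v i) g).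
  by apply: yd_ind; [exact: dVdeg|exact: dGE].
(* Triviality of [eps] on the degrees of G removes the factor eps |g| |h|. What is left is exactly
   the scalar needed to reduce the relation of v_i g and v_j h to that of v_i and v_j. *)
have eps_D i j g h : eps (D i g) (D j h) = q i j * chi j g * (chi i h)^-1.
  rewrite epsDl !epsDr (trivG (dGE g) (dGE h)) mulr1 /q /chi.
  by rewrite [eps (dV i) (dG h)]epsV; ring.
pose kappa (u w : V) : VG K gT n := br (vg u 1%g) (vg w 1%g).
have ract_gen g u h : Defs.ract (vg u h : L) (gelt K g) = vg u (h * g)%g.
  exact: VG_ract_gen.
have lact_gen g u h : lact (gelt K g) (vg u h : L) = vg (rG g *m u) (g * h)%g.
  exact: VG_lact_gen.
have vgZ a u g : vg (a *: u) g = a *: vg u g :> VG K gT n.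
  exact: linfZ (@vg_linear K gT n g) a u.
have br_gen i j g h : br (vg (v i) g) (vg (v j) h) =
    chi j g *: VG_ract (kappa (v i) (v j)) (gelt K (g * h)%g).
  (* Balancedness moves g from the first argument to the second, where it acts on v_j by chi_j(g);
     right linearity then extracts g h. *)
  have vgE u k : vg u k = Defs.ract (vg u 1%g : L) (gelt K k) by rewrite ract_gen mul1g.
  rewrite [vg (v i) g]vgE br_bal lact_gen chiE vgZ (linfZ (br_bilin.2 _)).
  rewrite [vg (v j) (g * h)%g]vgE -[X in br X _](lact1 (b := L)) br_lr lact1.
  by [].
have grL_coord a x : grL a x -> forall i g, coord b i (x g) != 0 -> D i g = a.
  pose co (ig : 'I_n * gT) (x : L) : K^o := coord b ig.1 (x ig.2).
  have co_lin ig : linear (co ig).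
    by move=> k y z; rewrite /co !ffunE linearP.
  have coE ig jh : co ig (vg (v jh.1) jh.2) = (ig == jh)%:R.
    case: ig jh => [i g] [j h]; rewrite /co ffunE /= xpair_eqE.
    case: (g =P h) => _; last by rewrite linear0 andbF.
    by rewrite (coord_v basis_b) andbT.
  have co_sum y : y = \sum_ig (co ig y : K) *: (vg (v ig.1) ig.2 : L).
    rewrite [LHS](VG_decomp basis_b) pair_bigA.
    by [].
  move=> xa i g; apply: (gr_coord (D := fun ig => D ig.1 ig.2) co_lin coE co_sum
    gradL _ xa (i := (i, g))).
  by move=> ig; exact: grL_gen.
have kappa_bilin : bilin kappa.
  split=> [y|x].
    apply: (linear_comp (f := br^~ (vg y 1%g)) (g := fun u => vg u 1%g : L)).
      exact: br_bilin.1.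
    exact: vg_linear.
  apply: (linear_comp (f := br (vg x 1%g)) (g := fun u => vg u 1%g : L)).
    exact: br_bilin.2.
  exact: vg_linear.
have deg i : has_degree grL (vg (v i) 1%g) (D i 1%g).
  split=> [|/eqP]; first exact: grL_gen.
  by rewrite (negbTE (vg_neq0 (gT := gT) basis_b _ _)).
have epsD1 i j : eps (D i 1%g) (D j 1%g) = q i j.
  by rewrite eps_D !chi1 invr1 !mulr1.
have kappa_antisym i j : kappa (v i) (v j) = - q i j *: kappa (v j) (v i).
  by rewrite -epsD1; exact: br_antisym.
(* The bracket of homogeneous elements is homogeneous, so every basis vector occurring in it has the
   degree of the bracket. *)
have c_deg i j r g : coord b r (kappa (v i) (v j) g) != 0 ->
    D r g = D i 1%g + D j 1%g.
  by apply: grL_coord; exact: br_deg.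
have qK i j : q i j * q j i = 1 by rewrite [q j i]qV mulfV.
have c_vanish i j k r g : coord b r (kappa (v i) (v j) g) != 0 ->
    chi k g = q i k * q j k * q k r.
  (* Paired with v_k, the equality of degrees reads q_rk chi_k(g) = q_ik q_jk. *)
  move=> /c_deg/(congr1 (eps ^~ (D k 1%g))).
  rewrite epsDl eps_D !epsD1 chi1 invr1 mulr1 => <-.
  by rewrite -mulrA mulrC -mulrA [q k r * _]qK mulr1.
have c_inv i j r g h : coord b r (kappa (v i) (v j) g) != 0 ->
    chi i h * chi j h = chi r h.
  (* Pairing with v_r h gives chi_r(h) chi_r(g)^-1 = q_ri chi_i(h) q_rj chi_j(h); the strong
     vanishing condition at k = r evaluates chi_r(g) as q_ir q_jr, and the scalars q cancel. *)
  move=> c0; have /(congr1 (eps (D r h))) := c_deg _ _ _ _ c0.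
  rewrite epsDr !eps_D !chi1 invr1 !mulr1 (c_vanish _ _ r _ _ c0) qii mul1r mulr1.
  move=> E; apply: (mulfI (mulf_neq0 (q_neq0 r i) (q_neq0 r j))).
  transitivity (q r i * chi i h * (q r j * chi j h)); first by ring.
  by rewrite -E invfM -!qV; ring.
have c_jac i j l s k :
    let c i j r g := coord b r (kappa (v i) (v j) g) in
    \sum_r \sum_g (c j l r g * c i r s (k * g^-1)%g
      - q i j * (c i l r g * c j r s (k * g^-1)%g)
      + q j l * q i l * (c i j r g * c l r s (k * g^-1)%g)) = 0.
  move=> c; pose X i' x : K := coord b s (br (vg (v i') 1%g) x k).
  have XE i' x : X i' x = \sum_r \sum_g coord b r (x g) * c i' r s (k * g^-1)%g.
    exact: (coord_br basis_b chiE br_bilin br_gen).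
  have Xlin i' : linear (X i' : L -> K^o).
    by move=> a y z; rewrite /X (br_bilin.2 _) !ffunE linearP.
  have := br_jac _ _ _ _ _ _ (deg i) (deg j) (deg l); rewrite !epsD1.
  rewrite -[br (vg (v j) _) (vg (v l) _)]/(kappa (v j) (v l)).
  rewrite -[br (vg (v l) _) (vg (v i) _)]/(kappa (v l) (v i)).
  rewrite -[br (vg (v i) _) (vg (v j) _)]/(kappa (v i) (v j)).
  rewrite [kappa (v l) (v i)]kappa_antisym => /(congr1 (fun x : L => coord b s (x k))).
  rewrite !ffunE linear0 !linearD !linearZ /=.
  rewrite -/(X i _) -/(X j _) -/(X l _) (linfZ (Xlin j)) => E.
  (* The color Jacobi identity, with [v_l, v_i] replaced by - q_li [v_i, v_l], is multiplied by q_il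
     to reach the normalization of the overlap computation. *)
  have {}E : X i (kappa (v j) (v l)) - q i j * X j (kappa (v i) (v l))
      + q j l * q i l * X l (kappa (v i) (v j)) = 0.
    rewrite -[RHS](mulr0 (q i l)) -E -[_ *: _]/(_ * _).
    rewrite -[X in X - _ + _]mul1r -(qK i l).
    transitivity (q i l * q l i * X i (kappa (v j) (v l))
      - (q i l * q l i) * (q i j * X j (kappa (v i) (v l)))
      + q j l * q i l * X l (kappa (v i) (v j))); last by ring.
    by rewrite qK !mul1r.
  rewrite -[RHS]E !XE !mulr_sumr -sumrB -big_split; apply: eq_bigr => r _ /=.
  by rewrite !mulr_sumr -sumrB -big_split; apply: eq_bigr.
exists b, q, kappa; split=> //.
- by split=> // g i; exists (chi i g).
- exact: (PBW_of_jacobi basis_b chiE).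
- have [] := uea_qdoa_iso basis_b chiE abelG br_bilin br_gen eps_D grL_coord grL_gen.
  by [].
Qed.

End EnvelopingAlgebraIsOrbifold.

(** * From orbifold algebras to color Lie rings *)

(** Moving g across x y or y x costs the same scalar a c, so the quadratic parts cancel and only the
    terms in z survive. *)
Lemma conjugate_commutator (K : fieldType) (B : algType K) (g x y : B) a c q z :
  g * x = a *: (x * g) -> g * y = c *: (y * g) ->
  g * z - (a * c) *: (z * g) =
  (a * c) *: ((x * y - q *: (y * x) - z) * g) - g * (x * y - q *: (y * x) - z).
Proof.
move=> gx gy; rewrite !mulrBl !mulrBr -scalerAl -scalerAr.
have gxy : g * (x * y) = (a * c) *: (x * y * g).
  by rewrite mulrA gx -scalerAl -[x * g * y]mulrA gy -scalerAr scalerA mulrA.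
have gyx : g * (y * x) = (a * c) *: (y * x * g).
  by rewrite mulrA gy -scalerAl -[y * g * x]mulrA gx -scalerAr scalerA mulrA [c * a]mulrC.
rewrite gxy gyx !scalerBr !scalerA [q * _]mulrC opprB.
by rewrite [RHS]addrC addrA subrK.
Qed.

Section GroupElementActions.
Variables (K : fieldType) (gT : finGroupType) (n : nat).
Variable rG : mx_representation K [set: gT]%G n.

Lemma VG_lact_gelt k (x : VG K gT n) h :
  VG_lact rG (gelt K k) x h = rG k *m x (k^-1 * h)%g.
Proof.
rewrite ffunE (bigD1 k) //= big1 => [|g gk].
  by rewrite /gelt /sgen ffunE eqxx scale1r addr0.
by rewrite /gelt /sgen ffunE (negbTE gk) scale0r.
Qed.

Lemma VG_ract_gelt k (x : VG K gT n) h : VG_ract x (gelt K k) h = x (h * k^-1)%g.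
Proof.
rewrite ffunE (bigD1 k) //= big1 => [|g gk].
  by rewrite /gelt /sgen ffunE eqxx scale1r addr0.
by rewrite /gelt /sgen ffunE (negbTE gk) scale0r.
Qed.

End GroupElementActions.

(** * Consequences of the PBW property: V (x) KG embeds and kappa is invariant *)

Section PBWConsequences.
Variables (K : fieldType) (gT : finGroupType) (n : nat).
Variable rG : mx_representation K [set: gT]%G n.
Local Notation V := 'cV[K]_n.
Local Notation L := (VG_bimodule rG).
Variables (b : n.-tuple V) (chi : 'I_n -> gT -> K).
Variables (q : 'I_n -> 'I_n -> K) (kappa : V -> V -> VG K gT n).
Local Notation v := (tnth b).
Local Notation S := (@qdoa_rel K gT n rG b q kappa).
Local Notation c i j r g := (coord b r (kappa (v i) (v j) g)).
Hypothesis basis_b : basis_of fullv b.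
Hypothesis chiE : forall g i, rG g *m v i = chi i g *: v i.
Hypothesis pbw : PBW_property rG b q kappa.

Lemma PBW_monomial1 r g :
  PBW_monomial rG b q kappa ([ffun i => (i == r) : nat], g) =
  api S (skew_v rG (v r) * skew_g rG g).
Proof.
rewrite /PBW_monomial /qdoa_pi; congr (api S (_ * _)).
have E (B : pzRingType) (x : 'I_n -> B) :
    \prod_(i < n) x i ^+ (i == r) = x r.
  have Es (s : seq 'I_n) : uniq s ->
      \prod_(i <- s) x i ^+ (i == r) = if r \in s then x r else 1.
    elim: s => [|i s IH] /=; first by rewrite big_nil.
    move=> /andP[is_ /IH {}IH]; rewrite big_cons IH inE [r == i]eq_sym.
    case: (eqVneq i r) => [ir|_] /=; last by rewrite expr0 mul1r.
    by rewrite -ir (negbTE is_) expr1 mulr1.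
  by rewrite Es ?index_enum_uniq // mem_index_enum.
by rewrite -[RHS](E _ (fun i => skew_v rG (v i))); apply: eq_bigr => i _; rewrite ffunE.
Qed.

(** The elements v_r g are the PBW monomials of degree one, hence independent in the quotient. *)
Lemma skew_VG_inj (x : VG K gT n) : ideal_of S (skew_VG rG x) -> x = 0.
Proof.
move=> Sx; have [_ free] := pbw.
have sx : api S (skew_VG rG x) = 0.
  by rewrite -(linf0 (api_linear S)); apply/apiP; rewrite subr0.
pose mon (rg : 'I_n * gT) : {ffun 'I_n -> nat} * gT :=
  ([ffun i => (i == rg.1) : nat], rg.2).
have mon_inj : injective mon.
  move=> [r g] [r' g'] [/ffunP/(_ r)]; rewrite !ffunE eqxx => + ->.
  by have [->|] := eqVneq r r'.
(* The PBW property wants coefficients on all exponent vectors; summing over the fibre of the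
   injective map [mon] supplies them without choosing an inverse. *)
pose co (m : {ffun 'I_n -> nat} * gT) : K :=
  \sum_(rg | mon rg == m) coord b rg.1 (x rg.2).
have coE rg : co (mon rg) = coord b rg.1 (x rg.2).
  by rewrite /co (eq_bigl (pred1 rg)) ?big_pred1_eq // => rg'; rewrite (inj_eq mon_inj).
have := free (map mon (enum {: 'I_n * gT})) co.
rewrite (map_inj_uniq mon_inj) enum_uniq big_map big_enum /= => /(_ isT) H.
have {}H : forall r g, coord b r (x g) = 0.
  move=> r g; rewrite -(coE (r, g)); apply: H; last by rewrite map_f // mem_enum.
  rewrite -[RHS]sx (skew_VG_decomp rG basis_b) (linf_sum (api_linear S)).
  rewrite -(pair_bigA _ (fun r g => co (mon (r, g)) *: PBW_monomial rG b q kappa (mon (r, g)))) /=.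
  apply: eq_bigr => r' _; rewrite (linf_sum (api_linear S)); apply: eq_bigr => g' _.
  by rewrite coE (linfZ (api_linear S)) -PBW_monomial1.
apply/ffunP => g; rewrite ffunE (basis_coord basis_b (x g)) big1 // => r _.
by rewrite H scale0r.
Qed.

(* Conjugate the relation of v_i and v_j by k and compare with the relation itself. *)
Lemma kappa_lact i j k : lact (gelt K k) (kappa (v i) (v j) : L) =
  (chi i k * chi j k) *: Defs.ract (kappa (v i) (v j) : L) (gelt K k).
Proof.
have gvE l : skew_g rG k * skew_v rG (v l) = chi l k *: (skew_v rG (v l) * skew_g rG k).
  rewrite skew_gv chiE (linfZ (@skew_v_linear _ _ _ rG)).
  exact: esym (scalerAl _ _ _).
have E := conjugate_commutator (q i j) (skew_VG rG (kappa (v i) (v j))) (gvE i) (gvE j).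
apply/eqP; rewrite -subr_eq0; apply/eqP; apply: skew_VG_inj.
have -> : skew_VG rG (lact (gelt K k) (kappa (v i) (v j) : L) -
    (chi i k * chi j k) *: Defs.ract (kappa (v i) (v j) : L) (gelt K k)) =
  skew_g rG k * skew_VG rG (kappa (v i) (v j)) -
    (chi i k * chi j k) *: (skew_VG rG (kappa (v i) (v j)) * skew_g rG k).
  rewrite (linfB (@skew_VG_linear _ _ _ rG)) (linfZ (@skew_VG_linear _ _ _ rG)).
  by rewrite skew_VG_lact skew_VG_ract skew_grpalg_gelt.
rewrite E -scaleN1r; apply: ideal_D; first by apply/ideal_ofZ/ideal_Mr/ideal_gen; constructor.
by apply/ideal_ofZ/ideal_Ml/ideal_gen; constructor.
Qed.

(** Compare the coefficients of v_r (x) k g on both sides of [kappa_lact]; commutativity of G makes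
    the same coefficient of kappa appear twice. *)
Lemma kappa_invariant_coef i j r g k : (forall g h : gT, (g * h = h * g)%g) ->
  c i j r g != 0 -> chi i k * chi j k = chi r k.
Proof.
move=> abelG c0; apply: (mulIf c0).
have := congr1 (fun x : L => coord b r (x (k * g)%g)) (kappa_lact i j k).
rewrite /= VG_lact_gelt [X in _ = coord b r X]ffunE VG_ract_gelt mulKg [(k * g)%g]abelG mulgK.
by rewrite (coord_action basis_b chiE) linearZ.
Qed.

End PBWConsequences.

(** Reduces homogeneity of a bilinear map to pairs of basis vectors; it serves for the product of
    KG, both actions on L and the bracket. *)
Lemma graded_bilin (K : fieldType) (A : zmodType) (I1 I2 : finType)
    (U1 U2 U3 : lmodType K) (e1 : I1 -> U1) (e2 : I2 -> U2)
    (D1 : I1 -> A) (D2 : I2 -> A) (co1 : I1 -> U1 -> K^o) (co2 : I2 -> U2 -> K^o)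
    (gr : A -> U3 -> Prop) (F : U1 -> U2 -> U3) x y a a' :
  (forall x, x = \sum_i (co1 i x : K) *: e1 i) ->
  (forall x, x = \sum_i (co2 i x : K) *: e2 i) ->
  grading gr -> bilin F ->
  (forall i j, gr (D1 i + D2 j) (F (e1 i) (e2 j))) ->
  basis_gr D1 co1 a x -> basis_gr D2 co2 a' y -> gr (a + a') (F x y).
Proof.
move=> co1E co2E grG [Fl Fr] Fe xa ya.
rewrite [x]co1E (linf_sum (Fl y)); apply: gr_sum => // i.
rewrite (linfZ (Fl y)); have [->|/xa<-] := eqVneq (co1 i x) 0.
  by rewrite scale0r; exact: gr_0.
apply: grZ => //; rewrite [y]co2E (linf_sum (Fr _)); apply: gr_sum => // j.
rewrite (linfZ (Fr _)); have [->|/ya<-] := eqVneq (co2 j y) 0.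
  by rewrite scale0r; exact: gr_0.
exact: grZ.
Qed.

Lemma basis_linear_eq (K : fieldType) (I : finType) (U W : lmodType K) (e : I -> U)
    (co : I -> U -> K^o) (f f' : U -> W) :
  (forall x, x = \sum_i (co i x : K) *: e i) -> linear f -> linear f' ->
  (forall i, f (e i) = f' (e i)) -> f =1 f'.
Proof.
move=> coE lf lf' ff x; rewrite [x]coE (linf_sum lf) (linf_sum lf').
by apply: eq_bigr => i _; rewrite (linfZ lf) (linfZ lf') ff.
Qed.

Lemma basis_bilin_eq0 (K : fieldType) (I : finType) (U W : lmodType K) (e : I -> U)
    (co : I -> U -> K^o) (F : U -> U -> W) x y :
  (forall x, x = \sum_i (co i x : K) *: e i) -> bilin F ->
  (forall i j, co i x != 0 -> co j y != 0 -> F (e i) (e j) = 0) -> F x y = 0.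
Proof.
move=> coE [Fl Fr] F0; rewrite {1}[x]coE (linf_sum (Fl y)) big1 // => i _.
rewrite (linfZ (Fl y)); have [->|xi] := eqVneq (co i x) 0; first by rewrite scale0r.
rewrite {1}[y]coE (linf_sum (Fr _)) big1 ?scaler0 // => j _; rewrite (linfZ (Fr _)).
have [->|yj] := eqVneq (co j y) 0; first by rewrite scale0r.
by rewrite F0 // scaler0.
Qed.

(** * The bracket on V (x) KG determined by kappa *)

Section BracketFromParameter.
Variables (K : fieldType) (gT : finGroupType) (n : nat).
Variable rG : mx_representation K [set: gT]%G n.
Local Notation V := 'cV[K]_n.
Local Notation L := (VG_bimodule rG).
Variable kappa : V -> V -> VG K gT n.
Hypothesis kappa_bilin : bilin kappa.

(** Balancedness and right linearity force [u g, w h] = [u, g w] g h; the formula is the bilinear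
    extension of this. *)
Definition orbifold_bracket (x y : L) : L :=
  \sum_g \sum_h VG_ract (kappa (x g) (rG g *m y h)) (gelt K (g * h)%g).

Lemma orbifold_bracket_bilin : bilin orbifold_bracket.
Proof.
split=> [y|x]; apply: linear_of_sum => g; apply: linear_of_sum => h a u w.
  rewrite !ffunE (kappa_bilin.1 _); exact: (ract_bilin L).1.
rewrite !ffunE mulmxDr -scalemxAr (kappa_bilin.2 _); exact: (ract_bilin L).1.
Qed.

Lemma orbifold_bracket_vg u w g h : orbifold_bracket (vg u g) (vg w h) =
  VG_ract (kappa u (rG g *m w)) (gelt K (g * h)%g).
Proof.
have ract0 k : VG_ract (0 : VG K gT n) (gelt K k) = 0.
  exact: (linf0 ((ract_bilin L).1 (gelt K k))).
rewrite /orbifold_bracket (bigD1 g) //= [X in _ + X]big1 ?addr0 => [|k kg].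
  rewrite (bigD1 h) //= big1 ?addr0 => [|k kh]; first by rewrite !ffunE !eqxx.
  rewrite [vg w h k]ffunE (negbTE kh) mulmx0.
  by rewrite (linf0 (kappa_bilin.2 _)) ract0.
rewrite big1 // => m _; rewrite [vg u g k]ffunE (negbTE kg).
by rewrite (linf0 (kappa_bilin.1 _)) ract0.
Qed.

Lemma orbifold_bracket_balanced x r y :
  orbifold_bracket (Defs.ract x r) y = orbifold_bracket x (lact r y).
Proof.
have [brl brr] := orbifold_bracket_bilin.
move: r; apply: grpalg_eq => [||k].
- apply: (linear_comp (f := orbifold_bracket ^~ y) (g := fun r => Defs.ract x r)).
    exact: brl.
  exact: (ract_bilin L).2.
- apply: (linear_comp (f := orbifold_bracket x) (g := fun r => lact r y)).
    exact: brr.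
  exact: (lact_bilin L).1.
move: x; apply: VG_eq => [||u g].
- apply: (linear_comp (f := orbifold_bracket ^~ y)
    (g := fun x => Defs.ract (x : L) (gelt K k))); first exact: brl.
  exact: (ract_bilin L).1.
- exact: brl.
move: y; apply: VG_eq => [||w h].
- exact: brr.
- apply: (linear_comp (f := orbifold_bracket (vg u g))
    (g := fun y => lact (gelt K k) (y : L))); first exact: brr.
  exact: (lact_bilin L).2.
have -> : Defs.ract (vg u g : L) (gelt K k) = vg u (g * k)%g by exact: VG_ract_gen.
have -> : lact (gelt K k) (vg w h : L) = vg (rG k *m w) (k * h)%g.
  exact: VG_lact_gen.
by rewrite !orbifold_bracket_vg mulmxA -repr_mxM ?inE // mulgA.
Qed.

Hypothesis kappa_inv : forall k u w, lact (gelt K k) (kappa u w : L) =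
  Defs.ract (kappa (rG k *m u) (rG k *m w) : L) (gelt K k).

(** Linearity on the left is the invariance of kappa: by [kappa_inv], k kappa (u, g w) = kappa (k u,
    k g w) k. *)
Lemma orbifold_bracket_lr r x y s :
  orbifold_bracket (lact r x) (Defs.ract y s) =
  lact r (Defs.ract (orbifold_bracket x y) s).
Proof.
have [brl brr] := orbifold_bracket_bilin.
have [lactl lactr] := lact_bilin L; have [ractl ractr] := ract_bilin L.
move: r; apply: grpalg_eq => [||k].
- apply: (linear_comp (f := orbifold_bracket ^~ _) (g := fun r => lact r x)).
    exact: brl.
  exact: lactl.
- exact: lactl.
move: s; apply: grpalg_eq => [||m].
- apply: (linear_comp (f := orbifold_bracket _) (g := fun s => Defs.ract y s)).
    exact: brr.
  exact: ractr.
- apply: (linear_comp (f := fun z : L => lact (gelt K k) z)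
    (g := fun s => Defs.ract (orbifold_bracket x y) s)); first exact: lactr.
  exact: ractr.
move: x; apply: VG_eq => [||u g].
- apply: (linear_comp (f := orbifold_bracket ^~ _)
    (g := fun x => lact (gelt K k) (x : L))); first exact: brl.
  exact: lactr.
- apply: (linear_comp (f := fun z : L => lact (gelt K k) z)
    (g := fun x => Defs.ract (orbifold_bracket x y) (gelt K m))); first exact: lactr.
  apply: (linear_comp (f := fun z : L => Defs.ract z (gelt K m))
    (g := orbifold_bracket ^~ y)); first exact: ractl.
  exact: brl.
move: y; apply: VG_eq => [||w h].
- apply: (linear_comp (f := orbifold_bracket _)
    (g := fun x => Defs.ract (x : L) (gelt K m))); first exact: brr.
  exact: ractl.
- apply: (linear_comp (f := fun z : L => lact (gelt K k) z)
    (g := fun y => Defs.ract (orbifold_bracket _ y) (gelt K m))); first exact: lactr.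
  apply: (linear_comp (f := fun z : L => Defs.ract z (gelt K m))
    (g := orbifold_bracket (vg u g))); first exact: ractl.
  exact: brr.
have -> : Defs.ract (vg w h : L) (gelt K m) = vg w (h * m)%g by exact: VG_ract_gen.
have -> : lact (gelt K k) (vg u g : L) = vg (rG k *m u) (k * g)%g.
  exact: VG_lact_gen.
rewrite !orbifold_bracket_vg -lractA.
have -> : lact (gelt K k) (VG_ract (kappa u (rG g *m w)) (gelt K (g * h)%g) : L) =
    Defs.ract (Defs.ract (kappa (rG k *m u) (rG k *m (rG g *m w)) : L) (gelt K k))
      (gelt K (g * h)%g).
  by rewrite -kappa_inv lractA.
rewrite -!ractM !geltM mulmxA -repr_mxM ?inE //.
by rewrite !mulgA.
Qed.

End BracketFromParameter.

(** * The Jacobi identity for color commutators in an associative algebra *)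

Section ColorJacobi.
Variables (K : fieldType) (B : algType K).
Implicit Types (x y z : B) (p r s : K).

Lemma double_bracket x y z p r s : p != 0 ->
  p *: (x * (y * z - r *: (z * y)) - (s * p^-1) *: ((y * z - r *: (z * y)) * x)) =
  p *: (x * y * z) - (p * r) *: (x * z * y) - s *: (y * z * x)
  + (s * r) *: (z * y * x).
Proof.
move=> p0; have ps : p * (s * p^-1) = s by rewrite mulrCA mulfV // mulr1.
rewrite scalerBr scalerA ps mulrBr mulrBl -scalerAl -scalerAr !mulrA !scalerBr.
by rewrite !scalerA opprB addrA addrAC.
Qed.

(** Here [ab], [bc], [ca] are the values of eps at the degrees of (x, y), (y, z), (z, x), so that
    eps at |x| and |y| |z| is ab ca^-1. Each of the six orderings of x, y, z appears twice, with
    opposite coefficients. *)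
Lemma color_jacobi_identity x y z (ab bc ca : K) :
  ab != 0 -> bc != 0 -> ca != 0 ->
  ca *: (x * (y * z - bc *: (z * y)) - (ab * ca^-1) *: ((y * z - bc *: (z * y)) * x))
  + ab *: (y * (z * x - ca *: (x * z)) - (bc * ab^-1) *: ((z * x - ca *: (x * z)) * y))
  + bc *: (z * (x * y - ab *: (y * x)) - (ca * bc^-1) *: ((x * y - ab *: (y * x)) * z))
  = 0.
Proof.
move=> ab0 bc0 ca0; rewrite !double_bracket //.
rewrite [bc * ca]mulrC [bc * ab]mulrC [ca * ab]mulrC.
rewrite (AC (4*4*4) ((1*11)*(8*2)*(5*3)*(4*10)*(12*6)*(9*7)))%AC /=.
by rewrite !subrr !addr0.
Qed.

End ColorJacobi.

Lemma api_nested_bracket (K : fieldType) (B : algType K) (S : B -> Prop) x y z w e :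
  ideal_of S (x * y - e *: (y * x) - z) -> ideal_of S (w - y) ->
  api S z = api S (x * w - e *: (w * x)).
Proof.
move=> /apiP/esym -> /apiP wy.
by rewrite !(linfB (api_linear S)) !(linfZ (api_linear S)) !apiM wy.
Qed.

Lemma linear3_eq (K : fieldType) (U U' W : lmodType K) (f : U -> W) (h : U' -> W)
    a c e x y z x' y' z' :
  linear f -> linear h -> f x = h x' -> f y = h y' -> f z = h z' ->
  f (a *: x + c *: y + e *: z) = h (a *: x' + c *: y' + e *: z').
Proof.
move=> lf lh xx yy zz.
by rewrite !(linfD lf) !(linfZ lf) !(linfD lh) !(linfZ lh) xx yy zz.
Qed.

Section OrbifoldIsEnvelopingAlgebra.
Variables (K : fieldType) (gT : finGroupType) (n : nat).
Variable rG : mx_representation K [set: gT]%G n.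
Local Notation V := 'cV[K]_n.
Local Notation L := (VG_bimodule rG).
Hypothesis abelG : forall g h : gT, (g * h = h * g)%g.
Variables (b : n.-tuple V) (q : 'I_n -> 'I_n -> K) (kappa : V -> V -> VG K gT n).
Hypothesis diag_b : diagonal_basis rG b.
Hypothesis q_sys : quantum_system q.
Hypothesis kappa_param : parameter_function b q kappa.
Hypothesis pbw : PBW_property rG b q kappa.
Hypothesis vanish : strong_vanishing rG b q kappa.

Lemma orbifold_YD : exists (A : zmodType) (eps : A -> A -> K)
    (grG : A -> grpalg K gT -> Prop) (grV : A -> V -> Prop) (grL : A -> L -> Prop)
    (br : L -> L -> L),
  [/\ antisymmetric_bicharacter eps, Yetter_Drinfeld_color_Lie_ring eps grG grV grL br,
      purely_positive_part eps grV
    & exists f : {rmorphism qdoa rG b q kappa -> uea eps grL br},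
        linear f /\ bijective f].
Proof.
have [basis_b b_diag] := diag_b.
have [kappa_bilin kappa_antisym] := kappa_param.
have [q_neq0 qii qV] := q_sys.
pose v i := tnth b i.
have [chi chiE] : exists chi : 'I_n -> gT -> K, forall g i, rG g *m v i = chi i g *: v i.
  by exists (fun i g => projT1 (cid (b_diag g i))) => g i; case: cid.
have chi1 i : chi i 1%g = 1 by exact: (diag_char1 basis_b chiE).
have chi_neq0 i g : chi i g != 0 by exact: (diag_char_neq0 basis_b chiE).
pose c i j r g := coord b r (kappa (v i) (v j) g).
have c_vanish i j k r g : c i j r g != 0 -> chi k g = q i k * q j k * q k r.
  move=> /vanish-/(_ k) E; apply: (basis_scale_inj basis_b (i := k)).
  by rewrite -chiE.
have c_inv i j r g h : c i j r g != 0 -> chi i h * chi j h = chi r h.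
  exact: (kappa_invariant_coef basis_b chiE pbw h abelG).
pose E (x y : 'I_n + gT) : K := match x, y with
  | inl i, inl j => q i j
  | inl i, inr g => (chi i g)^-1
  | inr g, inl i => chi i g
  | inr g, inr h => 1 end.
have E_neq0 x y : E x y != 0.
  by case: x y => [i|g] [j|h] //=; rewrite ?invr_eq0 ?oner_neq0.
have E_antisym x y : E y x = (E x y)^-1.
  by case: x y => [i|g] [j|h] /=; rewrite ?invrK ?invr1.
have [A [eps [d [eps_bi epsE nondeg]]]] := nondegenerate_bicharacter E_neq0 E_antisym.
have [[eps_neq0 epsDr epsDl] epsV] := eps_bi.
pose dV i := d (inl i); pose dG g := d (inr g).
pose D i g := dV i + dG g.
have dGM g h : dG (g * h)%g = dG g + dG h.
  (* The degrees of g h and of g plus h pair alike with every generator because the chi_i are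
     multiplicative; nondegeneracy then identifies them. *)
  apply: nondeg => -[i|k]; rewrite epsDl /dG !epsE /= ?mulr1 //.
  exact: (diag_charM basis_b chiE).
have c_deg i j r g : c i j r g != 0 -> dV i + dV j = dV r + dG g.
  (* Against the generator v_k the equality is the strong vanishing condition, against the generator
     h it is the invariance of kappa. *)
  move=> c0; apply: nondeg => -[k|h]; rewrite !epsDl /dV /dG !epsE /=.
    by rewrite (c_vanish _ _ k _ _ c0) [RHS]mulrC -[RHS]mulrA [q r k]qV mulfV // mulr1.
  by rewrite mulr1 -invfM (c_inv _ _ _ _ h c0).
have eps_D i j g h : eps (D i g) (D j h) = q i j * chi j g * (chi i h)^-1.
  by rewrite epsDl !epsDr /dV /dG !epsE /= mulr1 mulrAC.
pose coG (g : gT) (r : grpalg K gT) : K^o := r g.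
pose coV (i : 'I_n) (x : V) : K^o := coord b i x.
pose coL (ig : 'I_n * gT) (x : L) : K^o := coord b ig.1 (x ig.2).
pose DL (ig : 'I_n * gT) := D ig.1 ig.2.
pose eL (ig : 'I_n * gT) : L := vg (v ig.1) ig.2.
have coG_lin g : linear (coG g) by move=> k y z; rewrite /coG !ffunE.
have coGE g h : coG g (gelt K h) = (g == h)%:R.
  by rewrite /coG /gelt /sgen ffunE; case: eqP.
have coG_sum r : r = \sum_g (coG g r : K) *: gelt K g by exact: grpalg_decomp.
have coV_lin i : linear (coV i) by move=> k y z; rewrite /coV linearP.
have coVE i j : coV i (v j) = (i == j)%:R by exact: (coord_v basis_b).
have coV_sum x : x = \sum_i (coV i x : K) *: v i by exact: (basis_coord basis_b).
have coL_lin ig : linear (coL ig) by move=> k y z; rewrite /coL !ffunE linearP.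
have coLE ig jh : coL ig (eL jh) = (ig == jh)%:R.
  case: ig jh => [i g] [j h]; rewrite /coL /eL ffunE /= xpair_eqE.
  case: (g =P h) => _; last by rewrite linear0 andbF.
  by rewrite (coord_v basis_b) andbT.
have coL_sum y : y = \sum_ig (coL ig y : K) *: eL ig.
  by rewrite [LHS](VG_decomp basis_b) pair_bigA.
pose grG := basis_gr dG coG; pose grV := basis_gr dV coV; pose grL := basis_gr DL coL.
have gradG : grading grG by exact: (basis_grading dG coG_lin coGE coG_sum).
have gradV : grading grV by exact: (basis_grading dV coV_lin coVE coV_sum).
have gradL : grading grL by exact: (basis_grading DL coL_lin coLE coL_sum).
have grG_gen g : grG (dG g) (gelt K g) by apply: basis_gr_e.
have grV_gen i : grV (dV i) (v i) by apply: basis_gr_e.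
have grL_gen i g : grL (D i g) (vg (v i) g) by apply: (basis_gr_e (i := (i, g)) DL coLE).
pose br := orbifold_bracket (rG := rG) kappa.
have br_bilin : bilin br by exact: orbifold_bracket_bilin.
have vgZ a u g : vg (a *: u) g = a *: vg u g :> VG K gT n.
  exact: linfZ (@vg_linear K gT n g) a u.
have br_gen i j g h : br (vg (v i) g) (vg (v j) h) =
    chi j g *: VG_ract (kappa (v i) (v j)) (gelt K (g * h)%g).
  rewrite /br orbifold_bracket_vg // chiE (linfZ (kappa_bilin.2 _)).
  exact: (linfZ ((ract_bilin L).1 _)).
have kappa_inv k u w : lact (gelt K k) (kappa u w : L) =
    Defs.ract (kappa (rG k *m u) (rG k *m w) : L) (gelt K k).
  have [lactl lactr] := lact_bilin L; have [ractl ractr] := ract_bilin L.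
  have lmul : linear (fun u : V => rG k *m u).
    by move=> a x y; rewrite mulmxDr -scalemxAr.
  move: u; apply: (basis_linear_eq coV_sum) => [||i].
  - apply: (linear_comp (f := fun z : L => lact (gelt K k) z) (g := kappa ^~ w)).
      exact: lactr.
    exact: kappa_bilin.1.
  - apply: (linear_comp (f := fun z : L => Defs.ract z (gelt K k))
      (g := fun u => kappa (rG k *m u) _)); first exact: ractl.
    by apply: (linear_comp (f := kappa ^~ _)); first exact: kappa_bilin.1.
  move: w; apply: (basis_linear_eq coV_sum) => [||j].
  - apply: (linear_comp (f := fun z : L => lact (gelt K k) z) (g := kappa (v i))).
      exact: lactr.
    exact: kappa_bilin.2.
  - apply: (linear_comp (f := fun z : L => Defs.ract z (gelt K k))
      (g := fun w => kappa _ (rG k *m w))); first exact: ractl.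
    by apply: (linear_comp (f := kappa _)); first exact: kappa_bilin.2.
  rewrite !chiE (linfZ (kappa_bilin.1 _)) (linfZ (kappa_bilin.2 _)) scalerA.
  apply: etrans (kappa_lact basis_b chiE pbw i j k) _.
  exact: esym (linfZ (ractl _) _ _).
have grL_br a a' x y : grL a x -> grL a' y -> grL (a + a') (br x y).
  apply: (graded_bilin coL_sum coL_sum gradL br_bilin) => -[i g] [j h].
  rewrite /eL /= br_gen; apply: (grZ gradL) => -[r k].
  rewrite /coL /= VG_ract_gelt => /c_deg E'.
  (* The coefficient of v_r k in the bracket is that of v_r k (g h)^-1 in kappa; [dGM] adds the
     degree of g h back. *)
  rewrite /DL /D /= -[k in dG k](mulgKV (g * h)%g) dGM addrA -E' dGM.
  by rewrite addrACA.
have color : color_Lie_ring eps grG grL br.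
  split.
  - split=> // a a' r s.
    apply: (graded_bilin coG_sum coG_sum gradG) => [|g h].
      by split=> r'; [exact: mulr_linear|exact: mull_linear].
    by rewrite geltM -dGM.
  - split=> // a1 a2 a3 r x s ra xa sa.
    have lactM' : grL (a1 + a2) (lact r x).
      apply: (graded_bilin coG_sum coL_sum gradL (lact_bilin L)) ra xa => g [i h].
      have -> : lact (gelt K g) (eL (i, h)) = chi i g *: vg (v i) (g * h)%g.
        by apply: etrans (VG_lact_gen rG g (v i) h) _; rewrite chiE vgZ.
      apply: (grZ gradL); have := grL_gen i (g * h)%g.
      by rewrite /DL /D /= dGM addrCA.
    apply: (graded_bilin coL_sum coG_sum gradL (ract_bilin L)) lactM' sa => -[i h] g.
    have -> : Defs.ract (eL (i, h)) (gelt K g) = vg (v i) (h * g)%g.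
      exact: VG_ract_gen.
    by have := grL_gen i (h * g)%g; rewrite /DL /D /= dGM addrA.
  - exact: br_bilin.
  - by move=> r x y s; exact: orbifold_bracket_lr.
  - by move=> x r y; exact: orbifold_bracket_balanced.
  - by move=> x y a a' [xa _] [ya _]; exact: grL_br.
  - move=> x y a a' [xa _] [ya _].
    have Fbil : bilin (fun x y : L => eps a a' *: br y x + br x y).
      split=> z; apply: linear_comb.
      + exact: br_bilin.2.
      + exact: br_bilin.1.
      + exact: br_bilin.1.
      + exact: br_bilin.2.
    have := basis_bilin_eq0 (x := x) (y := y) coL_sum Fbil.
    move=> F0; apply/eqP; rewrite -subr_eq0 scaleNr opprK addrC; apply/eqP/F0.
    move=> [i g] [j h] /xa Da /ya Da'; rewrite -Da -Da' /DL /eL /= eps_D !br_gen.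
    rewrite [(h * g)%g]abelG scalerA -mulrA mulVf // mulr1.
    rewrite [kappa (v i) (v j)]kappa_antisym.
    have -> : VG_ract (- q i j *: kappa (v j) (v i)) (gelt K (g * h)%g) =
        - q i j *: VG_ract (kappa (v j) (v i)) (gelt K (g * h)%g).
      exact: (linfZ ((ract_bilin L).1 _)).
    by rewrite scalerA mulrN [chi j g * _]mulrC scaleNr subrr.
  - move=> x y z a1 a2 a3 [xa _] [ya _] [za _].
    pose F := @skew_VG K gT n rG; have F_lin : linear F by exact: skew_VG_linear.
    pose S := @qdoa_rel K gT n rG b q kappa.
    have rel u w s t : grL s u -> grL t w -> ideal_of S
        (F u * F w - eps s t *: (F w * F u) - F (br u w)).
      apply: (color_relation basis_b chiE abelG br_bilin br_gen eps_D).
      by move=> s' u' us i g; apply: (us (i, g)).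
    have nested u w t s1 s2 s3 : grL s1 u -> grL s2 w -> grL s3 t ->
        api S (F (br u (br w t))) = api S (F u * (F w * F t - eps s2 s3 *: (F t * F w))
          - (eps s1 s2 * (eps s3 s1)^-1) *:
            ((F w * F t - eps s2 s3 *: (F t * F w)) * F u)).
      (* The scalar is the value of [eps] at s1 and s2 + s3, the degree of the inner bracket. *)
      move=> us ws ts; rewrite -epsV -epsDr.
      exact: (api_nested_bracket (rel _ _ _ _ us (grL_br _ _ _ _ ws ts)) (rel _ _ _ _ ws ts)).
    (* Since L embeds in the orbifold algebra, the identity may be checked there, where brackets are
       color commutators and associativity gives it. *)
    apply: (skew_VG_inj basis_b pbw); rewrite -[skew_VG rG _]subr0; apply/apiP.
    have AF_lin : linear (fun u : L => api S (F u)).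
      by apply: (linear_comp (f := api S)); [exact: api_linear|exact: F_lin].
    apply: etrans (congr1 (api S) (color_jacobi_identity (F x) (F y) (F z)
      (eps_neq0 a1 a2) (eps_neq0 a2 a3) (eps_neq0 a3 a1))).
    apply: (linear3_eq _ _ _ AF_lin (api_linear S)).
    - exact: nested.
    - exact: nested.
    - exact: nested.
exists A, eps, grG, grV, grL, br; split=> //.
- split=> //; first last.
  (* Any degree a of g equals [dG g], because the coordinate of g at itself is 1. *)
  + move=> g a x a' ga [xa x0]; have := ga g.
    rewrite (coGE g g) eqxx oner_neq0 => /(_ isT) <-.
    rewrite {1}[x]coV_sum {2}[x]coV_sum mulmx_sumr scaler_sumr; apply: eq_bigr => i _.
    have [->|/xa<-] := eqVneq (coV i x) 0; first by rewrite !scale0r mulmx0 scaler0.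
    by rewrite -scalemxAr chiE !scalerA /dG /dV epsE mulrC.
  + move=> x a g a' [xa _] ga; have := ga g.
    rewrite (coGE g g) eqxx oner_neq0 => /(_ isT) <- [i h].
    rewrite /coL ffunE /=; case: (h =P g) => [->|_]; last by rewrite linear0 eqxx.
    by move=> /xa; rewrite /DL /D /= => ->.
  + by move=> g; exists (dG g); exact: grG_gen.
- move=> x a x0 xa; have [i xi] : exists i, coV i x != 0.
    apply/existsP; apply: contraNT x0; rewrite negb_exists => /forallP H.
    by apply/eqP/(co_eq0 coV_sum) => i; apply/eqP; have := H i; rewrite negbK.
  by rewrite -(xa _ xi) /dV epsE /= qii.
- have [] := uea_qdoa_iso basis_b chiE abelG br_bilin br_gen eps_D _ grL_gen => //.
  by move=> a x xa i g; apply: (xa (i, g)).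
Qed.

End OrbifoldIsEnvelopingAlgebra.

Theorem theorem7p4 (K : fieldType) (charK : [pchar K] =i pred0)
    (gT : finGroupType) (abG : abelian [set: gT]) (n : nat)
    (rG : mx_representation K [set: gT]%G n)
    (diagG : exists b : n.-tuple 'cV[K]_n, diagonal_basis rG b) :
  (forall (A : zmodType) (eps : A -> A -> K)
      (grG : A -> grpalg K gT -> Prop) (grV : A -> 'cV[K]_n -> Prop)
      (grL : A -> VG_bimodule rG -> Prop)
      (br : VG_bimodule rG -> VG_bimodule rG -> VG_bimodule rG),
    antisymmetric_bicharacter eps ->
    Yetter_Drinfeld_color_Lie_ring eps grG grV grL br ->
    purely_positive_part eps grV ->
    trivial_on_group eps grG ->
    exists (b : n.-tuple 'cV[K]_n) (q : 'I_n -> 'I_n -> K)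
        (kappa : 'cV[K]_n -> 'cV[K]_n -> VG K gT n),
      [/\ diagonal_basis rG b,
          quantum_system q,
          parameter_function b q kappa,
          PBW_property rG b q kappa
        & exists f : {rmorphism uea eps grL br -> qdoa rG b q kappa},
            linear f /\ bijective f])
  /\
  (forall (b : n.-tuple 'cV[K]_n) (q : 'I_n -> 'I_n -> K)
      (kappa : 'cV[K]_n -> 'cV[K]_n -> VG K gT n),
    diagonal_basis rG b ->
    quantum_system q ->
    parameter_function b q kappa ->
    PBW_property rG b q kappa ->
    strong_vanishing rG b q kappa ->
    exists (A : zmodType) (eps : A -> A -> K)
        (grG : A -> grpalg K gT -> Prop) (grV : A -> 'cV[K]_n -> Prop)
        (grL : A -> VG_bimodule rG -> Prop)
        (br : VG_bimodule rG -> VG_bimodule rG -> VG_bimodule rG),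
      [/\ antisymmetric_bicharacter eps,
          Yetter_Drinfeld_color_Lie_ring eps grG grV grL br,
          purely_positive_part eps grV
        & exists f : {rmorphism qdoa rG b q kappa -> uea eps grL br},
            linear f /\ bijective f]).
Proof.
have abG' (g h : gT) : (g * h = h * g)%g.
  by apply/commute_sym/(centsP abG); rewrite inE.
have two_neq0 : (2%:R : K) != 0 by have /negbT := charK 2%N; rewrite inE.
split=> [A eps grG grV grL br eps_bi yd pos trivG|b q kappa].
  exact: (YD_orbifold abG' two_neq0 eps_bi yd pos trivG).
exact: orbifold_YD.
Qed.
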